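(* Assume (A1)–(A2) of the context. Let $\xi\in C([0,T]:\mathbb{R}^d)$ be such that $I(\xi)<\infty$, and fix $\gamma\in(0,1)$. Then there exists $\xi^*\in C([0,T]:\mathbb{R}^d)$ such that $\sup_{0\le s\le T}\|\xi(s)-\xi^*(s)\|<\gamma$, and there is $(u^*,\varphi^*=(\varphi^*_{ij}),\pi^*=(\pi^*_i))\in\mathcal{A}(\xi^* )$ with the following properties. 1. For some constants $m_2,m_3\in(0,\infty)$ and all $(s,z)\in[0,T]\times[0,\zeta]$ and $(i,j)\in\mathbb{T}$, $m_3\ge\varphi^*_{ij}(s,z)\ge m_2$. 2. There is a measurable map $\varrho:[0,T]\times\mathbb{R}^d\to\mathcal{P}(\mathbb{L})$ such that for all $(s,x)\in[0,T]\times\mathbb{R}^d$ and $j\in\mathbb{L}$, $\sum_{i\in\mathbb{L}}\varrho_i(s,x)A_{ij}^{\varphi^*_{i,\cdot}(s,\cdot)}(x)=0$, and for some $c_1\in(0,\infty)$, $$\sup_{s\in[0,T]}\max_{i\in\mathbb{L}}|\varrho_i(s,x)-\varrho_i(s,\tilde x)|\le c_1\|x-\tilde x\|\ \text{ for all }x,\tilde x\in\mathbb{R}^d,\qquad \inf_{(s,x)\in[0,T]\times\mathbb{R}^d}\min_{i\in\mathbb{L}}\varrho_i(s,x)\ge c_1^{-1}.$$ 3. If for any $(s,x)\in[0,T]\times\mathbb{R}^d$, $\bar\pi\in\mathcal{P}(\mathbb{L})$ satisfies $\sum_{i\in\mathbb{L}}\bar\pi_iA_{ij}^{\varphi^*_{i,\cdot}(s,\cdot)}(x)=0$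 for all $j\in\mathbb{L}$, then $\bar\pi=\varrho(s,x)$. In particular, $\varrho(s,\xi^*(s))=\pi^*(s)$. 4. If for the given $u^*$ and $\varphi^*$, any other pair $(\tilde\xi,\tilde\pi)$, with $\tilde\xi\in C([0,T]:\mathbb{R}^d)$ and $\tilde\pi:[0,T]\to\mathcal{P}(\mathbb{L})$ measurable, satisfies $$\tilde\xi(t)=x_0+\sum_{j\in\mathbb{L}}\int_0^tb_j(\tilde\xi(s))\tilde\pi_j(s)ds+\sum_{j\in\mathbb{L}}\int_0^ta_j(\tilde\xi(s))u^*_j(s)\tilde\pi_j(s)ds,\quad t\in[0,T],$$ and $\sum_{i\in\mathbb{L}}\tilde\pi_i(s)A_{ij}^{\varphi^*_{i,\cdot}(s,\cdot)}(\tilde\xi(s))=0$ for a.e. $s\in[0,T]$ and all $j\in\mathbb{L}$, then $(\tilde\xi,\tilde\pi)=(\xi^*,\pi^* )$. 5. The cost associated with $(u^*,\varphi^* )$ satisfies $$\sum_{i\in\mathbb{L}}\frac12\int_0^T\|u^*_i(s)\|^2\pi^*_i(s)ds+\sum_{(i,j)\in\mathbb{T}}\int_{[0,\zeta]\times[0,T]}\ell(\varphi^*_{ij}(s,z))\pi^*_i(s)\lambda_\zeta(dz)ds\le I(\xi)+\gamma.$$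
   Context: Fix $d,m\in\mathbb{N}$, $T\in(0,\infty)$, a finite set $\mathbb{L}=\{1,\dots,|\mathbb{L}|\}$, $\mathbb{G}=\mathbb{R}^d\times\mathbb{L}$, and $x_0\in\mathbb{R}^d$. Let $b:\mathbb{G}\to\mathbb{R}^d$, $a:\mathbb{G}\to\mathbb{R}^{d\times m}$, $c:\mathbb{G}\to[0,\infty)$, $r:\mathbb{R}^d\times\mathbb{L}\times\mathbb{L}\to[0,1]$; write $b_y(x)=b(x,y)$, $a_y(x)=a(x,y)$, $c_y(x)=c(x,y)$, $r_{yy'}(x)=r(x,y,y')$. (A1) $b_y,a_y,c_y,r_{yy'}$ are Lipschitz in $x\in\mathbb{R}^d$ (uniformly in $y,y'\in\mathbb{L}$); $c$ is bounded; for all $(x,y)\in\mathbb{G}$, $\sum_{y'\in\mathbb{L}}r_{yy'}(x)=1$ and $r_{yy}(x)=0$. (A2) Let $\hat r^1_{yz}(x)=r_{yz}(x)$, $\hat r^n_{yz}(x)=\sum_{y'}\hat r^{n-1}_{yy'}(x)r_{y'z}(x)$ for $n>1$, and $\mathbb{T}=\{(y,y')\in\mathbb{L}\times\mathbb{L}: r_{yy'}(x)>0\text{ for some }x\in\mathbb{R}^d\}$. Then $\alpha:=\inf_x\min_{y,z}\sum_{n=1}^{|\mathbb{L}|}\hat r^n_{yz}(x)>0$, $\underline\varsigma:=\inf_x\min_y c_y(x)>0$, $\kappa_3:=\inf_x\min_{(y,y')\in\mathbb{T}}r_{yy'}(x)>0$. Let $\zeta=\sup_{(x,y)\in\mathbb{G}}c_y(x)+1$,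 $\lambda_\zeta$ be Lebesgue measure on $[0,\zeta]$, and $E_{ij}(x)=[0,c_i(x)r_{ij}(x)]$ for $i\ne j$. $C([0,T]:\mathbb{R}^d)$ is the space of continuous functions from $[0,T]$ to $\mathbb{R}^d$ with the uniform topology; $\mathcal{P}(\mathbb{L})$ is the set of probability measures on $\mathbb{L}$. Let $\ell(x)=x\log x-x+1$, $x\ge0$. For a family $\psi=(\psi_j)_{j\in\mathbb{L}}$ of measurable maps $\psi_j:[0,\zeta]\to\mathbb{R}_+$ and $x\in\mathbb{R}^d$ let, for $i\neq j$, $A^\psi_{ij}(x)=\int_{E_{ij}(x)}\psi_j(z)\lambda_\zeta(dz)$, and $A^\psi_{jj}(x)=-\sum_{y\ne j}A^\psi_{jy}(x)$. For $\xi\in C([0,T]:\mathbb{R}^d)$ let $$I(\xi)=\inf_{(u,\varphi,\pi)\in\mathcal{A}(\xi)}\Big\{\sum_{i\in\mathbb{L}}\frac12\int_0^T\|u_i(s)\|^2\pi_i(s)ds+\sum_{(i,j)\in\mathbb{T}}\int_{[0,\zeta]\times[0,T]}\ell(\varphi_{ij}(s,z))\pi_i(s)\lambda_\zeta(dz)ds\Big\},$$ where $\inf\emptyset=\infty$ and $\mathcal{A}(\xi)$ is the set of all $(u,\varphi,\pi)$ with: $u=(u_i)_{i\in\mathbb{L}}$, $u_i:[0,T]\to\mathbb{R}^m$ measurable, $\int_0^T\|u_i(s)\|^2\pi_i(s)ds<\infty$ for each $i$; $\varphi=(\varphi_{ij})_{(i,j)\in\mathbb{T}}$, $\varphi_{ij}:[0,T]\times[0,\zeta]\to\mathbb{R}_+$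 measurable; $\pi=(\pi_i)_{i\in\mathbb L}:[0,T]\to\mathcal{P}(\mathbb{L})$ measurable; for all $t\in[0,T]$ $$\xi(t)=x_0+\sum_{j\in\mathbb{L}}\int_0^tb_j(\xi(s))\pi_j(s)ds+\sum_{j\in\mathbb{L}}\int_0^ta_j(\xi(s))u_j(s)\pi_j(s)ds;$$ and for a.e. $s\in[0,T]$ and all $j\in\mathbb{L}$, $\sum_{i\in\mathbb{L}}\pi_i(s)A_{ij}^{\varphi_{i,\cdot}(s,\cdot)}(\xi(s))=0$, where $\varphi_{i,\cdot}=(\varphi_{ij})_{j\in\mathbb{L}}$ with $\varphi_{ij}=1$ if $(i,j)\notin\mathbb{T}$ (the same convention applies to $\varphi^*$), and with the conventions $0\cdot\infty=0$, $\infty-\infty=\infty$.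
   Formalization: In item 4 the equality of π̃ and π* is proved for almost every s in [0,T] (ξ̃ = ξ* everywhere): π̃ is constrained only for a.e. s, so changing π* at one time shows that equality at every s fails. *)

(* Defs.v *)
From HB Require Import structures.
From mathcomp Require Import all_boot all_order all_algebra.
From mathcomp Require Import all_classical all_reals all_analysis.

Set Implicit Arguments.
Unset Strict Implicit.
Unset Printing Implicit Defensive.

Import Order.TTheory GRing.Theory Num.Theory.
Import numFieldNormedType.Exports.

Local Open Scope classical_set_scope.
Local Open Scope ring_scope.

(* R^d is 'cV[R]_d with its product topology.  The library norm on matrices is
   the sup norm, so the Euclidean (for matrices: Frobenius) norm is defined
   here. *)
Definition enorm {R : realType} {p q : nat} (A : 'M[R]_(p, q)) : R :=
  Num.sqrt (\sum_i \sum_j A i j ^+ 2).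

Definition borel (U : ptopologicalType) : Type := g_sigma_algebraType (@open U).
HB.instance Definition _ (U : ptopologicalType) :=
  Measurable.copy (borel U) (g_sigma_algebraType (@open U)).

(* C([0,T] : R^d); the values of xi outside [0,T] are irrelevant. *)
Definition continuous_path {R : realType} {d : nat} (T : R) (xi : R -> 'cV[R]_d)
  : Prop := {within `[0, T], continuous xi}.

(* The set L is 'I_l, and P(L) is the standard simplex. *)
Definition prob_vec {R : realType} {l : nat} (p : 'I_l -> R) : Prop :=
  (forall i, 0 <= p i) /\ \sum_i p i = 1.

(* Measurability of maps into P(L): the sigma-algebra on P(L) is generated by
   the evaluations p |-> p i. *)
Definition measurable_prob {R : realType} {l : nat} (T : R)
    (pi : R -> 'I_l -> R) : Prop :=
  (forall s, 0 <= s <= T -> prob_vec (pi s)) /\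
  forall i, measurable_fun `[0, T] (fun s => pi s i).

Definition ell {R : realType} (x : R) : R := x * ln x - x + 1.

(* Integrals of R^d-valued functions, taken componentwise. *)
Definition vintegrable {R : realType} {d : nat} (D : set R)
    (f : R -> 'cV[R]_d) : Prop :=
  forall k, lebesgue_measure.-integrable D (fun s => (f s k 0)%:E).

Definition vint {R : realType} {d : nat} (D : set R)
    (f : R -> 'cV[R]_d) : 'cV[R]_d :=
  \col_k (\int[lebesgue_measure]_(s in D) f s k 0).

Section Model.
Context {R : realType} {d m l : nat}.
Implicit Types (x : 'cV[R]_d) (xi : R -> 'cV[R]_d) (pi : R -> 'I_l -> R).
Implicit Types (u : 'I_l -> R -> 'cV[R]_m) (phi : 'I_l -> 'I_l -> R -> R -> R).

Variable b : 'cV[R]_d -> 'I_l -> 'cV[R]_d.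
Variable a : 'cV[R]_d -> 'I_l -> 'M[R]_(d, m).
Variable c : 'cV[R]_d -> 'I_l -> R.
Variable r : 'cV[R]_d -> 'I_l -> 'I_l -> R.
Variable x0 : 'cV[R]_d.
Variable T : R.

Definition A1 : Prop :=
  [/\ exists K : R, forall x x' y y',
        [/\ enorm (b x y - b x' y) <= K * enorm (x - x'),
            enorm (a x y - a x' y) <= K * enorm (x - x'),
            `|c x y - c x' y| <= K * enorm (x - x') &
            `|r x y y' - r x' y y'| <= K * enorm (x - x')],
      exists M : R, forall x y, c x y <= M,
      forall x y, \sum_y' r x y y' = 1 &
      forall x y, r x y y = 0].

(* rhat n is the paper's \hat r^{n+1}. *)
Fixpoint rhat (n : nat) (x : 'cV[R]_d) (y z : 'I_l) : R :=
  if n is n'.+1 then \sum_y' rhat n' x y y' * r x y' z else r x y z.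

Definition TT : set ('I_l * 'I_l) := [set p | exists x, 0 < r x p.1 p.2].

Definition A2 : Prop :=
  [/\ (0 < ereal_inf (range (fun x =>
         \big[mine/+oo]_(p : 'I_l * 'I_l)
            (\sum_(n < l) rhat n x p.1 p.2)%R%:E)))%E,
      (0 < ereal_inf (range (fun x =>
         \big[mine/+oo]_(y : 'I_l) (c x y)%:E)))%E &
      (0 < ereal_inf (range (fun x =>
         \big[mine/+oo]_(p : 'I_l * 'I_l | p \in TT) (r x p.1 p.2)%:E)))%E].

Definition zeta : R := sup [set c p.1 p.2 | p in [set: 'cV[R]_d * 'I_l]] + 1.

Definition Eset x (i j : 'I_l) : set R := `[0, c x i * r x i j].

(* Since Eset x i j is included in [0, zeta], integration against lambda_zeta
   over Eset x i j is Lebesgue integration.  The values may be infinite. *)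
Definition Agen (psi : 'I_l -> R -> R) x (i j : 'I_l) : \bar R :=
  let off i j := (\int[lebesgue_measure]_(z in Eset x i j) (psi j z)%:E)%E in
  if i == j then (- \sum_(y | y != j) off j y)%E else off i j.

(* phi i j s z stands for \varphi_{ij}(s,z); only its values for (i,j) in TT
   matter, and the other entries are set to 1. *)
Definition ext phi (s : R) (i j : 'I_l) (z : R) : R :=
  if (i, j) \in TT then phi i j s z else 1.

(* The sum uses the dual extended addition, for which +oo - oo = +oo. *)
Definition stationary (psi : 'I_l -> 'I_l -> R -> R) x (p : 'I_l -> R) : Prop :=
  forall j, (\sum_i ((p i)%:E * Agen (psi i) x i j))%dE = 0%E.

Definition state_eq u xi pi : Prop :=
  [/\ forall j, vintegrable `[0, T] (fun s => pi s j *: b (xi s) j),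
      forall j, vintegrable `[0, T] (fun s => pi s j *: (a (xi s) j *m u j s)) &
      forall t, 0 <= t <= T ->
        xi t = x0 + \sum_j vint `[0, t] (fun s => pi s j *: b (xi s) j)
                  + \sum_j vint `[0, t] (fun s => pi s j *: (a (xi s) j *m u j s))].

Definition stationary_eq phi xi pi : Prop :=
  {ae lebesgue_measure, forall s : R, 0 <= s <= T ->
     stationary (ext phi s) (xi s) (pi s)}.

Definition control_cost u pi (i : 'I_l) : \bar R :=
  (\int[lebesgue_measure]_(s in `[0%R, T]) (enorm (u i s) ^+ 2 * pi s i)%:E)%E.

Definition jump_cost phi pi (i j : 'I_l) : \bar R :=
  (\int[lebesgue_measure \x lebesgue_measure]_(p in `[0%R, T] `*` `[0%R, zeta])
     (ell (phi i j p.1 p.2) * pi p.1 i)%:E)%E.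

Definition cost u phi pi : \bar R :=
  (\sum_i (2^-1)%:E * control_cost u pi i
   + \sum_(p : 'I_l * 'I_l | p \in TT) jump_cost phi pi p.1 p.2)%E.

Definition admissible xi u phi pi : Prop :=
  [/\ forall i, measurable_fun `[0, T] (u i : R -> borel 'cV[R]_m) /\
        (control_cost u pi i < +oo)%E,
      forall i j, (i, j) \in TT ->
        measurable_fun (`[0, T] `*` `[0, zeta])
          (fun p : R * R => phi i j p.1 p.2) /\
        forall s z, 0 <= s <= T -> 0 <= z <= zeta -> 0 <= phi i j s z,
      measurable_prob T pi,
      state_eq u xi pi &
      stationary_eq phi xi pi].

Definition rate_function xi : \bar R :=
  ereal_inf [set w | exists u phi pi, admissible xi u phi pi /\ w = cost u phi pi].

End Model.

(* Main.v *)
(* The stationarity condition only sees the fluxes pi_i(s) A_ij(s), a circulation on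
   the graph T, so a near-optimal triple is perturbed at the level of laws and
   fluxes instead of controls.  Replace pi by (1 - eps) pi + eps * uniform and the
   flux by (1 - eps) * flux + eps * g, for a circulation g > 0 on T; at the rare
   times when the flux or the energy exceeds a level N, use the uniform law, the
   circulation g and zero control altogether.  The new law is bounded below, hence
   the control u pi / law and the intensities flux / (law * rate) are bounded, and
   convexity, through the tangent inequality x ln y + 1 - y <= ell x, shows that the
   cost grows by O(eps).  The state equation for the new law is solved first, which
   gives xis close to xi by Gronwall's inequality; the intensities are then defined
   relative to the rates at xis and are turned into a control that is piecewise
   constant in z.  Its jump rates are Lipschitz in x and comparable to the original
   ones, so that Doeblin's contraction argument makes the invariant law unique,
   bounded below and Lipschitz in x; uniqueness of (xis, pis) follows by Gronwall's
   inequality again. *)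

Require Import Defs.
From HB Require Import structures.
From mathcomp Require Import all_boot all_order all_algebra.
From mathcomp Require Import all_classical all_reals all_analysis.
From mathcomp Require Import measurable_realfun ring lra.

Set Implicit Arguments.
Unset Strict Implicit.
Unset Printing Implicit Defensive.

Import Order.TTheory GRing.Theory Num.Theory.
Import numFieldNormedType.Exports.

Local Open Scope classical_set_scope.
Local Open Scope ring_scope.

(** * Finite Markov chains *)

(** The cost controls [u] only in an L2 sense weighted by the law, and the flux only through an
    integrable entropy density. Neither is bounded, whereas the intensities must be bounded above
    and below, and uniqueness uses bounded controls. Total replacement at rare times closes this
    gap, and its price fixes the scale [N * eps ^+ 2] for the integrated load: bad times then have
    length at most [eps ^+ 2], and [speed <= eps * speed ^+ 2 + 1 / eps] shows that losing the
    control there costs O([eps]) in the integrated drift. For a fixed tangent point the tangent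
    inequality is linear in the flux and in law times rate, so it passes through mixing without
    Jensen's inequality, and moving from the rates at [xi] to those at [xis] merely moves the
    tangent point. All error constants precede [eps], and [N] is chosen after [eps]. The given
    fluxes balance only at almost every time, while the final law must be invariant at every time.
    It is therefore the invariant kernel evaluated along the new path, and the mixed law is an
    almost everywhere equal version of it. *)

Lemma cvg_dist_le {R : realType} (u e : nat -> R) (z : R) :
  (forall n, `|u n - z| <= e n) -> e n @[n --> \oo] --> 0 -> u n @[n --> \oo] --> z.
Proof.
move=> ue e0; apply/cvgrPdist_le => eps eps0.
have /cvgrPdist_le /(_ _ eps0) := e0; apply: filterS => n.
rewrite sub0r normrN distrC; apply: le_trans; apply: le_trans (ler_norm _).
exact: ue.
Qed.

Section FiniteMarkovChain.
Context {R : realType} {l : nat}.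
Implicit Types (v w p : 'I_l -> R) (P G : 'I_l -> 'I_l -> R).

Definition step P v : 'I_l -> R := fun j => \sum_i v i * P i j.

Definition stochastic P : Prop :=
  (forall i j, 0 <= P i j) /\ (forall i, \sum_j P i j = 1).

Definition norm1 v : R := \sum_i `|v i|.

Lemma le_norm1 v i : `|v i| <= norm1 v.
Proof. by rewrite /norm1 (bigD1 i)//= lerDl sumr_ge0. Qed.

Lemma ler_norm1D v w : norm1 (v \+ w) <= norm1 v + norm1 w.
Proof. by rewrite /norm1 -big_split /= ler_sum// => i _; exact: ler_normD. Qed.

Lemma step_ge0 P v : (forall i j, 0 <= P i j) -> (forall i, 0 <= v i) ->
  forall j, 0 <= step P v j.
Proof. by move=> P0 v0 j; apply: sumr_ge0 => i _; rewrite mulr_ge0. Qed.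

Lemma stepB P v w : step P (v \- w) = step P v \- step P w.
Proof.
by apply/funext => j; rewrite /step /= -sumrB; apply: eq_bigr => i _; rewrite mulrBl.
Qed.

Lemma iter_stepB P n v w :
  iter n (step P) (v \- w) = iter n (step P) v \- iter n (step P) w.
Proof. by elim: n => //= n ->; rewrite stepB. Qed.

Lemma iter_step_ge0 P n v : (forall i j, 0 <= P i j) -> (forall i, 0 <= v i) ->
  forall j, 0 <= iter n (step P) v j.
Proof. by move=> P0 v0; elim: n => //= n IH j; exact: step_ge0. Qed.

Lemma sum_step P v : stochastic P -> \sum_j step P v j = \sum_i v i.
Proof.
move=> [_ P1]; rewrite /step exchange_big /=; apply: eq_bigr => i _.
by rewrite -mulr_sumr P1 mulr1.
Qed.

Lemma sum_iter_step P n v : stochastic P ->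
  \sum_j iter n (step P) v j = \sum_i v i.
Proof. by move=> sP; elim: n => //= n IH; rewrite sum_step. Qed.

Lemma norm1_step P v : stochastic P -> norm1 (step P v) <= norm1 v.
Proof.
move=> sP; rewrite /norm1 -(sum_step (fun i => `|v i|) sP) ler_sum// => j _.
apply: (le_trans (ler_norm_sum _ _ _)); apply: ler_sum => i _.
by rewrite normrM (ger0_norm (sP.1 i j)).
Qed.

Lemma norm1_iter_step P n v : stochastic P -> norm1 (iter n (step P) v) <= norm1 v.
Proof.
by move=> sP; elim: n => //= n IH; apply: le_trans IH; exact: norm1_step.
Qed.

(** Telescoping: [v - P^n v] is the sum over [k < n] of [P^k (v - P v)], and a stochastic matrix
    does not increase the l1 norm. The induction peels off the last of these terms. *)
Lemma norm1_iter_step_sub P n v : stochastic P ->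
  norm1 (v \- iter n (step P) v) <= n%:R * norm1 (v \- step P v).
Proof.
move=> sP; elim: n => [|n IH] /=.
  by rewrite mul0r /norm1 big1// => i _; rewrite /= subrr normr0.
have -> : v \- step P (iter n (step P) v) =
    (v \- iter n (step P) v) \+ iter n (step P) (v \- step P v).
  rewrite iter_stepB -iterSr iterS; apply/funext => i /=; ring.
apply: (le_trans (ler_norm1D _ _)); rewrite -natr1 mulrDl mul1r lerD//.
exact: norm1_iter_step.
Qed.

(** Doeblin's minorization: every entry of [P^n] is at least [beta]. Testing against nonnegative
    vectors avoids matrix powers. *)
Definition connected_by n P beta := forall v, (forall i, 0 <= v i) ->
  forall y z, beta * v y <= iter n (step P) v z.

(* Doeblin's argument: the positive and the negative part of [w] have equal mass,
   and after [n] steps both give every state at least [beta / l] times that mass,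
   which cancels. *)
Lemma contraction P n beta w : stochastic P -> 0 <= beta -> connected_by n P beta ->
  \sum_i w i = 0 -> norm1 (iter n (step P) w) <= (1 - beta) * norm1 w.
Proof.
move=> sP b0 cP w0.
case: (posnP l) => [l0|l0].
  have E v : norm1 v = 0.
    by rewrite /norm1 big1// => i _; move: (ltn_ord i); rewrite {2}l0.
  by rewrite !E mulr0.
pose wp i := Num.max (w i) 0; pose wm i := Num.max (- w i) 0.
have wE : w = wp \- wm.
  apply/funext => i; rewrite /wp /wm /=.
  case: (lerP (w i) 0) => h1; case: (lerP (- w i) 0) => h2 /=; lra.
have nE i : `|w i| = wp i + wm i.
  rewrite /wp /wm; case: (ger0P (w i));
    case: (lerP (w i) 0); case: (lerP (- w i) 0); lra.
have wp0 i : 0 <= wp i by rewrite le_max lexx orbT.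
have wm0 i : 0 <= wm i by rewrite le_max lexx orbT.
have eqS : \sum_i wp i = \sum_i wm i.
  by move: w0; rewrite wE /= sumrB => /eqP; rewrite subr_eq0 => /eqP.
have lb v : (forall i, 0 <= v i) -> forall j,
    beta * (\sum_i v i) / l%:R <= iter n (step P) v j.
  move=> v0 j; rewrite ler_pdivrMr ?ltr0n// mulr_sumr mulr_natr.
  rewrite -[l in _ *+ l]card_ord -sumr_const ler_sum// => i _; exact: cP.
set S := \sum_i wm i; set t := beta * S / l%:R.
have -> : norm1 w = S + S.
  by rewrite /norm1 (eq_bigr _ (fun i _ => nE i)) big_split /= eqS.
rewrite wE iter_stepB /norm1.
apply: (@le_trans _ _ (\sum_i (iter n (step P) wp i + iter n (step P) wm i - 2 * t))).
  apply: ler_sum => j _ /=.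
  have := lb _ wp0 j; have := lb _ wm0 j; rewrite eqS -/S -/t.
  set A := iter n _ wp j; set B := iter n _ wm j => h1 h2.
  by rewrite ler_norml; apply/andP; split; lra.
rewrite sumrB big_split /= !sum_iter_step// eqS -/S sumr_const card_ord.
have -> : (2 * t) *+ l = 2 * beta * S.
  by rewrite -mulr_natr /t; field; rewrite pnatr_eq0 -lt0n.
by rewrite le_eqVlt; apply/orP; left; apply/eqP; ring.
Qed.

(** Inverts [I - P] on vectors of sum zero: by [contraction] the norm lost in [n] steps is at least
    [beta * norm1 w], and by telescoping it is at most [n] times the residual. Uniqueness and
    Lipschitz dependence of the invariant law both come from this. *)
Lemma zero_sum_bound P n beta w : stochastic P -> 0 <= beta -> connected_by n P beta ->
  \sum_i w i = 0 -> beta * norm1 w <= n%:R * norm1 (w \- step P w).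
Proof.
move=> sP b0 cP w0; apply: le_trans (norm1_iter_step_sub n w sP).
have h := contraction sP b0 cP w0.
have : norm1 w <= norm1 (w \- iter n (step P) w) + norm1 (iter n (step P) w).
  rewrite -{1}[w](_ : (w \- iter n (step P) w) \+ iter n (step P) w = w).
    exact: ler_norm1D.
  by apply/funext => i /=; rewrite subrK.
rewrite mulrBl mul1r in h; lra.
Qed.

(** [P - I] kills the constant vector, so it is singular and has a left null vector [w]. Its
    absolute value satisfies [q <= step P q] with equal total masses, hence equality, and is then
    normalized. *)
Lemma invariant_exists P : (0 < l)%N -> stochastic P ->
  exists p, prob_vec p /\ step P p = p.
Proof.
move=> l0 sP.
pose M : 'M[R]_l := \matrix_(i, j) (P i j - (i == j)%:R).
have detM : \det M = 0.
  rewrite -det_tr; apply/eqP/det0P; exists (const_mx 1).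
    apply/eqP => /matrixP /(_ 0 (Ordinal l0)); rewrite !mxE => /eqP.
    by rewrite oner_eq0.
  apply/matrixP => i j; rewrite !mxE.
  under eq_bigr do rewrite !mxE mul1r.
  by rewrite sumrB sP.2 (bigD1 j)//= eqxx big1 ?addr0 ?subrr// => k /negPf;
    rewrite eq_sym => ->.
have /eqP/det0P[v vN0 vM] := detM.
pose w i := v 0 i.
have stepw : step P w = w.
  apply/funext => j; have /matrixP /(_ 0 j) := vM; rewrite !mxE.
  under eq_bigr do rewrite !mxE mulrBr.
  rewrite sumrB => /eqP; rewrite subr_eq0 => /eqP; rewrite /step => ->.
  by rewrite (bigD1 j)//= eqxx mulr1 big1 ?addr0// => k /negPf ->; rewrite mulr0.
pose q i := `|w i|.
have qle j : q j <= step P q j.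
  rewrite /q -{1}stepw; apply: (le_trans (ler_norm_sum _ _ _)).
  by apply: ler_sum => i _; rewrite normrM (ger0_norm (sP.1 i j)).
have qE : step P q = q.
  have : \sum_j (step P q j - q j) == 0 by rewrite sumrB sum_step// subrr.
  rewrite psumr_eq0; last by move=> j _; rewrite subr_ge0.
  move=> /allP h; apply/funext => j; apply/eqP.
  by rewrite -subr_eq0; apply: h; rewrite mem_index_enum.
have S0 : 0 < \sum_i q i.
  rewrite lt_neqAle sumr_ge0 ?andbT//; last by move=> i _; exact: normr_ge0.
  apply: contra vN0; rewrite eq_sym psumr_eq0; last by move=> i _; exact: normr_ge0.
  move=> /allP h; apply/eqP/matrixP => i j; rewrite mxE ord1.
  by have := h j (mem_index_enum _); rewrite /= normr_eq0 => /eqP.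
exists (fun i => q i / \sum_i q i); split.
  split; first by move=> i; apply: divr_ge0; [exact: normr_ge0|exact: ltW].
  by rewrite -mulr_suml divff ?gt_eqF.
apply/funext => j; transitivity (step P q j / \sum_i q i); last by rewrite qE.
by rewrite /step mulr_suml; apply: eq_bigr => i _; rewrite mulrAC.
Qed.

Lemma step_ge_entry P v i j : (forall i j, 0 <= P i j) -> (forall i, 0 <= v i) ->
  v i * P i j <= step P v j.
Proof.
by move=> P0 v0; rewrite /step (bigD1 i)//= lerDl sumr_ge0// => k _; rewrite mulr_ge0.
Qed.

(** Inflow equals outflow at every state. The diagonal rates occur on both sides and cancel, so that
    rate matrices can be used in place of generators. *)
Definition balanced G p : Prop :=
  forall j, \sum_i p i * G i j = p j * \sum_y G j y.

(* Uniformization: the chain with rates [G] observed at the ticks of a Poisson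
   clock of rate [L]. *)
Definition unif (L : R) G : 'I_l -> 'I_l -> R :=
  fun i j => G i j / L + (i == j)%:R * (1 - (\sum_y G i y) / L).

Lemma step_unif L G p j : L != 0 ->
  step (unif L G) p j - p j = (\sum_i p i * G i j - p j * \sum_y G j y) / L.
Proof.
move=> L0; rewrite /step /unif.
under eq_bigr do rewrite mulrDr mulrA.
rewrite big_split /= -mulr_suml.
have -> : \sum_i p i * ((i == j)%:R * (1 - (\sum_y G i y) / L)) =
    p j * (1 - (\sum_y G j y) / L).
  rewrite (bigD1 j)//= eqxx mul1r -[RHS]addr0; congr (_ + _).
  by apply: big1 => k /negPf ->; rewrite mul0r mulr0.
by rewrite mulrBr mulr1 mulrA; field.
Qed.

Lemma balancedP L G p : L != 0 -> balanced G p <-> step (unif L G) p = p.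
Proof.
move=> L0; split=> [h|h].
  by apply/funext => j; apply/eqP; rewrite -subr_eq0 step_unif// h subrr mul0r.
move=> j; have /eqP := step_unif G p j L0; rewrite h subrr eq_sym mulf_eq0 invr_eq0.
by rewrite (negPf L0) orbF subr_eq0 => /eqP.
Qed.

Lemma unif_stochastic L G : 0 < L -> (forall i j, 0 <= G i j) ->
  (forall i, \sum_y G i y <= L) -> stochastic (unif L G).
Proof.
move=> L0 G0 GL; split=> [i j|i].
  rewrite /unif; apply: addr_ge0; first by rewrite divr_ge0// ltW.
  by rewrite mulr_ge0// subr_ge0 ler_pdivrMr// mul1r.
rewrite /unif big_split /= -mulr_suml.
have -> : \sum_j (i == j)%:R * (1 - (\sum_y G i y) / L) = 1 - (\sum_y G i y) / L.
  rewrite (bigD1 i)//= eqxx mul1r -[RHS]addr0; congr (_ + _).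
  by apply: big1 => k; rewrite eq_sym => /negPf ->; rewrite mul0r.
by rewrite addrC subrK.
Qed.

(** [p] has no residual under [G], so only [p'] contributes, and subtracting its balance under [G']
    leaves the difference of the rates. Each entry counts once as inflow and once as outflow, whence
    the factor 2. *)
Lemma balanced_diff G G' p p' : balanced G p -> balanced G' p' -> prob_vec p' ->
  forall L, 0 < L ->
  norm1 ((p \- p') \- step (unif L G) (p \- p'))
    <= 2 / L * \sum_i \sum_j `|G i j - G' i j|.
Proof.
move=> bp bp' [p'0 p'1] L L0.
have Ln0 : L != 0 by rewrite gt_eqF.
have p'le1 i : p' i <= 1.
  by rewrite -p'1 (bigD1 i)//= lerDl sumr_ge0.
set D := fun i j => G i j - G' i j.
have E j : (p \- p') j - step (unif L G) (p \- p') j =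
    (\sum_i p' i * D i j - p' j * \sum_y D j y) / L.
  rewrite stepB /=; have := step_unif G p j Ln0; have := step_unif G p' j Ln0.
  rewrite bp subrr mul0r.
  have -> : \sum_i p' i * D i j = \sum_i p' i * G i j - p' j * \sum_y G' j y.
    by rewrite -bp' -sumrB; apply: eq_bigr => i _; rewrite /D mulrBr.
  have -> : \sum_y D j y = \sum_y G j y - \sum_y G' j y by rewrite -sumrB.
  move=> h1 h2; rewrite opprB mulrBr.
  have -> : (\sum_i p' i * G i j - p' j * \sum_y G' j y -
    (p' j * \sum_y G j y - p' j * \sum_y G' j y)) =
    \sum_i p' i * G i j - p' j * \sum_y G j y by ring.
  by rewrite -h1; lra.
apply: (@le_trans _ _ (\sum_j (\sum_i `|D i j| + \sum_y `|D j y|) / L)).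
  apply: ler_sum => j _; rewrite /= E normrM normfV (gtr0_norm L0).
  rewrite ler_pM2r ?invr_gt0//; apply: (le_trans (ler_normB _ _)); apply: lerD.
    apply: (le_trans (ler_norm_sum _ _ _)); apply: ler_sum => i _.
    by rewrite normrM ger0_norm// ler_piMl.
  rewrite normrM ger0_norm// (le_trans _ (ler_norm_sum _ _ _))// ler_piMl//.
rewrite -mulr_suml big_split /= exchange_big /= le_eqVlt; apply/orP; left.
by apply/eqP; ring.
Qed.

Lemma contraction_iter P n beta k w : stochastic P -> 0 <= beta <= 1 ->
  connected_by n P beta -> \sum_i w i = 0 ->
  norm1 (iter (k * n) (step P) w) <= (1 - beta) ^+ k * norm1 w.
Proof.
move=> sP /andP[b0 b1] cP w0; elim: k => [|k IH]; first by rewrite mul1r.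
rewrite mulSn iterD exprS -mulrA.
have z : \sum_i iter (k * n) (step P) w i = 0 by rewrite sum_iter_step.
apply: (le_trans (contraction sP b0 cP z)).
by rewrite ler_wpM2l// subr_ge0.
Qed.

End FiniteMarkovChain.

(** * Invariant laws over a fixed irreducible graph: uniform lower bound and Lipschitz dependence on
    the rates *)

Section InvariantDistribution.
Context {R : realType} {l d : nat}.
Variables (r : 'cV[R]_d -> 'I_l -> 'I_l -> R) (x0 : 'cV[R]_d).
Hypothesis r_ge0 : forall i j, 0 <= r x0 i j.
Hypothesis r_irr : forall y z, exists2 n, (n < l)%N & 0 < rhat r n x0 y z.
Hypothesis l_gt0 : (0 < l)%N.
Variables (kap Lam : R).
Hypotheses (kap_gt0 : 0 < kap) (kapLam : kap <= Lam).
Implicit Types (G : 'I_l -> 'I_l -> R) (p : 'I_l -> R).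

Lemma rhat_ge0 n y z : 0 <= rhat r n x0 y z.
Proof.
by elim: n z => //= n IH z; apply: sumr_ge0 => k _; rewrite mulr_ge0.
Qed.

(** A path of at most [l] edges has weight at least [theta] per edge, and the positive diagonal lets
    the chain wait during the remaining steps, so that all pairs are joined in exactly [l] steps. *)
Lemma connected_rhat (P : 'I_l -> 'I_l -> R) (theta : R) :
  (forall i j, 0 <= P i j) -> 0 < theta <= 1 ->
  (forall i j, 0 < r x0 i j -> theta <= P i j) -> (forall i, theta <= P i i) ->
  connected_by l P (theta ^+ l).
Proof.
move=> P0 /andP[t0 t1] Pr Pd v v0 y z.
have hn n w : 0 < rhat r n x0 y w -> theta ^+ n.+1 * v y <= iter n.+1 (step P) v w.
  elim: n w => [|n IH] w.
    rewrite expr1 /= => /Pr h; apply: le_trans (step_ge_entry y w P0 v0).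
    by rewrite mulrC ler_wpM2l.
  move=> h; have [k hk] : exists k, 0 < rhat r n x0 y k * r x0 k w.
    apply/existsP; move: h; apply: contraTT; rewrite negb_exists => /forallP h.
    rewrite -leNgt /= sumr_le0// => k _; rewrite leNgt; exact: h.
  have k1 : 0 < rhat r n x0 y k.
    by rewrite lt_def rhat_ge0 andbT; apply: contraTneq hk => ->; rewrite mul0r ltxx.
  have k2 : 0 < r x0 k w by move: hk; rewrite pmulr_rgt0.
  rewrite iterS; apply: le_trans (step_ge_entry k w P0 (iter_step_ge0 n.+1 P0 v0)).
  by rewrite exprSr mulrAC ler_pM ?IH ?Pr ?mulr_ge0 ?exprn_ge0 ?(ltW t0).
have hk n k w : theta ^+ n * v y <= iter n (step P) v w ->
    theta ^+ (k + n) * v y <= iter (k + n) (step P) v w.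
  move=> h; elim: k => // k IH; rewrite addSn iterS.
  apply: le_trans (step_ge_entry w w P0 (iter_step_ge0 _ P0 v0)).
  by rewrite exprSr mulrAC ler_pM ?IH ?Pd ?mulr_ge0 ?exprn_ge0 ?(ltW t0).
have [n nl rn] := r_irr y z.
(* [rhat n] counts paths of [n.+1] edges, so [l - n.+1] waiting steps remain. *)
by have := hk _ (l - n.+1)%N _ (hn _ _ rn); rewrite subnK.
Qed.

(** [r x0] enters through its support alone: one fixed graph serves all rate matrices, and the
    constants below depend only on [l], [kap] and [Lam]. *)
Definition rate_bounds G : Prop :=
  [/\ forall i j, 0 <= G i j, forall i j, 0 < r x0 i j -> kap <= G i j &
      forall i, \sum_y G i y <= Lam].

(** Twice the bound on the exit rates: the uniformized chain then stays put with probability at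
    least 1/2, which dominates [theta] and supplies the diagonal bound of [connected_rhat]. *)
Let L := 2 * Lam.
Let theta := kap / L.
Let beta := theta ^+ l.

Let Lam_gt0 : 0 < Lam. Proof. exact: lt_le_trans kapLam. Qed.
Let L_gt0 : 0 < L. Proof. by rewrite mulr_gt0. Qed.
Let theta01 : 0 < theta <= 1.
Proof.
rewrite divr_gt0//= ler_pdivrMr// mul1r /L; have := Lam_gt0; have := kapLam; lra.
Qed.

Let beta01 : 0 < beta <= 1.
Proof.
by case/andP: theta01 => t0 t1; rewrite exprn_gt0//= exprn_ile1// ltW.
Qed.

Let sto G : rate_bounds G -> stochastic (unif L G).
Proof.
move=> [G0 Gk GL]; apply: unif_stochastic => // i.
by apply: (le_trans (GL i)); rewrite /L; have := Lam_gt0; lra.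
Qed.

Let con G : rate_bounds G -> connected_by l (unif L G) beta.
Proof.
move=> bG; have [G0 Gk GL] := bG; have [P0 _] := sto bG.
have D i : 0 <= 1 - (\sum_y G i y) / L.
  rewrite subr_ge0 ler_pdivrMr// mul1r; apply: (le_trans (GL i)).
  by rewrite /L; have := Lam_gt0; lra.
apply: connected_rhat => // [i j rij|i].
  rewrite /unif /theta; apply: (@le_trans _ _ (G i j / L)).
    by rewrite ler_pM2r ?invr_gt0// Gk.
  by rewrite lerDl mulr_ge0.
rewrite /unif eqxx mul1r.
have h1 : 0 <= G i i / L by rewrite divr_ge0// ltW.
have h2 : (\sum_y G i y) / L <= 2^-1.
  rewrite ler_pdivrMr// /L mulrA mulVf ?mul1r//.
have h3 : theta <= 2^-1.
  rewrite /theta ler_pdivrMr// /L mulrA mulVf ?mul1r//.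
by lra.
Qed.

Let L_neq0 : L != 0. Proof. by rewrite gt_eqF. Qed.

Lemma balanced_exists G : rate_bounds G -> exists p, prob_vec p /\ balanced G p.
Proof.
move=> bG; have [p [pp /(balancedP _ _ L_neq0) bp]] := invariant_exists l_gt0 (sto bG).
by exists p.
Qed.

(** An invariant law is its own image after [l] steps, so [p i] is at least [beta * p y] for every
    [y]; averaging over [y] gives [beta / l]. *)
Lemma balanced_lower_bound :
  exists2 c : R, 0 < c & forall G p i, rate_bounds G -> prob_vec p -> balanced G p ->
    c <= p i.
Proof.
have l0 : 0 < l%:R :> R by rewrite ltr0n.
case/andP: beta01 => b0 b1.
exists (beta / l%:R); first by rewrite divr_gt0.
move=> G p i bG [p0 p1] /(balancedP _ _ L_neq0) bp.
have it n : iter n (step (unif L G)) p = p by elim: n => //= n ->.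
rewrite ler_pdivrMr// mulr_natr (_ : beta = \sum_y beta * p y); last first.
  by rewrite -mulr_sumr p1 mulr1.
rewrite -[l in _ *+ l]card_ord -sumr_const ler_sum// => y _.
by have := con bG p0 y i; rewrite it.
Qed.

(** [zero_sum_bound] for the chain of [G], applied to [p - p'], turns the residual estimate of
    [balanced_diff] into an estimate of the laws. *)
Lemma balanced_lipschitz :
  exists2 C : R, 0 < C & forall G G' p p', rate_bounds G ->
    prob_vec p -> prob_vec p' -> balanced G p -> balanced G' p' ->
    forall i, `|p i - p' i| <= C * \sum_i \sum_j `|G i j - G' i j|.
Proof.
case/andP: beta01 => b0 b1.
exists (beta^-1 * (l%:R * (2 / L))).
  by rewrite !mulr_gt0 ?invr_gt0// ltr0n.
move=> G G' p p' bG [p0 p1] pp' bp bp' i.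
have z : \sum_i (p \- p') i = 0 by rewrite sumrB p1 pp'.2 subrr.
have := zero_sum_bound (sto bG) (ltW b0) (con bG) z => h.
have h2 := balanced_diff bp bp' pp' L_gt0.
rewrite -!mulrA ler_pdivlMl//; apply: le_trans (le_trans h _).
  by rewrite ler_pM2l//; exact: (@le_norm1 _ _ (p \- p') i).
by rewrite ler_wpM2l// (le_trans h2)// mulrA.
Qed.

Lemma balanced_unique G p p' : rate_bounds G -> prob_vec p -> prob_vec p' ->
  balanced G p -> balanced G p' -> p = p'.
Proof.
move=> bG pp pp' bp bp'; have [C _ h] := balanced_lipschitz.
apply/funext => i; apply/eqP; rewrite -subr_eq0 -normr_le0.
apply: (le_trans (h G G p p' bG pp pp' bp bp' i)).
by rewrite big1 ?mulr0// => k _; rewrite big1// => j _; rewrite subrr normr0.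
Qed.

(** The contraction acts on blocks of [l] steps, hence the multiples of [l]. Exhibiting the
    invariant law as a limit of explicit iterates is what makes its measurability accessible. *)
Lemma balanced_limit G p v : rate_bounds G -> prob_vec p -> balanced G p ->
  prob_vec v -> forall i, iter (n * l) (step (unif L G)) v i @[n --> \oo] --> p i.
Proof.
move=> bG [p0 p1] /(balancedP _ _ L_neq0) bp [v0 v1] i.
have it n : iter n (step (unif L G)) p = p by elim: n => //= n ->.
case/andP: beta01 => b0 b1.
apply: (@cvg_dist_le _ _ (fun n => norm1 (v \- p) * (1 - beta) ^+ n)).
  move=> n; have z : \sum_i (v \- p) i = 0 by rewrite sumrB p1 v1 subrr.
  have b01 : 0 <= beta <= 1 by rewrite ltW.
  have := contraction_iter n (sto bG) b01 (con bG) z.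
  rewrite iter_stepB it mulrC; apply: le_trans.
  exact: (le_norm1 (iter (n * l) (step (unif L G)) v \- p)).
by apply: cvg_geometric; rewrite ger0_norm; lra.
Qed.

End InvariantDistribution.

(** * Norms and vector-valued integrals *)

Section EntrywiseNorm.
Context {R : realType}.

(* Submultiplicative and equivalent to [enorm]. *)
Definition n1 {p q : nat} (A : 'M[R]_(p, q)) : R := \sum_i \sum_j `|A i j|.

Lemma n1_ge0 p q (A : 'M[R]_(p, q)) : 0 <= n1 A.
Proof. by apply: sumr_ge0 => i _; exact: sumr_ge0. Qed.

Lemma n1_cV p (A : 'cV[R]_p) : n1 A = \sum_i `|A i 0|.
Proof. by apply: eq_bigr => i _; rewrite big_ord1. Qed.

Lemma le_n1 p q (A : 'M[R]_(p, q)) i j : `|A i j| <= n1 A.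
Proof.
rewrite /n1 (bigD1 i)//= (bigD1 j)//= -addrA lerDl addr_ge0// ?sumr_ge0//.
by move=> k _; exact: sumr_ge0.
Qed.

Lemma n1_0 p q : n1 (0 : 'M[R]_(p, q)) = 0.
Proof. by apply: big1 => i _; apply: big1 => j _; rewrite mxE normr0. Qed.

Lemma ler_n1D p q (A B : 'M[R]_(p, q)) : n1 (A + B) <= n1 A + n1 B.
Proof.
rewrite /n1 -big_split ler_sum//= => i _; rewrite -big_split ler_sum//= => j _.
by rewrite mxE ler_normD.
Qed.

Lemma n1N p q (A : 'M[R]_(p, q)) : n1 (- A) = n1 A.
Proof. by apply: eq_bigr => i _; apply: eq_bigr => j _; rewrite mxE normrN. Qed.

Lemma n1B p q (A B : 'M[R]_(p, q)) : n1 (A - B) = n1 (B - A).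
Proof. by rewrite -n1N opprB. Qed.

Lemma ler_n1_dist p q (B A C : 'M[R]_(p, q)) : n1 (A - C) <= n1 (A - B) + n1 (B - C).
Proof. by rewrite (le_trans _ (ler_n1D _ _))// addrA subrK. Qed.

Lemma n1Z p q (a : R) (A : 'M[R]_(p, q)) : n1 (a *: A) = `|a| * n1 A.
Proof.
rewrite /n1 mulr_sumr; apply: eq_bigr => i _; rewrite mulr_sumr.
by apply: eq_bigr => j _; rewrite mxE normrM.
Qed.

Lemma ler_n1_sum p q I (r : seq I) (P : pred I) (F : I -> 'M[R]_(p, q)) :
  n1 (\sum_(i <- r | P i) F i) <= \sum_(i <- r | P i) n1 (F i).
Proof.
elim/big_rec2 : _ => [|i y x _ h]; first by rewrite n1_0.
by rewrite (le_trans (ler_n1D _ _))// lerD2l.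
Qed.

Lemma ler_n1M p q s (A : 'M[R]_(p, q)) (B : 'M[R]_(q, s)) :
  n1 (A *m B) <= n1 A * n1 B.
Proof.
rewrite /n1 mulr_suml ler_sum// => i _.
rewrite mulr_suml.
apply: (@le_trans _ _ (\sum_j \sum_k `|A i k| * `|B k j|)).
  apply: ler_sum => j _; rewrite mxE (le_trans (ler_norm_sum _ _ _))//.
  by apply: ler_sum => k _; rewrite normrM.
rewrite exchange_big /= ler_sum// => k _; rewrite -mulr_sumr ler_wpM2l//.
by rewrite [leRHS](bigD1 k)//= lerDl sumr_ge0// => i' _; exact: sumr_ge0.
Qed.

Lemma n1_eq0 p q (A : 'M[R]_(p, q)) : n1 A <= 0 -> A = 0.
Proof.
move=> h; apply/matrixP => i j; rewrite mxE; apply/eqP.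
by rewrite -normr_le0 (le_trans (le_n1 _ _ _)).
Qed.

Lemma sqr_sum_le I (r : seq I) (F : I -> R) : (forall i, 0 <= F i) ->
  \sum_(i <- r) F i ^+ 2 <= (\sum_(i <- r) F i) ^+ 2.
Proof.
move=> F0; elim: r => [|i r IH]; first by rewrite !big_nil expr0n.
rewrite !big_cons sqrrD -addrA lerD2l (le_trans IH)// lerDr.
by rewrite mulrn_wge0// mulr_ge0// sumr_ge0.
Qed.

Lemma enorm_le_n1 p q (A : 'M[R]_(p, q)) : enorm A <= n1 A.
Proof.
rewrite -[n1 A]ger0_norm ?n1_ge0// -sqrtr_sqr /enorm ler_wsqrtr//.
rewrite /n1; apply: le_trans (sqr_sum_le _ _); last by move=> i; exact: sumr_ge0.
apply: ler_sum => i _; apply: le_trans (sqr_sum_le _ _) => //.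
by apply: ler_sum => j _; rewrite -normrX ger0_norm// sqr_ge0.
Qed.

Lemma le_enorm p q (A : 'M[R]_(p, q)) i j : `|A i j| <= enorm A.
Proof.
rewrite /enorm -sqrtr_sqr ler_wsqrtr// (bigD1 i)//= (bigD1 j)//= -addrA lerDl.
rewrite addr_ge0// ?sumr_ge0// => k _; rewrite ?sqr_ge0//.
by apply: sumr_ge0 => j' _; exact: sqr_ge0.
Qed.

Lemma n1_le_enorm p q (A : 'M[R]_(p, q)) : n1 A <= (p * q)%:R * enorm A.
Proof.
apply: (@le_trans _ _ (\sum_(i < p) \sum_(j < q) enorm A)).
  by apply: ler_sum => i _; apply: ler_sum => j _; exact: le_enorm.
by rewrite !sumr_const !card_ord -mulrnA mulnC mulr_natl.
Qed.

Lemma enorm_ge0 p q (A : 'M[R]_(p, q)) : 0 <= enorm A.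
Proof. exact: sqrtr_ge0. Qed.

Lemma enorm_sqr_cV p (A : 'cV[R]_p) : enorm A ^+ 2 = \sum_i A i 0 ^+ 2.
Proof.
rewrite sqr_sqrtr; first by apply: eq_bigr => i _; rewrite big_ord1.
by apply: sumr_ge0 => i _; apply: sumr_ge0 => j _; exact: sqr_ge0.
Qed.

Lemma n1_sqr_le p (A : 'cV[R]_p) : n1 A ^+ 2 <= p%:R ^+ 2 * enorm A ^+ 2.
Proof.
rewrite -exprMn ler_sqr ?nnegrE ?n1_ge0 ?mulr_ge0 ?enorm_ge0//.
by have := n1_le_enorm A; rewrite muln1.
Qed.

End EntrywiseNorm.

Section VectorIntegral.
Context {R : realType}.
Local Notation mu := (@lebesgue_measure R).
Implicit Types (T t : R).

Lemma bounded_integrable T (f : R -> R) (M : R) : measurable_fun `[0, T] f ->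
  (forall s, 0 <= s <= T -> `|f s| <= M) -> mu.-integrable `[0, T] (EFin \o f).
Proof.
move=> mf fM; apply: measurable_bounded_integrable => //.
  by rewrite /= lebesgue_measure_itv/=; case: ifP => //; rewrite ltry.
exists M; split; first exact: num_real.
move=> N MN s /=; rewrite in_itv /= => sT; exact: le_trans (fM s sT) (ltW MN).
Qed.

Lemma integrable_itvS T t (f : R -> \bar R) : t <= T ->
  mu.-integrable `[0, T] f -> mu.-integrable `[0, t] f.
Proof.
move=> tT; apply: integrableS => //= s /=; rewrite !in_itv /= => /andP[-> st].
exact: le_trans tT.
Qed.

Lemma measurable_fun_itvS T t d (U : measurableType d) (f : R -> U) : t <= T ->
  measurable_fun `[0, T] f -> measurable_fun `[0, t] f.
Proof.
move=> tT; apply: measurable_funS => //= s /=; rewrite !in_itv /= => /andP[-> st].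
exact: le_trans tT.
Qed.

Lemma le_Rintegral_itv T t (f : R -> R) : t <= T ->
  (forall s, 0 <= s <= T -> 0 <= f s) -> mu.-integrable `[0, T] (EFin \o f) ->
  \int[mu]_(s in `[0, t]) f s <= \int[mu]_(s in `[0, T]) f s.
Proof.
move=> tT f0 fi; have fit := integrable_itvS tT fi.
rewrite /Rintegral fine_le ?integrable_fin_num//.
apply: ge0_subset_integral => //.
- exact: (measurable_int mu).
- by move=> s /=; rewrite !in_itv /= => /andP[-> st]; exact: le_trans tT.
Qed.

Lemma Rintegral_exp_le (lam t : R) : 0 < lam -> 0 <= t ->
  \int[mu]_(s in `[0, t]) expR (lam * s) <= expR (lam * t) / lam.
Proof.
move=> l0; rewrite le_eqVlt => /predU1P[<-|t0].
  by rewrite set_itv1 Rintegral_set1 divr_ge0 ?expR_ge0 ?ltW.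
pose F s := expR (lam * s) / lam.
have dF (s : R) : is_derive s 1 F (expR (lam * s)).
  apply: is_derive_eq; rewrite scaler0 add0r /GRing.scale /= mulr1.
  by rewrite mulrCA mulVf ?mulr1 ?gt_eqF.
have cF (s : R) : {for s, continuous F}.
  by apply: differentiable_continuous; apply/derivable1_diffP; case: (dF s).
have cE (s : R) : {for s, continuous (fun s => expR (lam * s))}.
  apply: (@continuous_comp _ _ _ (fun s => lam * s) expR); last exact: continuous_expR.
  exact: mulrl_continuous.
rewrite /Rintegral (continuous_FTC2 (F := F) t0)//=.
- by rewrite /F mulr0 expR0; rewrite lerBlDr lerDl divr_ge0// ltW.
- by apply: continuous_subspaceT => s; exact: cE.
- split; first by move=> s _; case: (dF s).
  + by apply: cvg_at_right_filter; exact: cF.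
  + by apply: cvg_at_left_filter; exact: cF.
- by move=> s _; rewrite derive1E; case: (dF s).
Qed.

Lemma vintegrable_itvS T t d (f : R -> 'cV[R]_d) : t <= T ->
  vintegrable `[0, T] f -> vintegrable `[0, t] f.
Proof. by move=> tT h k; exact: integrable_itvS (h k). Qed.

Lemma integrable_n1 d (D : set R) (f : R -> 'cV[R]_d) : measurable D ->
  vintegrable D f -> mu.-integrable D (EFin \o (fun s => n1 (f s))).
Proof.
move=> mD h.
have -> : EFin \o (fun s => n1 (f s)) = (fun s => \sum_k (`|f s k 0|)%:E)%E.
  by apply/funext => s /=; rewrite n1_cV sumEFin.
by apply: integrable_sum => // k _; exact: integrable_norm (h k).
Qed.

Lemma n1_vint d (D : set R) (f : R -> 'cV[R]_d) : measurable D ->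
  vintegrable D f -> n1 (vint D f) <= \int[mu]_(s in D) n1 (f s).
Proof.
move=> mD h; rewrite n1_cV.
apply: (@le_trans _ _ (\sum_k \int[mu]_(s in D) `|f s k 0|)).
  by apply: ler_sum => k _; rewrite mxE; exact: le_normr_Rintegral (h k).
have -> : (fun s => n1 (f s)) = (fun s => \sum_k `|f s k 0|).
  by apply/funext => s; rewrite n1_cV.
have hh (r : seq 'I_d) : mu.-integrable D (EFin \o (fun s => \sum_(k <- r) `|f s k 0|)) /\
   \sum_(k <- r) \int[mu]_(s in D) `|f s k 0| = \int[mu]_(s in D) \sum_(k <- r) `|f s k 0|.
  elim: r => [|k r [IH1 IH2]].
    split.
      rewrite (_ : EFin \o _ = cst 0)%E ?integrable0//.
      by apply/funext => s /=; rewrite big_nil.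
    rewrite big_nil (_ : (fun s => _) = cst 0) ?Rintegral_cst ?mul0r//.
    by apply/funext => s; rewrite big_nil.
  have hk : mu.-integrable D (EFin \o (fun s => `|f s k 0|)) by exact: integrable_norm (h k).
  split.
    rewrite (_ : EFin \o _ = (fun s => (`|f s k 0|)%:E + (\sum_(k <- r) `|f s k 0|)%:E))%E.
      exact: integrableD.
    by apply/funext => s /=; rewrite big_cons EFinD.
  rewrite big_cons IH2 -RintegralD//; apply: eq_Rintegral => s _.
  by rewrite big_cons.
by have [_ ->] := hh (index_enum 'I_d).
Qed.

Lemma vintB d (D : set R) (f g : R -> 'cV[R]_d) : measurable D ->
  vintegrable D f -> vintegrable D g ->
  vintegrable D (fun s => f s - g s) /\
  vint D (fun s => f s - g s) = vint D f - vint D g.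
Proof.
move=> mD hf hg; split.
  move=> k; rewrite (_ : (fun s => _) = (fun s => (f s k 0)%:E - (g s k 0)%:E))%E.
    exact: integrableB.
  by apply/funext => s; rewrite !mxE EFinB.
apply/matrixP => i j; rewrite !mxE -RintegralB//; last exact: hg.
  by apply: eq_Rintegral => s _; rewrite !mxE.
exact: hf.
Qed.

Lemma vintD d (D : set R) (f g : R -> 'cV[R]_d) : measurable D ->
  vintegrable D f -> vintegrable D g ->
  vintegrable D (fun s => f s + g s) /\
  vint D (fun s => f s + g s) = vint D f + vint D g.
Proof.
move=> mD hf hg; split.
  move=> k; rewrite (_ : (fun s => _) = (fun s => (f s k 0)%:E + (g s k 0)%:E))%E.
    exact: integrableD.
  by apply/funext => s; rewrite !mxE EFinD.
apply/matrixP => i j; rewrite !mxE -RintegralD//; last exact: hg.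
  by apply: eq_Rintegral => s _; rewrite !mxE.
exact: hf.
Qed.

Lemma vint0 d (D : set R) : measurable D ->
  vintegrable D (fun=> 0 : 'cV[R]_d) /\ vint D (fun=> 0 : 'cV[R]_d) = 0.
Proof.
move=> mD; split.
  move=> k; rewrite (_ : (fun s => _) = cst 0)%E ?integrable0//.
  by apply/funext => s; rewrite mxE.
apply/matrixP => i j; rewrite !mxE (_ : (fun s => _) = cst 0) ?Rintegral_cst ?mul0r//.
Qed.

Lemma vint_sum d (D : set R) I (r : seq I) (f : I -> R -> 'cV[R]_d) : measurable D ->
  (forall i, vintegrable D (f i)) ->
  vintegrable D (fun s => \sum_(i <- r) f i s) /\
  vint D (fun s => \sum_(i <- r) f i s) = \sum_(i <- r) vint D (f i).
Proof.
move=> mD h; elim: r => [|i r [IH1 IH2]].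
  rewrite big_nil (_ : (fun s => _) = fun=> 0); first exact: vint0.
  by apply/funext => s; rewrite big_nil.
rewrite big_cons -IH2 (_ : (fun s => _) = fun s => f i s + \sum_(i <- r) f i s).
  exact: vintD.
by apply/funext => s; rewrite big_cons.
Qed.

End VectorIntegral.

(** * Continuous paths and Gronwall's inequality *)

Section ContinuousPaths.
Context {R : realType}.
Local Notation mu := (@lebesgue_measure R).
Implicit Types (T t : R).

Lemma continuous_mx (U : topologicalType) p q (f : U -> 'M[R]_(p, q)) :
  (forall i j, continuous (fun u => f u i j)) -> continuous f.
Proof.
move=> h u; apply/cvg_ballP => e e0.
suff H : \forall y \near u, forall i j, ball (f u i j) e (f y i j).
  by apply: filterS H => y.
apply: filter_forall => i; apply: filter_forall => j.
by have /cvg_ballP := h i j u; apply.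
Qed.

Lemma lipschitz_continuous d (g : 'cV[R]_d -> R) (K : R) :
  (forall x x', `|g x - g x'| <= K * n1 (x - x')) -> continuous g.
Proof.
move=> gK x; apply/(cvgrPdist_le (FF := nbhs_filter x)) => e e0.
pose M := `|K| * d%:R + 1.
have M0 : 0 < M by rewrite ltr_wpDl ?mulr_ge0.
have eM : 0 < e / M by rewrite divr_gt0.
near=> y; have [_ xy] : ball x (e / M) y by near: y; exact: nbhsx_ballx.
apply: (le_trans (gK _ _)); apply: (@le_trans _ _ (`|K| * (d%:R * (e / M)))).
  apply: (@le_trans _ _ (`|K| * n1 (x - y))).
    by rewrite ler_wpM2r ?n1_ge0// ler_norm.
  rewrite ler_wpM2l// n1_cV mulr_natl -[d in _ *+ d]card_ord -sumr_const ler_sum// => i _.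
  have := xy i 0; rewrite /ball/= => /ltW; by rewrite !mxE.
have -> : `|K| * (d%:R * (e / M)) = e * ((`|K| * d%:R) / M) by ring.
rewrite -[leRHS]mulr1; apply: ler_wpM2l; first exact: ltW.
by rewrite ler_pdivrMr// mul1r /M lerDl.
Unshelve. all: by end_near. Qed.

Lemma path_comp d T (xi : R -> 'cV[R]_d) (g : 'cV[R]_d -> R) : continuous_path T xi ->
  continuous g -> {within `[0, T], continuous (g \o xi)}.
Proof.
move=> cxi cg t; have := @continuous_comp (subspace `[0, T]) _ _ xi g t; apply.
  exact: cxi.
exact: cg.
Qed.

Lemma measurable_path_comp d T (xi : R -> 'cV[R]_d) (g : 'cV[R]_d -> R) :
  continuous_path T xi -> continuous g -> measurable_fun `[0, T] (g \o xi).
Proof.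
by move=> cxi cg; apply: subspace_continuous_measurable_fun => //; exact: path_comp.
Qed.

Lemma n1_lipschitz d (x x' : 'cV[R]_d) : `|n1 x - n1 x'| <= 1 * n1 (x - x').
Proof.
rewrite mul1r ler_distl; apply/andP; split.
  rewrite lerBlDr -(subrK x x') (le_trans (ler_n1D _ _))// addrC.
  by rewrite subrK lerD2l n1B.
by rewrite -{1}(subrK x' x) (le_trans (ler_n1D _ _))// addrC.
Qed.

Lemma path_bounded d T (xi : R -> 'cV[R]_d) : 0 <= T -> continuous_path T xi ->
  exists2 M : R, 0 <= M & forall t, 0 <= t <= T -> n1 (xi t) <= M.
Proof.
move=> T0 cxi.
have [c _ h] := EVT_max T0 (path_comp cxi (lipschitz_continuous (@n1_lipschitz d))).
exists (n1 (xi c)); first exact: n1_ge0.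
by move=> t tT; apply: h; rewrite in_itv.
Qed.

Lemma path_of_integral d T (x0 : 'cV[R]_d) (f : R -> 'cV[R]_d) : 0 <= T ->
  vintegrable `[0, T] f -> continuous_path T (fun t => x0 + vint `[0, t] f).
Proof.
move=> T0 hf; apply: continuous_mx => i j.
rewrite (_ : (fun t => _) = fun t => x0 i 0 + \int[mu]_(s in `[0, t]) f s i 0).
  move=> t; apply: cvgD; first exact: cvg_cst.
  exact: (parameterized_integral_continuous T0 (hf i)).
by apply/funext => t; rewrite !mxE ord1.
Qed.

Lemma path_eq d T (x y : R -> 'cV[R]_d) : (forall t, 0 <= t <= T -> x t = y t) ->
  continuous_path T x -> continuous_path T y.
Proof.
move=> xy; apply: subspace_eq_continuous => t; rewrite inE /= in_itv /= => h.
exact: xy.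
Qed.

Lemma measurable_path_coord d T (x : R -> 'cV[R]_d) k : continuous_path T x ->
  measurable_fun `[0, T] (fun t => x t k 0).
Proof.
move=> cx; apply: (measurable_path_comp (g := fun z : 'cV[R]_d => z k 0)) => // z.
exact: coord_continuous.
Qed.

Lemma measurable_n1_path d T (x x' : R -> 'cV[R]_d) :
  continuous_path T x -> continuous_path T x' ->
  measurable_fun `[0, T] (fun t => n1 (x t - x' t)).
Proof.
move=> cx cx'; have -> : (fun t => n1 (x t - x' t)) = fun t => \sum_k `|x t k 0 - x' t k 0|.
  by apply/funext => t; rewrite n1_cV; apply: eq_bigr => k _; rewrite !mxE.
apply: measurable_sum => k; apply: measurableT_comp => //.
by apply: measurable_funB; exact: measurable_path_coord.
Qed.

End ContinuousPaths.

Section Gronwall.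
Context {R : realType}.
Local Notation mu := (@lebesgue_measure R).
Implicit Types (T t : R).

(** [k <= 1 + k ^+ 2], and the interval has finite length. *)
Lemma integrable_sqrt_bound T (k h : R -> R) : measurable_fun `[0, T] k ->
  (forall s, 0 <= s <= T -> 0 <= k s /\ k s ^+ 2 <= h s) ->
  mu.-integrable `[0, T] (EFin \o h) -> mu.-integrable `[0, T] (EFin \o k).
Proof.
move=> mk hk ih.
have i1 : mu.-integrable `[0, T] (EFin \o (fun s => 1 + h s)).
  rewrite (_ : EFin \o _ = (fun s => 1%:E + (h s)%:E)%E)//.
  apply: integrableD => //; apply: (@bounded_integrable _ _ (cst 1) 1) => //.
  by move=> s _; rewrite normr1.
apply: le_integrable i1 => //; first exact/measurable_EFinP.
move=> s /=; rewrite in_itv /= => sT; have [k0 kh] := hk _ sT.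
rewrite lee_fin ger0_norm// ger0_norm; last by rewrite addr_ge0// (le_trans (sqr_ge0 _) kh).
have : k s <= 1 + k s ^+ 2 by have := sqr_ge0 (k s - 2^-1); lra.
lra.
Qed.

Lemma integrable_mul_bounded T (k f : R -> R) (M : R) :
  mu.-integrable `[0, T] (EFin \o k) -> measurable_fun `[0, T] f ->
  (forall s, 0 <= s <= T -> `|f s| <= M) ->
  mu.-integrable `[0, T] (EFin \o (fun s => k s * f s)).
Proof.
move=> ik mf fM; rewrite (_ : EFin \o _ = (EFin \o k) \* (EFin \o f))%E//.
apply: integrableMl => //; exists M; split; first exact: num_real.
move=> N MN s /=; rewrite in_itv /= => sT; exact: le_trans (fM s sT) (ltW MN).
Qed.

Lemma measurable_expRZ (lam : R) D : measurable_fun D (fun s : R => expR (lam * s)).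
Proof.
apply: measurable_funTS; apply: continuous_measurable_fun => s.
apply: (@continuous_comp _ _ _ (fun s => lam * s) expR); last exact: continuous_expR.
exact: mulrl_continuous.
Qed.

(* Splitting [k <= N + k^2 / N] lets one exponential weight absorb any square
   integrable coefficient. *)
Lemma exp_weight T (k h : R -> R) : 0 <= T -> measurable_fun `[0, T] k ->
  (forall s, 0 <= s <= T -> 0 <= k s /\ k s ^+ 2 <= h s) ->
  mu.-integrable `[0, T] (EFin \o h) ->
  exists2 lam, 0 < lam & forall t, 0 <= t <= T ->
    \int[mu]_(s in `[0, t]) (k s * expR (lam * s)) <= expR (lam * t) / 2.
Proof.
move=> T0 mk hk ih; pose H := \int[mu]_(s in `[0, T]) h s.
have h0 s : 0 <= s <= T -> 0 <= h s.
  by move=> sT; have [_] := hk s sT; apply: le_trans; exact: sqr_ge0.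
have H0 : 0 <= H by apply: Rintegral_ge0 => s /=; rewrite in_itv /=; exact: h0.
(* The part [N] of the coefficient integrates to at most [N / lam = 1 / 4] of the final weight, and
   the part [h / N] to at most [H / N <= 1 / 4] of it. *)
pose N := 4 * H + 1; pose lam := 4 * N.
have N0 : 0 < N by rewrite /N; lra.
have l0 : 0 < lam by rewrite mulr_gt0.
exists lam => // t /andP[t0 tT].
have expM s : 0 <= s <= t -> expR (lam * s) <= expR (lam * t).
  by move=> /andP[_ st]; rewrite ler_expR ler_wpM2l// ltW.
have ik := integrable_itvS tT (integrable_sqrt_bound mk hk ih).
have iht := integrable_itvS tT ih.
have ie : mu.-integrable `[0, t] (EFin \o (fun s => expR (lam * s))).
  apply: (@bounded_integrable _ _ _ (expR (lam * t))); first exact: measurable_expRZ.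
  by move=> s st; rewrite ger0_norm ?expR_ge0// expM.
have i1 : mu.-integrable `[0, t] (EFin \o (fun s => N * expR (lam * s))).
  exact: (integrableZl _ _ ie).
have i2 : mu.-integrable `[0, t] (EFin \o (fun s => expR (lam * t) / N * h s)).
  exact: (integrableZl _ _ iht).
apply: (@le_trans _ _ (\int[mu]_(s in `[0, t])
    (N * expR (lam * s) + expR (lam * t) / N * h s))).
  apply: le_Rintegral => //.
  - apply: (@integrable_mul_bounded _ k _ (expR (lam * t))) => //.
      exact: measurable_expRZ.
    by move=> s st; rewrite ger0_norm ?expR_ge0// expM.
  - rewrite (_ : EFin \o _ = (fun s => (N * expR (lam * s))%:E +
      (expR (lam * t) / N * h s)%:E)%E)//.
    exact: integrableD.
  - move=> s /=; rewrite in_itv /= => st.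
    have sT : 0 <= s <= T by case/andP: st => -> /le_trans; apply.
    have [k0 kh] := hk s sT.
    have kN : k s <= N + h s / N.
      apply: (@le_trans _ _ (N + k s ^+ 2 / N)); last first.
        by rewrite lerD2l ler_pM2r ?invr_gt0.
      rewrite -(ler_pM2r N0) mulrDl mulfVK ?gt_eqF//.
      by have := sqr_ge0 (k s - N / 2); have := sqr_ge0 N; lra.
    apply: (@le_trans _ _ ((N + h s / N) * expR (lam * s))).
      by rewrite ler_wpM2r ?expR_ge0.
    rewrite mulrDl lerD2l mulrC -mulrA (mulrC _^-1) ler_pM ?expR_ge0 ?expM//.
    by rewrite divr_ge0 ?h0 // ltW.
rewrite RintegralD// !RintegralZl//.
have e1 := Rintegral_exp_le l0 t0.
have e2 : \int[mu]_(s in `[0, t]) h s <= H by exact: le_Rintegral_itv.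
have E0 := expR_gt0 (lam * t); set X := expR (lam * t) in e1 E0 *.
apply: (@le_trans _ _ (N * (X / lam) + X / N * H)).
  apply: lerD; first by rewrite ler_wpM2l// ltW.
  by rewrite ler_wpM2l// divr_ge0// ltW.
have -> : N * (X / lam) = X / 4 by rewrite /lam; field; rewrite gt_eqF.
have : X / N * H <= X / 4.
  rewrite -mulrA ler_wpM2l ?(ltW E0)// ler_pdivrMl// /N; lra.
lra.
Qed.

(** Let [S] be the supremum of [f] divided by the weight of [exp_weight]. The integral inequality
    gives [S <= A + S / 2], hence [S <= 2 * A]. The bound [M] makes [S] finite without entering [C],
    which is therefore uniform in [f], [A] and [M]. *)
Lemma gronwall T (k h : R -> R) : 0 <= T -> measurable_fun `[0, T] k ->
  (forall s, 0 <= s <= T -> 0 <= k s /\ k s ^+ 2 <= h s) ->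
  mu.-integrable `[0, T] (EFin \o h) ->
  exists2 C, 0 < C & forall (A M : R) (f : R -> R), 0 <= A ->
    measurable_fun `[0, T] f -> (forall t, 0 <= t <= T -> 0 <= f t <= M) ->
    (forall t, 0 <= t <= T -> f t <= A + \int[mu]_(s in `[0, t]) (k s * f s)) ->
    forall t, 0 <= t <= T -> f t <= C * A.
Proof.
move=> T0 mk hk ih; have [lam l0 hw] := exp_weight T0 mk hk ih.
have ik := integrable_sqrt_bound mk hk ih.
exists (2 * expR (lam * T)); first by rewrite mulr_gt0 ?expR_gt0.
move=> A M f A0 mf fM fle.
pose E := [set f t / expR (lam * t) | t in `[0, T]].
have T00 : 0 <= (0 : R) <= T by rewrite lexx.
have E0 : E !=set0 by exists (f 0 / expR (lam * 0)), 0 => //=; rewrite in_itv.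
have e1 t : 0 <= t -> 1 <= expR (lam * t).
  by move=> t0; rewrite -expR0 ler_expR mulr_ge0 // ltW.
have Eb : has_ubound E.
  exists M => _ [t /= + <-]; rewrite in_itv /= => tT; have /andP[f0 fMt] := fM t tT.
  rewrite ler_pdivrMr ?expR_gt0//; apply: (le_trans fMt).
  by case/andP: tT => t0 _; rewrite ler_peMr ?e1// (le_trans f0).
pose S := sup E.
have fS t : 0 <= t <= T -> f t <= S * expR (lam * t).
  move=> tT; rewrite -ler_pdivrMr ?expR_gt0//; apply: (ub_le_sup Eb).
  by exists t => //=; rewrite in_itv.
have S0 : 0 <= S.
  have := fS 0 T00; rewrite mulr0 expR0 mulr1; apply: le_trans.
  by case/andP: (fM 0 T00).
have SA : S <= A + S / 2.
  apply: ge_sup => // _ [t /= + <-]; rewrite in_itv /= => tT.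
  have /andP[t0 tT'] := tT.
  rewrite ler_pdivrMr ?expR_gt0//; apply: (le_trans (fle t tT)).
  have ikt := integrable_itvS tT' ik.
  have ub s : 0 <= s <= t -> 0 <= s <= T by case/andP=> -> /le_trans; apply.
  have ie : mu.-integrable `[0, t] (EFin \o (fun s => k s * expR (lam * s))).
    apply: (@integrable_mul_bounded _ k _ (expR (lam * t))) => //.
      exact: measurable_expRZ.
    move=> s /andP[_ st]; rewrite ger0_norm ?expR_ge0// ler_expR ler_wpM2l//.
    exact: ltW.
  have : \int[mu]_(s in `[0, t]) (k s * f s) <= S * (expR (lam * t) / 2).
    apply: (@le_trans _ _ (\int[mu]_(s in `[0, t]) (S * (k s * expR (lam * s))))).
      apply: le_Rintegral => //.
      - apply: (@integrable_mul_bounded _ k _ M) => //.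
          exact: measurable_fun_itvS mf.
        by move=> s st; have /andP[f0 fs] := fM s (ub _ st); rewrite ger0_norm.
      - exact: (integrableZl _ _ ie).
      - move=> s /=; rewrite in_itv /= => st.
        by rewrite mulrCA ler_wpM2l ?fS ?ub//; case: (hk s (ub _ st)).
    by rewrite RintegralZl// ler_wpM2l// hw.
  have := e1 t t0; set X := expR _ => X1 hI; rewrite mulrDl mulrAC -mulrA.
  apply: lerD => //; by rewrite ler_peMr.
move=> t tT; apply: (le_trans (fS t tT)).
have S2 : S <= 2 * A by lra.
rewrite -mulrA mulrCA (mulrC _ (2 * A)); apply: ler_pM => //; rewrite ?expR_ge0//.
by rewrite ler_expR ler_wpM2l ?(ltW l0)//; case/andP: tT.
Qed.

End Gronwall.

(** * Caratheodory solutions *)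

Section Picard.
Context {R : realType}.
Local Notation mu := (@lebesgue_measure R).

(** The intervals of radius [2 * E / 2 ^+ n] around [u n] are nested, so the supremum of their left
    ends lies in all of them; the rate of convergence comes with it. *)
Lemma geometric_cauchy (u : nat -> R) (E : R) :
  (forall n, `|u n.+1 - u n| <= E / 2 ^+ n) ->
  exists z, forall n, `|u n - z| <= 2 * E / 2 ^+ n.
Proof.
move=> uE; have p0 n : 0 < 2 ^+ n :> R by rewrite exprn_gt0.
have step n : 2 * E / 2 ^+ n.+1 = E / 2 ^+ n.
  by rewrite exprS; field; rewrite gt_eqF.
have dbl n : 2 * E / 2 ^+ n = E / 2 ^+ n + E / 2 ^+ n by field; rewrite gt_eqF.
have E0 n : 0 <= E / 2 ^+ n by exact: le_trans (uE n).
pose a n := u n - 2 * E / 2 ^+ n; pose b n := u n + 2 * E / 2 ^+ n.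
have ia : nondecreasing_seq a.
  apply/nondecreasing_seqP => n; rewrite /a step dbl.
  by have := uE n; rewrite ler_norml => /andP[]; lra.
have ib : nonincreasing_seq b.
  apply/nonincreasing_seqP => n; rewrite /b step dbl.
  by have := uE n; rewrite ler_norml => /andP[]; lra.
have ab n m : a n <= b m.
  apply: (@le_trans _ _ (a (maxn n m))); first by apply: ia; rewrite leq_maxl.
  apply: (@le_trans _ _ (b (maxn n m))); last by apply: ib; rewrite leq_maxr.
  by rewrite /a /b dbl; have := E0 (maxn n m); lra.
exists (sup (range a)) => n.
have h1 : a n <= sup (range a).
  apply: ub_le_sup; last by exists n.
  by exists (b 0%N) => _ [m _ <-].
have h2 : sup (range a) <= b n.
  by apply: ge_sup; [exists (a 0%N); exists 0%N|move=> _ [m _ <-]].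
by move: h1 h2; rewrite /a /b ler_norml => h1 h2; apply/andP; split; lra.
Qed.

Lemma cvg_div_pow2 (C : R) : C / 2 ^+ n @[n --> \oo] --> 0.
Proof.
rewrite (_ : (fun n => _) = geometric C 2^-1).
  by apply: cvg_geometric; rewrite ger0_norm ?invf_lt1 ?ltr1n.
by apply/funext => n; rewrite /geometric /= exprVn.
Qed.

Lemma le0_div_pow2 (x C : R) : (forall n, x <= C / 2 ^+ n) -> x <= 0.
Proof.
move=> h; apply: (cvgr_to_ge (@cvg_div_pow2 C)).
by apply: nearW => n; exact: h.
Qed.

Lemma cvg_n1 d (u : nat -> 'cV[R]_d) (z : 'cV[R]_d) (C : R) :
  (forall n, n1 (u n - z) <= C / 2 ^+ n) -> forall k, u n k 0 @[n --> \oo] --> z k 0.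
Proof.
move=> h k; apply: (@cvg_dist_le _ _ (fun n => C / 2 ^+ n)); last exact: cvg_div_pow2.
move=> n; apply: le_trans (h n); have := le_n1 (u n - z) k 0.
by rewrite !mxE.
Qed.

(** Picard iteration in the sup norm weighted by [expR (lam * t)]. With [lam = 2 * K] the integral
    operator halves distances on all of [[0, T]], so no short intervals have to be patched
    together. *)
Lemma caratheodory d (T K B : R) (x0 : 'cV[R]_d) (F : R -> 'cV[R]_d -> 'cV[R]_d) :
  0 < T -> 0 < K ->
  (forall s x x', 0 <= s <= T -> n1 (F s x - F s x') <= K * n1 (x - x')) ->
  (forall s, 0 <= s <= T -> n1 (F s x0) <= B) ->
  (forall x, continuous_path T x -> forall k,
     measurable_fun `[0, T] (fun s => F s (x s) k 0)) ->
  exists x, [/\ continuous_path T x, vintegrable `[0, T] (fun s => F s (x s)) &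
    forall t, 0 <= t <= T -> x t = x0 + vint `[0, t] (fun s => F s (x s))].
Proof.
move=> T_gt0 K0 FK FB mF; have T0 := ltW T_gt0.
have Fbound x M : (forall s, 0 <= s <= T -> n1 (x s) <= M) ->
    forall s, 0 <= s <= T -> n1 (F s (x s)) <= B + K * (M + n1 x0).
  move=> xM s sT; have -> : F s (x s) = F s x0 + (F s (x s) - F s x0).
    by rewrite addrC subrK.
  apply: (le_trans (ler_n1D _ _)); apply: lerD; first exact: FB.
  apply: (le_trans (FK s _ _ sT)); rewrite ler_wpM2l ?(ltW K0)//.
  by apply: (le_trans (ler_n1D _ _)); rewrite n1N lerD2r xM.
have Fint x M : (forall k, measurable_fun `[0, T] (fun s => F s (x s) k 0)) ->
    (forall s, 0 <= s <= T -> n1 (x s) <= M) -> vintegrable `[0, T] (fun s => F s (x s)).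
  move=> mx xM k; apply: (@bounded_integrable _ _ _ (B + K * (M + n1 x0))) => // s sT.
  exact: le_trans (le_n1 _ _ _) (Fbound _ _ xM s sT).
pose Phi (x : R -> 'cV[R]_d) t := x0 + vint `[0, t] (fun s => F s (x s)).
pose X n := iter n Phi (cst x0).
have cX n : continuous_path T (X n).
  elim: n => [|n IH]; first by move=> t; exact: cvg_cst.
  have [M _ hM] := path_bounded T0 IH.
  by apply: path_of_integral => //; apply: (Fint _ M) => //; exact: mF.
have iX n : vintegrable `[0, T] (fun s => F s (X n s)).
  by have [M _ hM] := path_bounded T0 (cX n); apply: (Fint _ M) => //; exact: mF.
pose lam := 2 * K; have l0 : 0 < lam by rewrite mulr_gt0.
pose D := T * `|B|.
have D0 : 0 <= D by rewrite mulr_ge0.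
have ile t : 0 <= t <= T -> forall x y c, vintegrable `[0, T] (fun s => F s (x s)) ->
    vintegrable `[0, T] (fun s => F s (y s)) -> 0 <= c ->
    (forall s, 0 <= s <= T -> n1 (x s - y s) <= c * expR (lam * s)) ->
    n1 (Phi x t - Phi y t) <= c / 2 * expR (lam * t).
  move=> /andP[t0 tT] x y c ix iy c0 hxy.
  have ixt := vintegrable_itvS tT ix; have iyt := vintegrable_itvS tT iy.
  have mt : measurable (`[0, t] : set R) by [].
  have [iB eB] := vintB mt ixt iyt.
  have -> : Phi x t - Phi y t = vint `[0, t] (fun s => F s (x s) - F s (y s)).
    by rewrite eB /Phi opprD addrACA subrr add0r.
  apply: (le_trans (n1_vint mt iB)).
  have ie : mu.-integrable `[0, t] (EFin \o (fun s => expR (lam * s))).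
    apply: (@bounded_integrable _ _ _ (expR (lam * t))); first exact: measurable_expRZ.
    move=> s /andP[_ st]; rewrite ger0_norm ?expR_ge0// ler_expR ler_wpM2l//.
    exact: ltW.
  apply: (@le_trans _ _ (\int[mu]_(s in `[0, t]) (K * c * expR (lam * s)))).
    apply: le_Rintegral => //.
    - exact: (integrable_n1 _ iB).
    - exact: (integrableZl _ _ ie).
    - move=> s /=; rewrite in_itv /= => /andP[s0 st].
      have sT : 0 <= s <= T by rewrite s0 (le_trans st).
      by apply: (le_trans (FK s _ _ sT)); rewrite -mulrA ler_wpM2l ?(ltW K0)// hxy.
  rewrite RintegralZl//.
  apply: (le_trans (ler_wpM2l _ (Rintegral_exp_le l0 t0))).
    by rewrite mulr_ge0// ltW.
  rewrite le_eqVlt; apply/orP; left; apply/eqP; rewrite /lam; field.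
  by rewrite gt_eqF.
have dX n t : 0 <= t <= T -> n1 (X n.+1 t - X n t) <= D / 2 ^+ n * expR (lam * t).
  elim: n t => [|n IH] t tT.
    have /andP[t0 tT'] := tT.
    have mt : measurable (`[0, t] : set R) by [].
    rewrite expr0 divr1 /X /= /Phi addrAC subrr add0r.
    have it := vintegrable_itvS tT' (iX 0%N).
    apply: (le_trans (n1_vint mt it)).
    apply: (@le_trans _ _ (\int[mu]_(s in `[0, t]) (cst `|B| s))).
      apply: le_Rintegral => //.
      - exact: (integrable_n1 _ it).
      - by apply: (@bounded_integrable _ _ (cst `|B|) `|B|) => // s _; rewrite normr_id.
      - move=> s /=; rewrite in_itv /= => /andP[s0 st].
        by rewrite (le_trans _ (ler_norm _))// FB// s0 (le_trans st).
    rewrite Rintegral_cst//= lebesgue_measure_itv /= lte_fin.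
    apply: (@le_trans _ _ D).
      by rewrite /D mulrC ler_wpM2r//; case: ifP; rewrite /= ?subr0.
    by rewrite ler_peMr// -expR0 ler_expR mulr_ge0// ltW.
  have := ile t tT (X n.+1) (X n) (D / 2 ^+ n) (iX _) (iX _).
  rewrite exprS invfM mulrA [X in X * expR _](_ : _ = D / 2 ^+ n / 2); last by ring.
  by apply; [rewrite divr_ge0// exprn_ge0|exact: IH].
pose E := D * expR (lam * T).
have dXE n t : 0 <= t <= T -> n1 (X n.+1 t - X n t) <= E / 2 ^+ n.
  move=> tT; apply: (le_trans (dX n t tT)); rewrite /E mulrAC.
  rewrite ler_wpM2r ?invr_ge0 ?exprn_ge0// ler_wpM2l// ler_expR ler_wpM2l ?(ltW l0)//.
  by case/andP: tT.
have zex t k : exists z, 0 <= t <= T -> forall n, `|X n t k 0 - z| <= 2 * E / 2 ^+ n.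
  have [tT|/negP tT] := boolP (0 <= t <= T); last by exists 0.
  have [n|z hz] := @geometric_cauchy (fun n => X n t k 0) E.
    by apply: le_trans (dXE n t tT); have := le_n1 (X n.+1 t - X n t) k 0; rewrite !mxE.
  by exists z.
(* Coordinatewise limit of the iterates, with an arbitrary value outside [[0, T]]. *)
pose x t : 'cV[R]_d := \col_k sval (cid (zex t k)).
pose C := d%:R * (2 * E).
have xX n t : 0 <= t <= T -> n1 (X n t - x t) <= C / 2 ^+ n.
  move=> tT; rewrite n1_cV /C -mulrA mulr_natl -[d in _ *+ d]card_ord -sumr_const.
  apply: ler_sum => k _; rewrite !mxE; case: (cid _) => z /= /(_ tT); exact.
have E0 : 0 <= E by rewrite mulr_ge0 ?expR_ge0.
have C0 : 0 <= C by rewrite !mulr_ge0.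
have [M _ XM] := path_bounded T0 (cX 0%N).
have xM t : 0 <= t <= T -> n1 (x t) <= M + C.
  move=> tT; have -> : x t = X 0%N t - (X 0%N t - x t) by rewrite opprB addrC subrK.
  apply: (le_trans (ler_n1D _ _)); rewrite n1N lerD ?XM//.
  by have := xX 0%N t tT; rewrite expr0 divr1.
(* Continuity of [x] is not known yet, so measurability is inherited from the iterates; continuity
   follows at the end from the integral equation. *)
have ix : vintegrable `[0, T] (fun s => F s (x s)).
  apply: (Fint _ (M + C)) => // k.
  apply: (measurable_fun_cvg (fun n => mF _ (cX n) k)) => s /=.
  rewrite in_itv /= => sT.
  apply: (@cvg_n1 d (fun n => F s (X n s)) _ (K * C)) => n.
  by apply: (le_trans (FK s _ _ sT)); rewrite -mulrA ler_wpM2l ?(ltW K0)// xX.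
have xE t : 0 <= t <= T -> x t = Phi x t.
  move=> tT; apply/eqP; rewrite -subr_eq0; apply/eqP/n1_eq0.
  apply: (@le0_div_pow2 _ (C + C / 2 * expR (lam * t))) => n.
  apply: (le_trans (ler_n1_dist (X n.+1 t) _ _)).
  rewrite [leRHS]mulrDl; apply: lerD.
    rewrite n1B; apply: (le_trans (xX n.+1 t tT)); rewrite ler_wpM2l//.
    by rewrite lef_pV2 ?posrE ?exprn_gt0// ler_weXn2l ?ler1n.
  rewrite mulrAC (mulrAC C); apply: (ile t tT) => //; first by rewrite divr_ge0 ?exprn_ge0.
  move=> s sT; apply: (le_trans (xX n s sT)); rewrite ler_peMr ?divr_ge0 ?exprn_ge0//.
  by rewrite -expR0 ler_expR mulr_ge0 ?(ltW l0)//; case/andP: sT.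
exists x; split => //.
apply: (path_eq (x := Phi x)); first by move=> t tT; rewrite -xE.
exact: path_of_integral.
Qed.

End Picard.

(** * Borel maps into column vectors *)

Section BorelVectors.
Context {R : realType}.

Lemma open_rat_box p (U : set 'cV[R]_p) (x : 'cV[R]_p) : open U -> U x ->
  exists q : {ffun 'I_p -> rat * rat},
    (forall k, ratr (q k).1 < x k 0 < ratr (q k).2) /\
    forall y : 'cV[R]_p, (forall k, ratr (q k).1 < y k 0 < ratr (q k).2) -> U y.
Proof.
move=> oU Ux; have /nbhs_ballP[e /= e0 eU] : nbhs x U by exact: open_nbhs_nbhs.
have h k : exists q : rat * rat,
    x k 0 - e < ratr q.1 < x k 0 /\ x k 0 < ratr q.2 < x k 0 + e.
  have [q1 h1] : exists q, ratr q \in `]x k 0 - e, x k 0[.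
    by apply: rat_in_itvoo; rewrite ltrBlDr ltrDl.
  have [q2 h2] : exists q, ratr q \in `]x k 0, x k 0 + e[.
    by apply: rat_in_itvoo; rewrite ltrDl.
  by exists (q1, q2); move: h1 h2; rewrite !in_itv.
exists [ffun k => sval (cid (h k))]; split.
  move=> k; rewrite ffunE; case: (cid (h k)) => q /= [/andP[_ ->] /andP[-> _]] //.
move=> y hy; apply: eU; split => // i j; rewrite ord1.
have := hy i; rewrite ffunE; case: (cid (h i)) => q /= [/andP[a1 a2] /andP[a3 a4]].
move=> /andP[b1 b2]; rewrite /ball /= ltr_norml; apply/andP; split; lra.
Qed.

(** An open set is a countable union of boxes with rational corners, and the preimage of a box is a
    finite intersection of coordinate preimages. *)
Lemma measurable_borel_cV d (T : measurableType d) (D : set T) p (f : T -> 'cV[R]_p) :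
  measurable D -> (forall k, measurable_fun D (fun s => f s k 0)) ->
  measurable_fun D (f : T -> borel 'cV[R]_p).
Proof.
move=> mD mf; apply: (@measurability _ _ T (borel 'cV[R]_p) D f (@open 'cV[R]_p)) => // _ [U oU <-].
pose box (q : {ffun 'I_p -> rat * rat}) : set 'cV[R]_p :=
  [set y | forall k, ratr (q k).1 < y k 0 < ratr (q k).2].
pose G q := if `[< box q `<=` U >] then D `&` f @^-1` box q else set0.
have -> : D `&` f @^-1` U = \bigcup_q G q.
  apply/seteqP; split => [s [Ds Us]|s [q _]]; last first.
    by rewrite /G; case: asboolP => // h [Ds /h].
  have [q [h1 h2]] := open_rat_box oU Us.
  by exists q => //; rewrite /G; case: asboolP => // h; exfalso; apply: h.
apply: countable_bigcupT_measurable => [|q]; first exact: countableP.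
rewrite /G; case: asboolP => // _.
have -> : D `&` f @^-1` box q =
    D `&` \bigcap_(k in [set: 'I_p])
      (D `&` (fun s => f s k 0) @^-1` `]ratr (q k).1, ratr (q k).2[).
  apply/seteqP; split => s [Ds h]; split => //.
    by move=> k _; split => //=; rewrite in_itv /=; exact: h.
  by move=> k; have [_ /=] := h k Logic.I; rewrite in_itv.
apply: measurableI => //; apply: fin_bigcap_measurable => // k _.
exact: mf.
Qed.

Lemma measurable_continuous_borel p (g : 'cV[R]_p -> R) : continuous g ->
  measurable_fun [set: borel 'cV[R]_p] (g : borel 'cV[R]_p -> R).
Proof.
move=> cg; apply: (measurability _ (RGenOInfty.measurableE R)) => // _ [_ [x ->] <-].
rewrite setTI; apply: sub_sigma_algebra.
apply: open_comp; last exact: interval_open.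
by move=> y _; exact: cg.
Qed.

Lemma measurable_coord d (T : measurableType d) (D : set T) p
    (f : T -> borel 'cV[R]_p) k :
  measurable_fun D f -> measurable_fun D (fun s => (f s : 'cV[R]_p) k 0).
Proof.
move=> mf; apply: (@measurableT_comp _ _ _ _ _ _ (fun y : borel 'cV[R]_p => (y : 'cV[R]_p) k 0)) mf.
apply: (@measurable_continuous_borel p (fun y => y k 0)) => y.
exact: coord_continuous.
Qed.

End BorelVectors.

(** * Constants of the model *)

Section StepIntegral.
Context {R : realType}.
Local Notation mu := (@lebesgue_measure R).

Lemma integral_step (E e0 al be : R) : 0 <= E -> 0 <= e0 -> 0 <= al -> 0 <= be ->
  (\int[mu]_(z in `[0%R, E]) (if (z <= e0)%R then al else be)%:E
    = (al * Num.min E e0 + be * Num.max (E - e0) 0)%:E)%E.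
Proof.
move=> E0 e00 al0 be0; have [Ee|eE] := leP E e0.
  rewrite (eq_integral (cst al%:E)); last first.
    by move=> z; rewrite inE /= in_itv /= => /andP[_ zE]; rewrite (le_trans zE).
  rewrite integral_cst//= lebesgue_measure_itv /= lte_fin max_r ?subr_le0// mulr0 addr0.
  move: E0; rewrite le_eqVlt => /predU1P[<-|->]; first by rewrite ltxx mule0 mulr0.
  by rewrite sube0.
have -> : `[0, E]%classic = (`[0, e0] `|` `]e0, E])%classic :> set R.
  by apply: itv_bndbnd_setU; rewrite bnd_simp// ltW.
rewrite ge0_integral_setU//=; last 3 first.
- apply/measurable_EFinP; apply: measurable_funTS.
  apply: measurable_fun_ifT => //; by apply: measurable_fun_ler => //.
- by move=> z _; rewrite lee_fin; case: ifP.
- rewrite disj_set2E; apply/eqP/seteqP; split => // z [] /=.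
  by rewrite !in_itv /= => /andP[_ h] /andP[h' _]; rewrite leNgt h' in h.
rewrite (eq_integral (cst al%:E)); last first.
  by move=> z; rewrite inE /= in_itv /= => /andP[_ ->].
rewrite [X in (_ + X)%E](eq_integral (cst be%:E)); last first.
  by move=> z; rewrite inE /= in_itv /= => /andP[h _]; rewrite leNgt h.
rewrite !integral_cst//= !lebesgue_measure_itv /= !lte_fin eE max_l ?subr_ge0 ?ltW//.
move: e00; rewrite le_eqVlt => /predU1P[<-|->].
  by rewrite ltxx mule0 mulr0 add0e add0r subr0 sube0.
by rewrite sube0.
Qed.

End StepIntegral.

Section Model.
Context {R : realType} {d m l : nat}.
Local Notation mu := (@lebesgue_measure R).
Variables (b : 'cV[R]_d -> 'I_l -> 'cV[R]_d) (a : 'cV[R]_d -> 'I_l -> 'M[R]_(d, m)).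
Variables (c : 'cV[R]_d -> 'I_l -> R) (r : 'cV[R]_d -> 'I_l -> 'I_l -> R).

Definition rate (x : 'cV[R]_d) (i j : 'I_l) : R := c x i * r x i j.

Lemma inf_bigmin_gt0 (I : finType) (P : pred I) (f : 'cV[R]_d -> I -> R) :
  (0 < ereal_inf (range (fun x => \big[mine/+oo]_(p | P p) (f x p)%:E)))%E ->
  exists2 e : R, 0 < e & forall x p, P p -> e <= f x p.
Proof.
set S := range _ => S0.
have lb x p : P p -> (ereal_inf S <= (f x p)%:E)%E.
  move=> Pp; apply: (@le_trans _ _ (\big[mine/+oo]_(p | P p) (f x p)%:E)%E).
    by apply: ereal_inf_lbound; exists x.
  exact: bigmin_le_cond.
case: (ereal_inf S) S0 lb => [e|_|//].
  by rewrite lte_fin => e0 lb; exists e.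
(* An infinite infimum means that no index satisfies [P], since [f] is real valued; the bound then
   holds vacuously. *)
by move=> lb; exists 1 => // x p /(lb x).
Qed.

(** The jump integrals have to be finite only where [p i] is nonzero, thanks to the convention that
    0 times infinity is 0. For the given triple nothing better is available. *)
Lemma stationary_balanced (psi : 'I_l -> 'I_l -> R -> R) x (p : 'I_l -> R) G :
  (forall i j, p i != 0 ->
    (\int[mu]_(z in Eset c r x i j) (psi i j z)%:E = (G i j)%:E)%E) ->
  stationary c r psi x p <-> balanced G p.
Proof.
move=> h.
have E j : (\sum_i ((p i)%:E * Agen c r (psi i) x i j))%dE =
    (\sum_i p i * G i j - p j * \sum_y G j y)%:E.
  have -> : \sum_i p i * G i j - p j * \sum_y G j y =
      \sum_i p i * (if i == j then - \sum_(y | y != j) G j y else G i j).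
    have e1 : \sum_(i | i != j) p i * (if i == j then - \sum_(y | y != j) G j y
        else G i j) = \sum_(i | i != j) p i * G i j.
      by apply: eq_bigr => i /negPf ->.
    rewrite [in RHS](bigD1 j)//= eqxx e1 (bigD1 j (F := fun i => p i * G i j))//=.
    by rewrite (bigD1 j (F := G j))//=; ring.
  rewrite -DualAddTheoryNumDomain.dsumEFin; apply: eq_bigr => i _.
  have [pi0|pi0] := eqVneq (p i) 0; first by rewrite pi0 mul0e mul0r.
  rewrite EFinM; congr (_ * _)%E; rewrite /Agen; case: eqP => [ij|_]; last exact: h.
  rewrite EFinN -sumEFin; congr (- _)%E; apply: eq_bigr => y _.
  by rewrite -ij h.
split=> [H j|H j].
  by have /eqP := H j; rewrite E eqe subr_eq0 => /eqP.
by rewrite E H subrr.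
Qed.

(** Jump intensities depend on [c] and [r] through the product [rate] only. The graph of possible
    jumps is the same at every point: a rate is either at least [kap] everywhere or identically
    zero. *)
Record model_consts (K kap cb : R) : Prop := ModelConsts {
  mc_K : 0 < K; mc_kap : 0 < kap; mc_kapcb : kap <= cb;
  mc_b : forall x x' y, n1 (b x y - b x' y) <= K * n1 (x - x');
  mc_a : forall x x' y, n1 (a x y - a x' y) <= K * n1 (x - x');
  mc_rate : forall x x' i j, `|rate x i j - rate x' i j| <= K * n1 (x - x');
  mc_rate0 : forall x i j, 0 <= rate x i j;
  mc_sum : forall x i, \sum_j rate x i j <= cb;
  mc_zeta : forall x i j, rate x i j <= zeta c;
  mc_TT : forall x i j, (i, j) \in TT r -> kap <= rate x i j;
  mc_nTT : forall x i j, (i, j) \notin TT r -> rate x i j = 0;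
  mc_irr : forall x y z, exists2 n, (n < l)%N & 0 < rhat r n x y z }.

Lemma sup_zeta (M : R) x y : (forall x y, c x y <= M) -> c x y <= zeta c.
Proof.
move=> cM; rewrite /zeta.
apply: (@le_trans _ _ (sup [set c p.1 p.2 | p in [set: 'cV[R]_d * 'I_l]])).
  apply: ub_le_sup; last by exists (x, y).
  by exists M => _ [p _ <-].
by rewrite lerDl.
Qed.

Lemma model_constsP : (0 < l)%N -> (forall x y, 0 <= c x y) ->
  (forall x y y', 0 <= r x y y' <= 1) -> A1 b a c r -> A2 c r ->
  exists K kap cb, model_consts K kap cb.
Proof.
move=> l0 c0 r01 [[K hK] [M cM] r1 rd] [].
have r0 x y y' : 0 <= r x y y' by case/andP: (r01 x y y').
have rl1 x y y' : r x y y' <= 1 by case/andP: (r01 x y y').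
move=> /inf_bigmin_gt0[alpha al0 hal] /inf_bigmin_gt0[sig sig0 hsig].
move=> /inf_bigmin_gt0[k3 k30 hk3].
pose K0 := `|K|; have K00 : 0 <= K0 by exact: normr_ge0.
have hK0 x x' y y' : [/\ enorm (b x y - b x' y) <= K0 * n1 (x - x'),
    enorm (a x y - a x' y) <= K0 * n1 (x - x'),
    `|c x y - c x' y| <= K0 * n1 (x - x') &
    `|r x y y' - r x' y y'| <= K0 * n1 (x - x')].
  have [h1 h2 h3 h4] := hK x x' y y'.
  have h : K * enorm (x - x') <= K0 * n1 (x - x').
    apply: (@le_trans _ _ (K0 * enorm (x - x'))).
      by rewrite ler_wpM2r ?enorm_ge0// ler_norm.
    by rewrite ler_wpM2l// enorm_le_n1.
  by split; apply: le_trans h.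
have M0 : 0 <= M by apply: le_trans (cM 0 (Ordinal l0)).
pose K1 := d%:R * K0 + (d * m)%:R * K0 + K0 + M * K0 + 1.
have p1 : 0 <= d%:R * K0 by rewrite mulr_ge0.
have p2 : 0 <= (d * m)%:R * K0 by rewrite mulr_ge0.
have p3 : 0 <= M * K0 by rewrite mulr_ge0.
have sk : sig * k3 <= M + sig * k3 by rewrite lerDr.
(* [K1] adds up the constants required by [b], [a] and the product of [c] and [r], plus 1 for
   positivity. Adding [sig * k3] to the bound [M] of [c] makes [kap <= cb] immediate. *)
exists K1, (sig * k3), (M + sig * k3); split => //.
- by rewrite /K1; lra.
- by rewrite mulr_gt0.
- move=> x x' y; have [h _ _ _] := hK0 x x' y y.
  apply: (le_trans (n1_le_enorm _)); rewrite muln1.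
  apply: (@le_trans _ _ (d%:R * (K0 * n1 (x - x')))); first by rewrite ler_wpM2l.
  by rewrite mulrA ler_wpM2r ?n1_ge0// /K1; lra.
- move=> x x' y; have [_ h _ _] := hK0 x x' y y.
  apply: (le_trans (n1_le_enorm _)).
  apply: (@le_trans _ _ ((d * m)%:R * (K0 * n1 (x - x')))); first by rewrite ler_wpM2l.
  by rewrite mulrA ler_wpM2r ?n1_ge0// /K1; lra.
- move=> x x' i j; have [_ _ h1 h2] := hK0 x x' i j.
  have -> : rate x i j - rate x' i j =
    (c x i - c x' i) * r x i j + c x' i * (r x i j - r x' i j) by rewrite /rate; ring.
  apply: (le_trans (ler_normD _ _)); rewrite !normrM.
  apply: (@le_trans _ _ (K0 * n1 (x - x') + M * (K0 * n1 (x - x')))).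
    apply: lerD.
      by rewrite -[leRHS]mulr1 ler_pM// ger0_norm.
    by rewrite ler_pM// ger0_norm.
  by rewrite mulrA -mulrDl ler_wpM2r ?n1_ge0// /K1; lra.
- by move=> x i j; rewrite /rate mulr_ge0.
- move=> x i; rewrite /rate -mulr_sumr r1 mulr1.
  by apply: (le_trans (cM x i)); rewrite lerDl mulr_ge0// ltW.
- move=> x i j; apply: le_trans (sup_zeta x i cM).
  by rewrite /rate ler_piMr.
- move=> x i j hT; rewrite /rate ler_pM ?(ltW sig0) ?(ltW k30)//; first exact: (hsig x i isT).
  exact: (hk3 x (i, j) hT).
- move=> x i j; rewrite notin_setE /TT /= => hT; rewrite /rate.
  have -> : r x i j = 0; last by rewrite mulr0.
  apply/eqP; rewrite eq_le r0 andbT leNgt; apply/negP => h.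
  by apply: hT; exists x.
- move=> x y z; have h : 0 < \sum_(n < l) rhat r n x y z.
    by apply: lt_le_trans al0 _; exact: (hal x (y, z) isT).
  have /existsP[n hn] : [exists n : 'I_l, 0 < rhat r n x y z].
    move: h; apply: contraTT; rewrite negb_exists => /forallP hn.
    by rewrite -leNgt; apply: sumr_le0 => n _; rewrite leNgt; exact: hn.
  by exists n.
Qed.

End Model.

(** * The entropy cost on a rectangle *)

Section Entropy.
Context {R : realType}.
Local Notation mu := (@lebesgue_measure R).

(** The left side is the tangent of [ell] at [y]; the inequality amounts to [1 + ln t <= t] at
    [t = y / x]. *)
Lemma ell_tangent (x y : R) : 0 <= x -> 0 < y -> x * ln y + (1 - y) <= ell x.
Proof.
rewrite /ell le_eqVlt => /predU1P[<- y0|x0 y0]; first by rewrite !mul0r; lra.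
have yx0 : 0 < y / x by rewrite divr_gt0.
have : 1 + ln (y / x) <= y / x by rewrite -[leRHS]lnK ?posrE// expR_ge1Dx.
rewrite ln_div ?posrE// => h.
have : x * (1 + (ln y - ln x)) <= x * (y / x) by rewrite ler_wpM2l// ltW.
have -> : x * (y / x) = y by field; rewrite gt_eqF.
lra.
Qed.

Lemma ell_ge0 (x : R) : 0 <= x -> 0 <= ell x.
Proof. by move=> /ell_tangent /(_ ltr01); rewrite ln1; lra. Qed.

(** The tangent at [expR 1], of slope 1: it bounds a flux by its cost. *)
Lemma le_ell (x : R) : 0 <= x -> x <= ell x + expR 1.
Proof. by move=> /ell_tangent /(_ (expR_gt0 1)); rewrite expRK; lra. Qed.

Lemma ell1 : ell (1 : R) = 0.
Proof. by rewrite /ell ln1; lra. Qed.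

Lemma measurable_ell : measurable_fun [set: R] (@ell R).
Proof.
apply: measurable_funD => //; apply: measurable_funB => //.
by apply: measurable_funM => //; exact: measurable_ln.
Qed.

Section Rectangle.
Variables (A B : set R) (f : R * R -> \bar R).
Hypotheses (mA : measurable A) (mB : measurable B).
Hypothesis mf : measurable_fun (A `*` B) f.
Hypothesis f_ge0 : forall p, (A `*` B) p -> (0 <= f p)%E.

Let g := f \_ (A `*` B).

Let mAB : measurable (A `*` B). Proof. exact: measurableX. Qed.

Let mg : measurable_fun setT g. Proof. exact/(measurable_restrictT f mAB). Qed.

Let g0 p : (0 <= g p)%E. Proof. exact: erestrict_ge0. Qed.

Let gE x : (\int[mu]_y g (x, y) = (fun x => \int[mu]_(y in B) f (x, y)) \_ A x)%E.
Proof.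
rewrite [RHS]patchE; case: ifPn => [|] xA.
  rewrite [RHS]integral_mkcond; apply: eq_integral => y _; rewrite /g !patchE.
  have -> : ((x, y) \in A `*` B) = (y \in B) by rewrite in_setX /= xA.
  by [].
by rewrite integral0_eq// => y _; rewrite /g patchE in_setX /= (negPf xA).
Qed.

(** After extension by zero, Tonelli's theorem on the whole plane applies. *)
Lemma measurable_integral_rectangle :
  measurable_fun A (fun x => \int[mu]_(y in B) f (x, y))%E.
Proof.
apply/(measurable_restrictT _ mA).
have := @measurable_fun_fubini_tonelli_F _ _ _ _ _ mu g mg g0.
by rewrite /fubini_F (funext gE).
Qed.

Lemma integral_rectangle :
  (\int[mu \x mu]_(p in A `*` B) f p = \int[mu]_(x in A) \int[mu]_(y in B) f (x, y))%E.
Proof.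
rewrite [LHS]integral_mkcond fubini_tonelli1// [RHS]integral_mkcond.
by apply: eq_integral => x _; exact: gE.
Qed.

End Rectangle.

(** * Flux and cost density of a single jump control *)

Section JumpControl.
Variables (T ze : R) (f : R -> R -> R) (p e : R -> R).
Hypothesis mf : measurable_fun (`[0, T] `*` `[0, ze]) (fun q : R * R => f q.1 q.2).
Hypothesis f_ge0 : forall s z, 0 <= s <= T -> 0 <= z <= ze -> 0 <= f s z.
Hypotheses (mp : measurable_fun `[0, T] p) (me : measurable_fun `[0, T] e).
Hypothesis p_ge0 : forall s, 0 <= s <= T -> 0 <= p s.
Hypothesis e_itv : forall s, 0 <= s <= T -> 0 <= e s <= ze.

Let Jb s := (\int[mu]_(z in `[0%R, ze]) (ell (f s z) * p s)%:E)%E.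
Let off s := (\int[mu]_(z in `[0%R, e s]) (f s z)%:E)%E.

Let cost := (\int[mu \x mu]_(q in `[0%R, T] `*` `[0%R, ze]) (ell (f q.1 q.2) * p q.1)%:E)%E.

Let mrect : measurable (`[0, T] `*` `[0, ze] : set (R * R)).
Proof. exact: measurableX. Qed.

Let rectP (q : R * R) : (`[0, T] `*` `[0, ze]) q -> 0 <= q.1 <= T /\ 0 <= q.2 <= ze.
Proof. by move=> [] /=; rewrite !in_itv. Qed.

Let mfst (g : R -> R) : measurable_fun `[0, T] g ->
  measurable_fun (`[0, T] `*` `[0, ze]) (fun q : R * R => g q.1).
Proof.
move=> mg; apply: (measurable_comp (F := `[0, T]) _ _ mg) => //.
  by move=> _ [q /rectP[h _] <-]; rewrite /= in_itv.
by apply: measurable_funTS; exact: measurable_fst.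
Qed.

Lemma measurable_jump_integrand :
  measurable_fun (`[0, T] `*` `[0, ze]) (fun q : R * R => (ell (f q.1 q.2) * p q.1)%:E).
Proof.
apply/measurable_EFinP; apply: measurable_funM; last exact: mfst.
by apply: measurableT_comp => //; exact: measurable_ell.
Qed.

(** The moving upper limit [e s] becomes an indicator on the fixed rectangle, where Tonelli's
    theorem gives measurability. *)
Lemma measurable_flux : measurable_fun `[0, T] off.
Proof.
pose g (q : R * R) := (if q.2 <= e q.1 then f q.1 q.2 else 0)%:E.
have mg : measurable_fun (`[0, T] `*` `[0, ze]) g.
  apply/measurable_EFinP; apply: measurable_fun_if => //.
  - by apply: measurable_fun_ler; [exact: measurable_funTS|exact: mfst].
  - by apply: measurable_funS mf => // q [].
have g0 q : (`[0, T] `*` `[0, ze]) q -> (0 <= g q)%E.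
  by move=> /rectP[h1 h2]; rewrite lee_fin; case: ifP => // _; exact: f_ge0.
have mI := measurable_integral_rectangle (measurable_itv _) (measurable_itv _) mg g0.
apply: eq_measurable_fun mI => s; rewrite inE /= in_itv /= => sT.
rewrite /off [RHS]integral_mkcond [LHS]integral_mkcond; apply: eq_integral => z _.
rewrite !patchE /g /=; have /andP[e0 eze] := e_itv sT.
have -> : (z \in `[0, ze]%classic) = (0 <= z <= ze) by apply/idP/idP; rewrite inE /= in_itv.
have -> : (z \in `[0, e s]%classic) = (0 <= z <= e s) by apply/idP/idP; rewrite inE /= in_itv.
case: (leP z (e s)) => h; last by rewrite andbF if_same.
by rewrite (le_trans h eze).
Qed.

Lemma measurable_jump_cost : measurable_fun `[0, T] Jb.
Proof.
apply: (measurable_integral_rectangle _ _ measurable_jump_integrand) => //.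
by move=> q /rectP[h1 h2]; rewrite lee_fin mulr_ge0 ?p_ge0// ell_ge0// f_ge0.
Qed.

Lemma jump_cost_ge0 s : 0 <= s <= T -> (0 <= Jb s)%E.
Proof.
move=> sT; apply: integral_ge0 => z /=; rewrite in_itv /= => zz.
by rewrite lee_fin mulr_ge0 ?p_ge0// ell_ge0// f_ge0.
Qed.

Lemma jump_costE : cost = (\int[mu]_(s in `[0%R, T]) Jb s)%E.
Proof.
rewrite /cost (integral_rectangle _ _ measurable_jump_integrand)//.
by move=> q /rectP[h1 h2]; rewrite lee_fin mulr_ge0 ?p_ge0// ell_ge0// f_ge0.
Qed.

Let mfs s : 0 <= s <= T -> measurable_fun `[0, ze] (f s).
Proof.
move=> sT; have h : measurable_fun `[0, ze] (fun z : R => (s, z)).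
  by apply: measurable_funTS; exact: pair1_measurable.
apply: (measurable_comp (F := `[0, T] `*` `[0, ze]) _ _ mf h) => //.
by move=> _ [z zz <-]; split => //=; rewrite in_itv.
Qed.

(* Where the cost density is finite, the flux is finite and the tangent lines of
   [ell] bound the cost density from below. *)
Lemma jump_cost_tangent s : 0 <= s <= T -> (Jb s < +oo)%E -> p s != 0 ->
  off s \is a fin_num /\
  forall y, 0 < y -> p s * fine (off s) * ln y + p s * e s * (1 - y) <= fine (Jb s).
Proof.
move=> sT Joo pN0.
have p0 : 0 < p s by rewrite lt_def pN0 p_ge0.
have /andP[e0 eze] := e_itv sT.
have sub : `[0, e s]%classic `<=` `[0, ze]%classic.
  by move=> z /=; rewrite !in_itv /= => /andP[-> /le_trans]; apply.
have mE : measurable (`[0, e s] : set R) by [].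
have fin : (mu `[0%R, e s]%classic < +oo)%E.
  by rewrite /= lebesgue_measure_itv /=; case: ifP => //; rewrite ltry.
have f0 z : 0 <= z <= e s -> 0 <= f s z.
  by move=> /andP[z0 ze']; apply: f_ge0 => //; rewrite z0 (le_trans ze').
have mfE : measurable_fun `[0, e s] (f s) by apply: measurable_funS (mfs sT).
have mell : measurable_fun `[0, e s] (fun z => ell (f s z)).
  by apply: measurableT_comp => //; exact: measurable_ell.
pose g z := ell (f s z) * p s.
have mg : measurable_fun `[0, ze] g.
  apply: measurable_funM => //.
  by apply: measurableT_comp; [exact: measurable_ell|exact: mfs].
have ig : mu.-integrable `[0, ze] (EFin \o g).
  apply/integrableP; split; first exact/measurable_EFinP.
  rewrite [X in (X < _)%E](_ : _ = Jb s)//; apply: eq_integral => z.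
  rewrite inE /= in_itv /= => zz; congr _%:E.
  by rewrite ger0_norm// mulr_ge0 ?p_ge0// ell_ge0// f_ge0.
have igE : mu.-integrable `[0, e s] (EFin \o g) by exact: integrableS ig.
(* Finiteness of [Jb s] passes to [ell (f s z)] after division by [p s], which is positive here. *)
have iell : mu.-integrable `[0, e s] (EFin \o (fun z => ell (f s z))).
  have -> : EFin \o (fun z => ell (f s z)) = (fun z => ((p s)^-1)%:E * (EFin \o g) z)%E.
    by apply/funext => z /=; rewrite -EFinM /g mulrCA mulVf ?mulr1 // gt_eqF.
  exact: integrableZl.
have icst k : mu.-integrable `[0, e s] (EFin \o cst k).
  apply: measurable_bounded_integrable => //.
  by exists `|k|; split; [exact: num_real|move=> N /ltW h z _].
have ifs : mu.-integrable `[0, e s] (EFin \o f s).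
  have iS : mu.-integrable `[0, e s] (fun z => (ell (f s z))%:E + (expR 1)%:E)%E.
    by apply: (integrableD _ iell (icst (expR 1))).
  apply: le_integrable iS => //; first exact/measurable_EFinP.
  move=> z /=; rewrite in_itv /= => /f0 fz; rewrite lee_fin ger0_norm// ger0_norm.
    exact: le_ell.
  by rewrite addr_ge0 ?ell_ge0// expR_ge0.
split; first exact: integrable_fin_num.
move=> y y0.
have -> : p s * fine (off s) * ln y + p s * e s * (1 - y) =
    p s * \int[mu]_(z in `[0, e s]) (f s z * ln y + cst (1 - y) z).
  rewrite RintegralD// ?RintegralZr ?Rintegral_cst//; last first.
    rewrite (_ : EFin \o _ = (EFin \o f s) \* cst (ln y)%:E)%E//.
    exact: integrableZr.
  have -> : fine (mu `[0, e s]%classic) = e s.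
    rewrite /= lebesgue_measure_itv /= lte_fin; move: e0.
    by rewrite le_eqVlt => /predU1P[<-|->] /=; rewrite ?ltxx ?subr0.
  by rewrite /off /Rintegral; ring.
(* The tangent is integrated over [[0, e s]] only; the cost over the rest of [[0, ze]] is
   nonnegative and dropped. *)
apply: (@le_trans _ _ (\int[mu]_(z in `[0, e s]) g z)).
  rewrite /g RintegralZr// mulrC ler_wpM2r ?(ltW p0)//; apply: le_Rintegral => //.
    rewrite (_ : EFin \o _ = (fun z => (f s z * ln y)%:E + (cst (1 - y) z)%:E)%E)//.
    apply: integrableD => //; last exact: icst.
    rewrite (_ : (fun z => _) = (EFin \o f s) \* cst (ln y)%:E)%E//.
    exact: integrableZr.
  by move=> z /=; rewrite in_itv /= => /f0 fz; exact: ell_tangent.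
rewrite /Rintegral fine_le ?integrable_fin_num//.
apply: ge0_subset_integral => //; first exact/measurable_EFinP.
move=> z /=; rewrite in_itv /= => zz.
by rewrite lee_fin mulr_ge0 ?p_ge0// ell_ge0// f_ge0.
Qed.

End JumpControl.

End Entropy.

(** * The invariant law as a Lipschitz kernel *)

Section InvariantKernel.
Context {R : realType} {d m l : nat}.
Local Notation mu := (@lebesgue_measure R).
Variables (b : 'cV[R]_d -> 'I_l -> 'cV[R]_d) (a : 'cV[R]_d -> 'I_l -> 'M[R]_(d, m)).
Variables (c : 'cV[R]_d -> 'I_l -> R) (r : 'cV[R]_d -> 'I_l -> 'I_l -> R).
Variables (K kap cb : R).
Hypothesis mc : model_consts b a c r K kap cb.
Hypothesis r_ge0 : forall x i j, 0 <= r x i j.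
Hypothesis l_gt0 : (0 < l)%N.
Variables (T m2 m3 : R) (q es : R -> 'I_l -> 'I_l -> R).
Hypotheses (m2_gt0 : 0 < m2) (m2_le1 : m2 <= 1) (m3_ge1 : 1 <= m3).
Hypothesis q_itv : forall s i j, 0 <= s <= T -> (i, j) \in TT r -> m2 <= q s i j <= m3.
Hypothesis es_ge0 : forall s i j, 0 <= s <= T -> 0 <= es s i j.
Hypothesis mq : forall i j, measurable_fun `[0, T] (fun s => q s i j).
Hypothesis mes : forall i j, measurable_fun `[0, T] (fun s => es s i j).

(* The constant intensity [q s i j] is applied only up to the edge [es s i j], and
   the original intensity 1 beyond it.  The rates at [x] are then Lipschitz in [x]
   and positive exactly where the original rates are, and for [es] the rate at the
   current point of a path they are [q] times the original ones on that path. *)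
Definition step_control (i j : 'I_l) (s z : R) : R := if z <= es s i j then q s i j else 1.

Definition step_rate (s : R) (x : 'cV[R]_d) (i j : 'I_l) : R :=
  q s i j * Num.min (rate c r x i j) (es s i j)
  + Num.max (rate c r x i j - es s i j) 0.

Lemma min_add_max (e e0 : R) : Num.min e e0 + Num.max (e - e0) 0 = e.
Proof. by case: (lerP e e0) => h; case: (lerP (e - e0) 0) => h'; lra. Qed.

Lemma step_rate_notTT s x i j : 0 <= s <= T -> (i, j) \notin TT r -> step_rate s x i j = 0.
Proof.
move=> sT h; rewrite /step_rate (mc_nTT mc x h) min_l ?es_ge0// max_r ?mulr0 ?addr0//.
by rewrite subr_le0 es_ge0.
Qed.

(** The rate splits into its parts below and above the edge, multiplied by [q] and by 1. Both
    factors lie in [[m2, m3]], which is where [m2 <= 1 <= m3] enters. Outside [TT] nothing is known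
    about [q]. *)
Lemma step_rate_itv s x i j : 0 <= s <= T ->
  m2 * rate c r x i j <= step_rate s x i j <= m3 * rate c r x i j
  \/ (i, j) \notin TT r.
Proof.
move=> sT; have [h|h] := boolP ((i, j) \in TT r); last by right.
left; have /andP[q1 q2] := q_itv sT h; rewrite /step_rate.
have e0 := mc_rate0 mc x i j; have e1 := es_ge0 i j sT.
rewrite -{1 6}(min_add_max (rate c r x i j) (es s i j)).
have mi : 0 <= Num.min (rate c r x i j) (es s i j) by rewrite le_min e0 e1.
have ma : 0 <= Num.max (rate c r x i j - es s i j) 0 by rewrite le_max lexx orbT.
set A := Num.min _ _ in mi *; set B := Num.max _ _ in ma *.
rewrite !mulrDr; apply/andP; split; apply: lerD; rewrite ?ler_wpM2r//.
  by rewrite ler_piMl.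
by rewrite ler_peMl.
Qed.

Lemma integral_step_control s x i j : 0 <= s <= T ->
  (\int[mu]_(z in Eset c r x i j) (ext r step_control s i j z)%:E
    = (step_rate s x i j)%:E)%E.
Proof.
move=> sT; rewrite /Eset /ext; have [h|h] := boolP ((i, j) \in TT r).
  rewrite integral_step ?mul1r// ?mc_rate0 ?es_ge0//; first exact: (mc_rate0 mc).
  have /andP[q1 _] := q_itv sT h; exact: le_trans (ltW m2_gt0) q1.
rewrite step_rate_notTT// -/(rate c r x i j) (mc_nTT mc x h) set_itv1.
exact: integral_set1.
Qed.

Lemma stationary_step s x (p : 'I_l -> R) : 0 <= s <= T ->
  stationary c r (ext r step_control s) x p <-> balanced (step_rate s x) p.
Proof.
by move=> sT; apply: stationary_balanced => i j _; exact: integral_step_control.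
Qed.

(** The point 0 fixes the reference graph: positivity of [r 0 i j] puts the edge in [TT], where the
    rate is at least [kap] at every [x]. Hence one set of constants works for all [s] and [x]. *)
Lemma step_rate_bounds s x : 0 <= s <= T ->
  rate_bounds r (0 : 'cV[R]_d) (m2 * kap) (m3 * cb) (step_rate s x).
Proof.
move=> sT; have r0 := mc_rate0 mc x.
split=> [i j|i j h|i].
- have [/andP[h _]|h] := step_rate_itv x i j sT; last by rewrite step_rate_notTT.
  by apply: le_trans h; rewrite mulr_ge0// ltW.
- have hT : (i, j) \in TT r by rewrite inE /TT /=; exists 0.
  have [/andP[h1 _]|] := step_rate_itv x i j sT; last by rewrite hT.
  by apply: le_trans h1; rewrite ler_wpM2l ?(ltW m2_gt0)// (mc_TT mc).
- apply: (@le_trans _ _ (\sum_y m3 * rate c r x i y)).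
    apply: ler_sum => j _; have [/andP[_ h]//|h] := step_rate_itv x i j sT.
    by rewrite step_rate_notTT// (mc_nTT mc x h) mulr0.
  by rewrite -mulr_sumr ler_wpM2l ?(mc_sum mc)// (le_trans _ m3_ge1).
Qed.

(** Both truncations are 1-Lipschitz in the rate; the lower one carries the factor [q <= m3], the
    upper one the factor 1. *)
Lemma step_rate_lipschitz s x x' i j : 0 <= s <= T ->
  `|step_rate s x i j - step_rate s x' i j| <= (m3 + 1) * (K * n1 (x - x')).
Proof.
move=> sT; have [h|h] := boolP ((i, j) \in TT r); last first.
  by rewrite !step_rate_notTT// subrr normr0 !mulr_ge0 ?n1_ge0 ?addr_ge0 ?ltW ?(mc_K mc)//;
    exact: lt_le_trans m3_ge1.
have /andP[q1 q2] := q_itv sT h.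
have q0 : 0 <= q s i j by apply: le_trans q1; exact: ltW.
apply: (@le_trans _ _ ((m3 + 1) * `|rate c r x i j - rate c r x' i j|)); last first.
  by rewrite ler_wpM2l ?(mc_rate mc)// addr_ge0// (le_trans _ m3_ge1).
rewrite /step_rate; set e := rate _ _ _ _ _; set e' := rate _ _ _ _ _; set e0 := es _ _ _.
have h1 : `|Num.min e e0 - Num.min e' e0| <= `|e - e'|.
  rewrite ler_norml; case: (ger0P (e - e')) => hh;
  by case: (lerP e e0) => ?; case: (lerP e' e0) => ?; apply/andP; split; lra.
have h2 : `|Num.max (e - e0) 0 - Num.max (e' - e0) 0| <= `|e - e'|.
  rewrite ler_norml; case: (ger0P (e - e')) => hh;
  by case: (lerP (e - e0) 0) => ?; case: (lerP (e' - e0) 0) => ?; apply/andP; split; lra.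
rewrite opprD addrACA -mulrBr (le_trans (ler_normD _ _))// mulrDl mul1r lerD//.
by rewrite normrM ger0_norm// ler_pM.
Qed.

Let kap_gt0 : 0 < m2 * kap. Proof. by rewrite mulr_gt0// (mc_kap mc). Qed.

Let kap_le : m2 * kap <= m3 * cb.
Proof.
have k0 := mc_kap mc; have kc := mc_kapcb mc.
apply: (@le_trans _ _ (1 * kap)); first by rewrite ler_wpM2r// ltW.
by rewrite ler_pM// ltW.
Qed.

Let irr := mc_irr mc (0 : 'cV[R]_d).

(** The law is chosen separately at each [(s, x)]; since [step_rate_bounds] is uniform, so are the
    lower bound and the Lipschitz constant. *)
Lemma invariant_kernel : exists rho : R -> 'cV[R]_d -> 'I_l -> R,
  [/\ (forall s x, 0 <= s <= T -> prob_vec (rho s x)),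
      (forall i, measurable_fun (`[0, T] `*` [set: borel 'cV[R]_d])
         (fun p : R * borel 'cV[R]_d => rho p.1 p.2 i)),
      (forall s x, 0 <= s <= T -> balanced (step_rate s x) (rho s x)),
      (exists c1 : R, [/\ 0 < c1,
         forall s i x x', 0 <= s <= T ->
           `|rho s x i - rho s x' i| <= c1 * enorm (x - x') &
         forall s x i, 0 <= s <= T -> c1^-1 <= rho s x i]) &
      (forall s x (p : 'I_l -> R), 0 <= s <= T -> prob_vec p ->
         balanced (step_rate s x) p -> p = rho s x)].
Proof.
have l0 : 0 < l%:R :> R by rewrite ltr0n.
have rex s x : exists p, 0 <= s <= T -> prob_vec p /\ balanced (step_rate s x) p.
  have [sT|sT] := boolP (0 <= s <= T); last by exists (fun=> 0).
  have [p hp] := balanced_exists l_gt0 kap_gt0 kap_le (step_rate_bounds x sT).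
  by exists p.
pose rho s x := sval (cid (rex s x)).
have rhoP s x : 0 <= s <= T -> prob_vec (rho s x) /\ balanced (step_rate s x) (rho s x).
  by move=> sT; rewrite /rho; case: (cid _) => p /= /(_ sT).
exists rho; split.
- by move=> s x /(rhoP s x)[].
  (* [rho] is the pointwise limit of the iterates of the uniformized chain from a
     fixed law, and these are rational in the measurable rates. *)
- move=> i; pose L := 2 * (m3 * cb); pose v0 (_ : 'I_l) : R := l%:R^-1.
  have mD : measurable (`[0, T] `*` [set: borel 'cV[R]_d]) by exact: measurableX.
  have pv0 : prob_vec v0.
    split=> [j|]; first by rewrite invr_ge0 ltW.
    by rewrite sumr_const card_ord /v0 -(mulr_natr l%:R^-1 l) mulVf// gt_eqF.
  have m1 (g : R -> R) : measurable_fun `[0, T] g ->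
      measurable_fun (`[0, T] `*` [set: borel 'cV[R]_d]) (fun p => g p.1).
    move=> mg; apply: (measurable_comp (F := `[0, T]) _ _ mg) => //.
      by move=> _ [p [h _] <-].
    by apply: measurable_funTS; exact: measurable_fst.
  have m2' j k : measurable_fun (`[0, T] `*` [set: borel 'cV[R]_d])
      (fun p => rate c r p.2 j k).
    have h := measurable_continuous_borel (lipschitz_continuous
      (fun x x' => mc_rate mc x x' j k)).
    apply: (measurableT_comp h); apply: measurable_funTS; exact: measurable_snd.
  have mG j k : measurable_fun (`[0, T] `*` [set: borel 'cV[R]_d])
      (fun p => step_rate p.1 p.2 j k).
    apply: measurable_funD.
      apply: measurable_funM; first exact: (m1 (fun s => q s j k)).
      by apply: measurable_minr => //; exact: (m1 (fun s => es s j k)).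
    apply: measurable_maxr => //; apply: measurable_funB => //.
    exact: (m1 (fun s => es s j k)).
  have mP j k : measurable_fun (`[0, T] `*` [set: borel 'cV[R]_d])
      (fun p => unif L (step_rate p.1 p.2) j k).
    apply: measurable_funD; first by apply: measurable_funM.
    apply: measurable_funM => //; apply: measurable_funB => //.
    by apply: measurable_funM => //; apply: measurable_sum.
  have mI n j : measurable_fun (`[0, T] `*` [set: borel 'cV[R]_d])
      (fun p => iter n (step (unif L (step_rate p.1 p.2))) v0 j).
    elim: n j => [|n IH] j; first exact: measurable_cst.
    apply: measurable_sum => k; apply: measurable_funM; [exact: IH|exact: mP].
  apply: (measurable_fun_cvg (fun n => mI (n * l)%N i)) => -[s x] [/= sT _].
  rewrite in_itv /= in sT; have [p1 p2] := rhoP s x sT.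
  exact: (balanced_limit (r_ge0 0) irr kap_gt0 kap_le (step_rate_bounds x sT) p1 p2 pv0).
- by move=> s x /(rhoP s x)[].
- have [c0 c00 hc0] := balanced_lower_bound (r_ge0 0) irr l_gt0 kap_gt0 kap_le.
  have [C C0 hC] := balanced_lipschitz (r_ge0 0) irr l_gt0 kap_gt0 kap_le.
  have K0 := mc_K mc.
  (* There are [l * l] rates, each with Lipschitz constant [(m3 + 1) * K] for [n1], and [n1] is at
     most [d] times [enorm]. *)
  pose C1 := C * ((l * l)%:R * ((m3 + 1) * (K * d%:R))).
  have m30 : 0 <= m3 by exact: le_trans m3_ge1.
  have C10 : 0 <= C1 by rewrite !mulr_ge0 ?addr_ge0 ?(ltW C0) ?(ltW K0).
  have ci0 : 0 < c0^-1 by rewrite invr_gt0.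
  (* The same constant has to serve as Lipschitz constant and as inverse of the lower bound. *)
  exists (C1 + c0^-1); split.
  + by rewrite ltr_wpDl.
  + move=> s i x x' sT; have [p1 p2] := rhoP s x sT; have [p1' p2'] := rhoP s x' sT.
    apply: (le_trans (hC _ _ _ _ (step_rate_bounds x sT) p1 p1' p2 p2' i)).
    apply: (@le_trans _ _ (C1 * enorm (x - x'))); last first.
      by rewrite ler_wpM2r ?enorm_ge0// lerDl ltW.
    rewrite /C1 -mulrA ler_wpM2l ?(ltW C0)//.
    have n1e : n1 (x - x') <= d%:R * enorm (x - x').
      by rewrite (le_trans (n1_le_enorm _))// muln1.
    apply: (@le_trans _ _ (\sum_(k < l) \sum_(j < l)
        ((m3 + 1) * (K * (d%:R * enorm (x - x')))))).
      apply: ler_sum => k _; apply: ler_sum => j _.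
      apply: (le_trans (step_rate_lipschitz x x' k j sT)).
      by rewrite ler_wpM2l ?addr_ge0// ler_wpM2l ?(ltW K0).
    rewrite !sumr_const !card_ord -mulrnA -(mulr_natl _ (l * l)%N).
    by rewrite le_eqVlt; apply/orP; left; apply/eqP; ring.
  + move=> s x i sT; have [p1 p2] := rhoP s x sT.
    apply: le_trans (hc0 _ _ i (step_rate_bounds x sT) p1 p2).
    by rewrite -[leRHS]invrK lef_pV2 ?posrE// ?lerDr// ltr_wpDl.
- move=> s x p sT pp bp; have [p1 p2] := rhoP s x sT.
  exact: (balanced_unique (r_ge0 0) irr l_gt0 kap_gt0 kap_le (step_rate_bounds x sT)).
Qed.

End InvariantKernel.

(** * The state equation *)

Section AlmostEverywhere.
Context {R : realType}.
Local Notation mu := (@lebesgue_measure R).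

Lemma ae_imp (P Q : R -> Prop) : (forall s, P s -> Q s) ->
  {ae mu, forall s, P s} -> {ae mu, forall s, Q s}.
Proof.
move=> PQ [N [mN N0 PN]]; exists N; split => //.
by apply: subset_trans PN => s /=; apply: contra_not; exact: PQ.
Qed.

Lemma ae_and (P Q : R -> Prop) : {ae mu, forall s, P s} -> {ae mu, forall s, Q s} ->
  {ae mu, forall s, P s /\ Q s}.
Proof.
move=> hP hQ; have F : Filter (almost_everywhere mu) by exact: ae_filter_ringOfSetsType.
exact: filterI hP hQ.
Qed.

Lemma ae_integrable (D : set R) (f g : R -> \bar R) : measurable D ->
  {ae mu, forall s, D s -> f s = g s} -> measurable_fun D g ->
  mu.-integrable D f -> mu.-integrable D g.
Proof.
move=> mD fg mg /integrableP[mf fi]; apply/integrableP; split => //.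
apply: le_lt_trans fi; rewrite le_eqVlt; apply/orP; left; apply/eqP.
apply: ge0_ae_eq_integral => //; try exact: measurableT_comp.
by apply: ae_imp fg => s h Ds; rewrite h.
Qed.

End AlmostEverywhere.

Section StateEquation.
Context {R : realType} {d m l : nat}.
Local Notation mu := (@lebesgue_measure R).
Variables (b : 'cV[R]_d -> 'I_l -> 'cV[R]_d) (a : 'cV[R]_d -> 'I_l -> 'M[R]_(d, m)).
Variables (K T : R) (x0 : 'cV[R]_d).
Hypotheses (K_gt0 : 0 < K) (T_gt0 : 0 < T).
Hypothesis b_lip : forall x x' y, n1 (b x y - b x' y) <= K * n1 (x - x').
Hypothesis a_lip : forall x x' y, n1 (a x y - a x' y) <= K * n1 (x - x').
Implicit Types (x : R -> 'cV[R]_d) (P : R -> 'I_l -> R) (w : 'I_l -> R -> 'cV[R]_m).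

Let T_ge0 : 0 <= T := ltW T_gt0.

Definition drift w P x (s : R) : 'cV[R]_d :=
  \sum_j (P s j *: b (x s) j + P s j *: (a (x s) j *m w j s)).

Lemma coef_bounded x : continuous_path T x ->
  exists2 M : R, 0 <= M &
    forall s j, 0 <= s <= T -> n1 (b (x s) j) <= M /\ n1 (a (x s) j) <= M.
Proof.
move=> cx; have [Mx Mx0 hx] := path_bounded T_ge0 cx.
pose B := \sum_j n1 (b 0 j); pose A := \sum_j n1 (a 0 j).
have B0 : 0 <= B by apply: sumr_ge0 => j _; exact: n1_ge0.
have A0 : 0 <= A by apply: sumr_ge0 => j _; exact: n1_ge0.
have KM0 : 0 <= K * Mx by rewrite mulr_ge0// ltW.
have hB j : n1 (b 0 j) <= B.
  by rewrite /B (bigD1 j)//= lerDl sumr_ge0// => i _; exact: n1_ge0.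
have hA j : n1 (a 0 j) <= A.
  by rewrite /A (bigD1 j)//= lerDl sumr_ge0// => i _; exact: n1_ge0.
exists (B + A + K * Mx); first by rewrite !addr_ge0.
move=> s j sT; have KX : K * n1 (x s - 0) <= K * Mx.
  by rewrite subr0 ler_wpM2l ?(ltW K_gt0)// hx.
split.
  rewrite -(subrK (b 0 j) (b (x s) j)) (le_trans (ler_n1D _ _))//.
  by have := b_lip (x s) 0 j; have := hB j; lra.
rewrite -(subrK (a 0 j) (a (x s) j)) (le_trans (ler_n1D _ _))//.
by have := a_lip (x s) 0 j; have := hA j; lra.
Qed.

Lemma measurable_b x j k : continuous_path T x ->
  measurable_fun `[0, T] (fun s => b (x s) j k 0).
Proof.
move=> cx; apply: (measurable_path_comp (g := fun y => b y j k 0)) => //.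
apply: (@lipschitz_continuous _ _ _ K) => y y'.
by apply: le_trans (b_lip y y' j); have := le_n1 (b y j - b y' j) k 0; rewrite !mxE.
Qed.

Lemma measurable_a x j k i : continuous_path T x ->
  measurable_fun `[0, T] (fun s => a (x s) j k i).
Proof.
move=> cx; apply: (measurable_path_comp (g := fun y => a y j k i)) => //.
apply: (@lipschitz_continuous _ _ _ K) => y y'.
by apply: le_trans (a_lip y y' j); have := le_n1 (a y j - a y' j) k i; rewrite !mxE.
Qed.

Lemma measurable_drift_b P x j k : continuous_path T x ->
  measurable_fun `[0, T] (fun s => P s j) ->
  measurable_fun `[0, T] (fun s => (P s j *: b (x s) j) k 0).
Proof.
move=> cx mP; rewrite (_ : (fun s => _) = fun s => P s j * b (x s) j k 0).
  by apply: measurable_funM => //; exact: measurable_b.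
by apply/funext => s; rewrite mxE.
Qed.

Lemma measurable_drift_a w P x j k : continuous_path T x ->
  measurable_fun `[0, T] (fun s => P s j) ->
  (forall i, measurable_fun `[0, T] (fun s => w j s i 0)) ->
  measurable_fun `[0, T] (fun s => (P s j *: (a (x s) j *m w j s)) k 0).
Proof.
move=> cx mP mw.
rewrite (_ : (fun s => _) = fun s => P s j * \sum_i a (x s) j k i * w j s i 0).
  apply: measurable_funM => //; apply: measurable_sum => i.
  by apply: measurable_funM => //; exact: measurable_a.
by apply/funext => s; rewrite !mxE.
Qed.

Lemma drift_integral w P x t : 0 <= t <= T ->
  (forall j, vintegrable `[0, T] (fun s => P s j *: b (x s) j)) ->
  (forall j, vintegrable `[0, T] (fun s => P s j *: (a (x s) j *m w j s))) ->
  vintegrable `[0, t] (drift w P x) /\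
  vint `[0, t] (drift w P x) =
    \sum_j vint `[0, t] (fun s => P s j *: b (x s) j)
    + \sum_j vint `[0, t] (fun s => P s j *: (a (x s) j *m w j s)).
Proof.
move=> /andP[t0 tT] ib ia; have mt : measurable (`[0, t] : set R) by [].
have ibt j := vintegrable_itvS tT (ib j); have iat j := vintegrable_itvS tT (ia j).
have h j := vintD mt (ibt j) (iat j).
have [h1 h2] := vint_sum (index_enum 'I_l) mt (fun j => (h j).1).
split; first exact: h1.
by rewrite /drift h2 -big_split /=; apply: eq_bigr => j _; exact: (h j).2.
Qed.

Lemma state_eq_drift w P x : state_eq b a x0 T w x P ->
  forall t, 0 <= t <= T -> vintegrable `[0, t] (drift w P x) /\
    x t = x0 + vint `[0, t] (drift w P x).
Proof.
move=> [ib ia xE] t tT; have [h1 h2] := drift_integral tT ib ia.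
by split => //; rewrite h2 addrA; exact: xE.
Qed.

Lemma vintegrable_drift_b P x j : continuous_path T x ->
  (forall s, 0 <= s <= T -> prob_vec (P s)) -> measurable_fun `[0, T] (fun s => P s j) ->
  vintegrable `[0, T] (fun s => P s j *: b (x s) j).
Proof.
move=> cx pP mP k; have [M M0 hM] := coef_bounded cx.
apply: (@bounded_integrable _ _ _ M); first exact: measurable_drift_b.
move=> s sT; have [p0 p1] := pP s sT; have [hb _] := hM s j sT.
apply: le_trans hb; apply: le_trans (le_n1 _ k 0) _.
rewrite n1Z ger0_norm// ler_piMl ?n1_ge0// -p1 (bigD1 j)//= lerDl sumr_ge0//.
Qed.

Lemma vintegrable_drift_a w P x j (W : R) : continuous_path T x ->
  (forall s, 0 <= s <= T -> prob_vec (P s)) -> measurable_fun `[0, T] (fun s => P s j) ->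
  (forall i, measurable_fun `[0, T] (fun s => w j s i 0)) ->
  (forall s, 0 <= s <= T -> n1 (w j s) <= W) ->
  vintegrable `[0, T] (fun s => P s j *: (a (x s) j *m w j s)).
Proof.
move=> cx pP mP mw wW k; have [M M0 hM] := coef_bounded cx.
apply: (@bounded_integrable _ _ _ (M * W)); first exact: measurable_drift_a.
move=> s sT; have [p0 p1] := pP s sT; have [_ ha] := hM s j sT.
apply: (@le_trans _ _ (n1 (a (x s) j) * n1 (w j s))); last first.
  by rewrite ler_pM ?n1_ge0// wW.
apply: le_trans (le_n1 _ k 0) _; apply: le_trans (ler_n1M _ _).
rewrite n1Z ger0_norm// ler_piMl ?n1_ge0// -p1 (bigD1 j)//= lerDl sumr_ge0//.
Qed.

Lemma prob_vec_le1 (v : 'I_l -> R) j : prob_vec v -> `|v j| <= 1.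
Proof.
by move=> [p0 p1]; rewrite ger0_norm// -p1 (bigD1 j)//= lerDl sumr_ge0.
Qed.

(** With laws and bounded controls given as functions of time alone, the drift is Lipschitz in the
    state uniformly in time, so [caratheodory] applies. *)
Lemma state_eq_exists w P (W : R) : 0 <= W ->
  (forall s, 0 <= s <= T -> prob_vec (P s)) ->
  (forall j, measurable_fun `[0, T] (fun s => P s j)) ->
  (forall j i, measurable_fun `[0, T] (fun s => w j s i 0)) ->
  (forall j s, 0 <= s <= T -> n1 (w j s) <= W) ->
  exists2 x, continuous_path T x & state_eq b a x0 T w x P.
Proof.
move=> W0 pP mP mw wW.
pose F s (y : 'cV[R]_d) := \sum_j (P s j *: b y j + P s j *: (a y j *m w j s)).
pose M0 := \sum_j (n1 (b x0 j) + n1 (a x0 j) * W).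
pose K' := \sum_(j < l) (K + K * W) + 1.
have KW : 0 <= K + K * W by rewrite addr_ge0 ?mulr_ge0 ?(ltW K_gt0).
have K'0 : 0 < K' by rewrite ltr_wpDl// sumr_ge0.
have P1 s j : 0 <= s <= T -> `|P s j| <= 1 by move=> sT; apply: prob_vec_le1; exact: pP.
have [|||y [cy iy yE]] := @caratheodory R d T K' M0 x0 F T_gt0 K'0.
- move=> s y y' sT; rewrite /F -sumrB; apply: (le_trans (ler_n1_sum _ _ _)).
  apply: (@le_trans _ _ (\sum_(j < l) (K + K * W) * n1 (y - y'))); last first.
    by rewrite -mulr_suml ler_wpM2r ?n1_ge0// /K' lerDl.
  apply: ler_sum => j _; rewrite opprD addrACA -!scalerBr -mulmxBl.
  apply: (le_trans (ler_n1D _ _)); rewrite !n1Z mulrDl; apply: lerD.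
    by apply: le_trans (b_lip y y' j); rewrite ler_piMl ?n1_ge0// P1.
  apply: (@le_trans _ _ (n1 (a y j - a y' j) * n1 (w j s))).
    by apply: le_trans (ler_n1M _ _); rewrite ler_piMl ?n1_ge0// P1.
  by rewrite mulrAC ler_pM ?n1_ge0// wW.
- move=> s sT; apply: (le_trans (ler_n1_sum _ _ _)); apply: ler_sum => j _.
  apply: (le_trans (ler_n1D _ _)); rewrite !n1Z; apply: lerD.
    by rewrite ler_piMl ?n1_ge0// P1.
  apply: (@le_trans _ _ (n1 (a x0 j) * n1 (w j s))).
    by apply: le_trans (ler_n1M _ _); rewrite ler_piMl ?n1_ge0// P1.
  by rewrite ler_wpM2l ?n1_ge0// wW.
- move=> y cy k.
  rewrite (_ : (fun s => _) = fun s => \sum_j ((P s j *: b (y s) j) k 0 +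
     (P s j *: (a (y s) j *m w j s)) k 0)); last first.
    by apply/funext => s; rewrite /F summxE; apply: eq_bigr => j _; rewrite mxE.
  apply: measurable_sum => j; apply: measurable_funD.
    exact: measurable_drift_b.
  exact: measurable_drift_a.
have ib j := vintegrable_drift_b cy pP (mP j).
have ia j := vintegrable_drift_a cy pP (mP j) (mw j) (wW j).
exists y => //; split => // t tT.
have [_ h2] := drift_integral tT ib ia.
by rewrite -addrA -h2; exact: yE.
Qed.

Lemma vint_ae (D : set R) (f g : R -> 'cV[R]_d) : measurable D ->
  {ae mu, forall s, D s -> f s = g s} ->
  (forall k, measurable_fun D (fun s => g s k 0)) -> vintegrable D f ->
  vintegrable D g /\ vint D f = vint D g.
Proof.
move=> mD fg mg hf.
have h k : ae_eq mu D (fun s => (f s k 0)%:E) (fun s => (g s k 0)%:E).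
  by apply: ae_imp fg => s fg Ds; rewrite fg.
split.
  move=> k; apply: (ae_integrable _ (h k)) => //.
  exact/measurable_EFinP.
apply/matrixP => i j; rewrite !mxE; congr fine; apply: ae_eq_integral => //.
  exact: (measurable_int mu (hf i)).
by apply/measurable_EFinP; exact: mg.
Qed.

(** Null sets of times do not affect the integrals. This exchanges the mixed law for the invariant
    one, and later a competitor's law for its feedback form. *)
Lemma state_eq_ae w P P' x : continuous_path T x ->
  (forall j i, measurable_fun `[0, T] (fun s => w j s i 0)) ->
  (forall j, measurable_fun `[0, T] (fun s => P' s j)) ->
  {ae mu, forall s, 0 <= s <= T -> P s = P' s} ->
  state_eq b a x0 T w x P -> state_eq b a x0 T w x P'.
Proof.
move=> cx mw mP' PP' [ib ia xE].
have ab t j : 0 <= t <= T -> vintegrable `[0, t] (fun s => P' s j *: b (x s) j) /\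
    vint `[0, t] (fun s => P s j *: b (x s) j) = vint `[0, t] (fun s => P' s j *: b (x s) j).
  move=> /andP[t0 tT]; apply: vint_ae => //.
  - apply: ae_imp PP' => s h /=; rewrite in_itv /= => /andP[s0 st].
    by rewrite h// s0 (le_trans st).
  - by move=> k; apply: measurable_fun_itvS (measurable_drift_b _ cx (mP' j)).
  - exact: vintegrable_itvS (ib j).
have aa t j : 0 <= t <= T -> vintegrable `[0, t] (fun s => P' s j *: (a (x s) j *m w j s)) /\
    vint `[0, t] (fun s => P s j *: (a (x s) j *m w j s)) =
    vint `[0, t] (fun s => P' s j *: (a (x s) j *m w j s)).
  move=> /andP[t0 tT]; apply: vint_ae => //.
  - apply: ae_imp PP' => s h /=; rewrite in_itv /= => /andP[s0 st].
    by rewrite h// s0 (le_trans st).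
  - by move=> k; apply: measurable_fun_itvS (measurable_drift_a _ cx (mP' j) (mw j)).
  - exact: vintegrable_itvS (ia j).
have TT : 0 <= T <= T by rewrite T_ge0 lexx.
split=> [j|j|t tT].
- exact: (ab T j TT).1.
- exact: (aa T j TT).1.
- rewrite xE//; congr (_ + _ + _); apply: eq_bigr => j _.
    exact: (ab t j tT).2.
  exact: (aa t j tT).2.
Qed.

(** In feedback form the law is Lipschitz in the state, hence so is the drift near the bounded path
    [x], and Gronwall's inequality applies with [A = 0]. *)
Lemma state_eq_unique w (rho : R -> 'cV[R]_d -> 'I_l -> R) (c1 W : R) x x' :
  0 <= c1 -> 0 <= W ->
  (forall s y, 0 <= s <= T -> prob_vec (rho s y)) ->
  (forall s i y y', 0 <= s <= T -> `|rho s y i - rho s y' i| <= c1 * n1 (y - y')) ->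
  (forall j s, 0 <= s <= T -> n1 (w j s) <= W) ->
  continuous_path T x -> continuous_path T x' ->
  state_eq b a x0 T w x (fun s => rho s (x s)) ->
  state_eq b a x0 T w x' (fun s => rho s (x' s)) ->
  forall t, 0 <= t <= T -> x t = x' t.
Proof.
move=> c10 W0 prho rho_lip wW cx cx' ex ex'.
have [M M0 hM] := coef_bounded cx.
(* [c1 * M] comes from the variation of the law and [K] from that of the coefficients; the second
   copy carries the bound [W] of the controls. *)
pose k0 := (c1 * M + K) + (c1 * M + K) * W.
pose k1 := \sum_(j < l) k0.
have k00 : 0 <= k0 by rewrite !(addr_ge0, mulr_ge0)// ltW.
have k10 : 0 <= k1 by exact: sumr_ge0.
pose f t := n1 (x t - x' t).
have fdrift s : 0 <= s <= T ->
    n1 (drift w (fun s => rho s (x s)) x s - drift w (fun s => rho s (x' s)) x' s)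
      <= k1 * f s.
  move=> sT; rewrite /drift -sumrB; apply: (le_trans (ler_n1_sum _ _ _)).
  rewrite /k1 mulr_suml; apply: ler_sum => j _.
  have [hb ha] := hM s j sT.
  have hr := rho_lip s j (x s) (x' s) sT.
  have p1 := prob_vec_le1 j (prho s (x' s) sT).
  have gen p q (A B : 'M[R]_(p, q)) : n1 A <= M -> n1 (A - B) <= K * f s ->
      n1 (rho s (x s) j *: A - rho s (x' s) j *: B) <= (c1 * M + K) * f s.
    move=> hA hAB.
    have -> : rho s (x s) j *: A - rho s (x' s) j *: B =
        (rho s (x s) j - rho s (x' s) j) *: A + rho s (x' s) j *: (A - B).
      by rewrite scalerBl scalerBr addrA subrK.
    apply: (le_trans (ler_n1D _ _)); rewrite !n1Z mulrDl; apply: lerD.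
      by rewrite mulrAC ler_pM ?n1_ge0.
    by apply: le_trans hAB; rewrite ler_piMl ?n1_ge0.
  rewrite opprD addrACA; apply: (le_trans (ler_n1D _ _)).
  rewrite /k0 (mulrDl (c1 * M + K)); apply: lerD; first by apply: gen => //; exact: b_lip.
  rewrite !scalemxAl -mulmxBl; apply: (le_trans (ler_n1M _ _)).
  rewrite mulrAC ler_pM ?n1_ge0//; first by apply: gen => //; exact: a_lip.
  exact: wW.
have [Mx Mx0 hx] := path_bounded T_ge0 cx.
have [Mx' Mx'0 hx'] := path_bounded T_ge0 cx'.
have mf : measurable_fun `[0, T] f by exact: measurable_n1_path.
have fb t : 0 <= t <= T -> 0 <= f t <= Mx + Mx'.
  move=> tT; rewrite n1_ge0 /f (le_trans (ler_n1D _ _))// n1N.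
  by rewrite lerD// ?hx ?hx'.
have ib : mu.-integrable `[0, T] (EFin \o f).
  apply: (@bounded_integrable _ _ _ (Mx + Mx')) => // s sT.
  by have /andP[h1 h2] := fb s sT; rewrite ger0_norm.
have mk : measurable_fun `[0, T] (cst k1) by exact: measurable_cst.
have ik : mu.-integrable `[0, T] (EFin \o cst (k1 ^+ 2)).
  apply: (@bounded_integrable _ _ _ (k1 ^+ 2)); first exact: measurable_cst.
  by move=> s _; rewrite ger0_norm// exprn_ge0.
have [C C0 hC] := gronwall T_ge0 mk (fun s _ => conj k10 (lexx _)) ik.
move=> t tT; apply/eqP; rewrite -subr_eq0; apply/eqP/n1_eq0.
have := hC 0 (Mx + Mx') f (lexx _) mf fb; rewrite mulr0; apply => // {}t {}tT.
have /andP[t0 tT'] := tT.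
have mt : measurable (`[0, t] : set R) by [].
have [i1 e1] := state_eq_drift ex tT; have [i2 e2] := state_eq_drift ex' tT.
have [i12 e12] := vintB mt i1 i2.
rewrite /f e1 e2 add0r opprD addrACA subrr add0r -e12.
apply: (le_trans (n1_vint mt i12)); apply: le_Rintegral => //.
- exact: integrable_n1.
- exact: (integrableZl _ _ (integrable_itvS tT' ib)).
- move=> s /=; rewrite in_itv /= => /andP[s0 st]; apply: fdrift.
  by rewrite s0 (le_trans st).
Qed.

End StateEquation.

(** * Mixing with a reference circulation *)

Lemma sqr_sum_le_card {R : realType} {l : nat} (w : 'I_l -> R) :
  (\sum_i w i) ^+ 2 <= l%:R * \sum_i w i ^+ 2.
Proof.
have h : \sum_i \sum_j w i * w j <= \sum_i \sum_j (w i ^+ 2 + w j ^+ 2) / 2.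
  apply: ler_sum => i _; apply: ler_sum => j _.
  by have := sqr_ge0 (w i - w j); lra.
rewrite expr2 big_distrlr /=; apply: (le_trans h).
set S := \sum_i w i ^+ 2.
have E i : \sum_j (w i ^+ 2 + w j ^+ 2) / 2 = (l%:R * w i ^+ 2 + S) / 2.
  by rewrite -mulr_suml big_split /= sumr_const card_ord mulr_natl.
rewrite (eq_bigr _ (fun i _ => E i)) -mulr_suml big_split /= -mulr_sumr -/S.
by rewrite sumr_const card_ord -(mulr_natl S l); lra.
Qed.

Lemma measurable_funV_gt0 {R : realType} d (T : measurableType d) (D : set T)
    (f : T -> R) : measurable_fun D f -> (forall x, D x -> 0 < f x) ->
  measurable_fun D (fun x => (f x)^-1).
Proof.
move=> mf f0; apply: (@eq_measurable_fun _ _ _ _ _ (fun x => expR (- ln (f x)))).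
  by move=> x; rewrite inE => /f0 fx; rewrite expRN lnK.
do 2 apply: measurableT_comp => //.
by apply: measurableT_comp => //; exact: measurable_ln.
Qed.

Section Perturbation.
Context {R : realType} {d m l : nat}.
Local Notation mu := (@lebesgue_measure R).
Variables (b : 'cV[R]_d -> 'I_l -> 'cV[R]_d) (a : 'cV[R]_d -> 'I_l -> 'M[R]_(d, m)).
Variables (c : 'cV[R]_d -> 'I_l -> R) (r : 'cV[R]_d -> 'I_l -> 'I_l -> R).
Variables (K kap cb : R).
Hypothesis mc : model_consts b a c r K kap cb.
Hypothesis l_gt0 : (0 < l)%N.
Variables (T : R) (x0 : 'cV[R]_d).
Hypothesis T_gt0 : 0 < T.
Variables (xi : R -> 'cV[R]_d) (u : 'I_l -> R -> 'cV[R]_m) (p : R -> 'I_l -> R).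
Hypothesis xi_cont : continuous_path T xi.
Hypothesis u_meas : forall i k, measurable_fun `[0, T] (fun s => u i s k 0).
Hypothesis p_prob : forall s, 0 <= s <= T -> prob_vec (p s).
Hypothesis mp : forall i, measurable_fun `[0, T] (fun s => p s i).
Hypothesis xi_eq : state_eq b a x0 T u xi p.
Variables (Q J : R -> 'I_l -> 'I_l -> R) (g : 'I_l -> 'I_l -> R) (g0 : R).
Hypothesis Q_ge0 : forall s i j, 0 <= s <= T -> 0 <= Q s i j.
Hypothesis J_ge0 : forall s i j, 0 <= s <= T -> 0 <= J s i j.
Hypothesis iQ : forall i j, mu.-integrable `[0, T] (EFin \o (fun s => Q s i j)).
Hypothesis iJ : forall i j, mu.-integrable `[0, T] (EFin \o (fun s => J s i j)).
Hypothesis g0_gt0 : 0 < g0.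
Hypothesis g_low : forall i j, (i, j) \in TT r -> g0 <= g i j.
Hypothesis g_itv : forall i j, 0 <= g i j <= cb.

Let T_ge0 : 0 <= T := ltW T_gt0.
Let K_gt0 : 0 < K := mc_K mc.
Let kap_gt0 : 0 < kap := mc_kap mc.
Let cb_gt0 : 0 < cb. Proof. exact: lt_le_trans (mc_kapcb mc). Qed.
Let l0 : 0 < l%:R :> R. Proof. by rewrite ltr0n. Qed.
Let l1 : l%:R^-1 <= 1 :> R. Proof. by rewrite invf_le1// ler1n. Qed.

Definition energy (i : 'I_l) (s : R) : R := enorm (u i s) ^+ 2 * p s i.

Hypothesis iU : forall i, mu.-integrable `[0, T] (EFin \o energy i).

(** One integrable quantity dominating every flux and every energy, so that a single threshold
    bounds all of them. *)
Definition load (s : R) : R := \sum_i \sum_j Q s i j + \sum_i energy i s.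

(* At times of small load the law and the flux are mixed with a share [eps] of the
   uniform law and of the reference circulation [g]; at times of large load, whose
   total length is at most [\int load / N], they are replaced altogether, which
   keeps all intensities and controls bounded. *)
Definition bad (N s : R) : bool := N < load s.
Definition mix (eps N s : R) : R := if bad N s then 1 else eps.
Definition mixed_law (eps N s : R) (i : 'I_l) : R :=
  (1 - mix eps N s) * p s i + mix eps N s / l%:R.
Definition mixed_flux (eps N s : R) (i j : 'I_l) : R :=
  (1 - mix eps N s) * Q s i j + mix eps N s * g i j.
(** The factor keeps law times control equal to [p * u] at good times, so that the controlled drift
    changes there only through the state. *)
Definition mixed_control (eps N : R) (i : 'I_l) (s : R) : 'cV[R]_m :=
  (if bad N s then 0 else p s i / mixed_law eps N s i) *: u i s.

Lemma energy_ge0 i s : 0 <= s <= T -> 0 <= energy i s.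
Proof. by move=> /p_prob[p0 _]; rewrite mulr_ge0// sqr_ge0. Qed.

Lemma load_ge0 s : 0 <= s <= T -> 0 <= load s.
Proof.
move=> sT; rewrite addr_ge0 ?sumr_ge0// => i _; rewrite ?energy_ge0//.
by apply: sumr_ge0 => j _; exact: Q_ge0.
Qed.

Lemma Q_le_load s i j : 0 <= s <= T -> Q s i j <= load s.
Proof.
move=> sT; rewrite /load (bigD1 i)//= (bigD1 j)//= -!addrA lerDl.
rewrite !addr_ge0 ?sumr_ge0// => k _; rewrite ?Q_ge0 ?energy_ge0//.
by apply: sumr_ge0 => j' _; exact: Q_ge0.
Qed.

Lemma energy_le_load s i : 0 <= s <= T -> energy i s <= load s.
Proof.
move=> sT; rewrite /load (bigD1 i (F := fun i => energy i s))//= addrCA lerDl.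
rewrite addr_ge0 ?sumr_ge0// => k _; rewrite ?energy_ge0//.
by apply: sumr_ge0 => j' _; exact: Q_ge0.
Qed.

Lemma integrable_load : mu.-integrable `[0, T] (EFin \o load).
Proof.
have -> : EFin \o load = (fun s => (\sum_i \sum_j (Q s i j)%:E) +
    \sum_i (energy i s)%:E)%E.
  apply/funext => s /=; rewrite /load EFinD -!sumEFin; congr (_ + _)%E.
  by apply: eq_bigr => i _; rewrite -sumEFin.
apply: integrableD => //; last by apply: integrable_sum => // i _; exact: iU.
by apply: integrable_sum => // i _; apply: integrable_sum => // j _; exact: iQ.
Qed.

Lemma measurable_load : measurable_fun `[0, T] load.
Proof. by apply/measurable_EFinP; exact: (measurable_int mu integrable_load). Qed.

Lemma measurable_bad N : measurable_fun `[0, T] (bad N).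
Proof. by apply: measurable_fun_ltr; [exact: measurable_cst|exact: measurable_load]. Qed.

Lemma measurable_if_bad N (f h : R -> R) : measurable_fun `[0, T] f ->
  measurable_fun `[0, T] h -> measurable_fun `[0, T] (fun s => if bad N s then f s else h s).
Proof.
move=> mf mh; apply: measurable_fun_if => //; first exact: measurable_bad.
  by apply: measurable_funS mf => // s [].
by apply: measurable_funS mh => // s [].
Qed.

Lemma measurable_mix eps N : measurable_fun `[0, T] (mix eps N).
Proof. by apply: measurable_if_bad; exact: measurable_cst. Qed.

Lemma measurable_mixed_law eps N i : measurable_fun `[0, T] (fun s => mixed_law eps N s i).
Proof.
have mm := measurable_mix eps N.
apply: measurable_funD; first by apply: measurable_funM => //; apply: measurable_funB.
by apply: measurable_funM.
Qed.

Lemma measurable_mixed_flux eps N i j :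
  measurable_fun `[0, T] (fun s => mixed_flux eps N s i j).
Proof.
have mm := measurable_mix eps N.
have mQ : measurable_fun `[0, T] (fun s => Q s i j).
  by apply/measurable_EFinP; exact: (measurable_int mu (iQ i j)).
apply: measurable_funD; first by apply: measurable_funM => //; apply: measurable_funB.
by apply: measurable_funM.
Qed.

(** By Markov's inequality the bad times have length at most [eps ^+ 2]; one of the two factors pays
    for the term [1 / eps] in the proof of [drift_dist]. The bound by 1/2 gives
    [1 <= (1 + 2 * eps) * (1 - eps)]. *)
Record small (eps N : R) : Prop := Small {
  small_eps0 : 0 < eps; small_eps : eps <= 2^-1; small_N : 0 < N;
  small_load : \int[mu]_(s in `[0, T]) load s <= N * eps ^+ 2 }.

Section Small.
Variables (eps N : R).
Hypothesis sm : small eps N.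

Let eps0 : 0 < eps := small_eps0 sm.
Let epsh : eps <= 2^-1 := small_eps sm.
Let N0 : 0 < N := small_N sm.

Lemma mix_itv s : eps <= mix eps N s <= 1.
Proof. by rewrite /mix; case: ifP => _; apply/andP; split; have := epsh; lra. Qed.

(** Markov's inequality before integration: at bad times [load s / N] exceeds 1. *)
Lemma mix_le s : 0 <= s <= T -> mix eps N s <= eps + load s / N.
Proof.
move=> sT; have L0 := load_ge0 sT; rewrite /mix; case: ifP => [h|_].
  rewrite (@le_trans _ _ (load s / N))//; first by rewrite ler_pdivlMr// mul1r ltW.
  by rewrite lerDr ltW.
by rewrite lerDl divr_ge0// ltW.
Qed.

Lemma mixed_law_prob s : 0 <= s <= T -> prob_vec (mixed_law eps N s).
Proof.
move=> sT; have [p0 p1] := p_prob sT; have /andP[m0 m1] := mix_itv s.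
have m0' := le_trans (ltW eps0) m0.
split=> [i|].
  by apply: addr_ge0; [rewrite mulr_ge0// subr_ge0|rewrite divr_ge0// ltW].
rewrite big_split /= -mulr_sumr p1 mulr1 sumr_const card_ord.
by rewrite -(mulr_natr (mix eps N s / l%:R) l) mulfVK ?gt_eqF// subrK.
Qed.

Lemma mixed_law_low s i : 0 <= s <= T -> eps / l%:R <= mixed_law eps N s i.
Proof.
move=> sT; have [p0 p1] := p_prob sT; have /andP[m0 m1] := mix_itv s.
apply: (@le_trans _ _ (mix eps N s / l%:R)); first by rewrite ler_pM2r ?invr_gt0.
by rewrite lerDr mulr_ge0// subr_ge0.
Qed.

Lemma mixed_law_gt0 s i : 0 <= s <= T -> 0 < mixed_law eps N s i.
Proof. by move=> sT; apply: lt_le_trans (mixed_law_low i sT); rewrite divr_gt0. Qed.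

Lemma mixed_law_good s i : 0 <= s <= T -> bad N s = false ->
  (1 - eps) * p s i <= mixed_law eps N s i.
Proof.
move=> sT h; rewrite /mixed_law /mix h lerDl divr_ge0 ?(ltW l0)//.
exact: ltW.
Qed.

Lemma mixed_law_dist s i : 0 <= s <= T ->
  `|p s i - mixed_law eps N s i| <= mix eps N s.
Proof.
move=> sT; have := prob_vec_le1 i (p_prob sT); have [p0 p1] := p_prob sT.
have /andP[m0 m1] := mix_itv s; have m0' := le_trans (ltW eps0) m0.
rewrite ger0_norm// => pi1.
have -> : p s i - mixed_law eps N s i = mix eps N s * (p s i - l%:R^-1).
  by rewrite /mixed_law; ring.
rewrite normrM ger0_norm// ler_piMr// ler_norml.
have li : 0 <= l%:R^-1 :> R by rewrite invr_ge0 ltW.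
by have h1 := p0 i; have h2 := l1; apply/andP; split; lra.
Qed.

Lemma mixed_flux_low s i j : 0 <= s <= T -> (i, j) \in TT r ->
  eps * g0 <= mixed_flux eps N s i j.
Proof.
move=> sT h; have /andP[m0 m1] := mix_itv s.
apply: (@le_trans _ _ (mix eps N s * g i j)).
  by rewrite ler_pM ?(ltW eps0) ?(ltW g0_gt0)// g_low.
by rewrite lerDr mulr_ge0 ?subr_ge0// Q_ge0.
Qed.

Lemma mixed_flux_high s i j : 0 <= s <= T -> mixed_flux eps N s i j <= N + cb.
Proof.
move=> sT; have /andP[m0 m1] := mix_itv s; have /andP[g1 g2] := g_itv i j.
have m0' := le_trans (ltW eps0) m0.
rewrite /mixed_flux; apply: lerD; last first.
  by apply: le_trans g2; rewrite ler_piMl.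
rewrite /mix; case: ifP => [_|/negbT]; first by rewrite subrr mul0r ltW.
rewrite -leNgt => h; apply: (@le_trans _ _ (1 * Q s i j)).
  by rewrite ler_wpM2r ?Q_ge0// gerBl ltW.
by rewrite mul1r (le_trans (Q_le_load i j sT)).
Qed.

(** The energy carries the law to the first power only; the second factor [p s i] is at most 1. *)
Lemma mulr_n1_energy s i : 0 <= s <= T ->
  (p s i * n1 (u i s)) ^+ 2 <= m%:R ^+ 2 * energy i s.
Proof.
move=> sT; have := prob_vec_le1 i (p_prob sT); have [p0 _] := p_prob sT.
rewrite ger0_norm// => p1; rewrite exprMn /energy mulrA.
apply: (@le_trans _ _ (p s i * n1 (u i s) ^+ 2)).
  by rewrite ler_wpM2r ?sqr_ge0// expr2 ler_piMl.
by rewrite [leRHS]mulrC ler_wpM2l// n1_sqr_le.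
Qed.

(** The numerator bounds [p * n1 u] at good times through [x <= x ^+ 2 + 1]; the denominator is the
    lower bound of the mixed law. *)
Definition control_bound : R := (m%:R ^+ 2 * N + 1) / (eps / l%:R).

Lemma mixed_control_bounded i s : 0 <= s <= T ->
  n1 (mixed_control eps N i s) <= control_bound.
Proof.
move=> sT; have w0 : 0 < eps / l%:R by rewrite divr_gt0.
have mN : 0 <= m%:R ^+ 2 * N by rewrite mulr_ge0 ?sqr_ge0// ltW.
rewrite /mixed_control n1Z /control_bound; case: ifP => [_|/negbT].
  by rewrite normr0 mul0r divr_ge0 ?addr_ge0// ltW.
rewrite -leNgt => h; have [p0 _] := p_prob sT; have q0 := mixed_law_gt0 i sT.
rewrite ger0_norm ?divr_ge0 ?(ltW q0)// mulrAC.
have h2 : p s i * n1 (u i s) <= m%:R ^+ 2 * N + 1.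
  have h3 := mulr_n1_energy i sT.
  have h4 : m%:R ^+ 2 * energy i s <= m%:R ^+ 2 * N.
    by rewrite ler_wpM2l ?sqr_ge0// (le_trans (energy_le_load i sT)).
  set X := p s i * n1 (u i s) in h3 *.
  have := sqr_ge0 (X - 2^-1); lra.
by rewrite ler_pM ?mulr_ge0 ?n1_ge0 ?invr_ge0 ?(ltW q0)// lef_pV2 ?posrE// mixed_law_low.
Qed.

Lemma measurable_mixed_control i k :
  measurable_fun `[0, T] (fun s => mixed_control eps N i s k 0).
Proof.
have minv : measurable_fun `[0, T] (fun s => (mixed_law eps N s i)^-1).
  apply: measurable_funV_gt0 => [|s /=]; first exact: measurable_mixed_law.
  by rewrite in_itv /=; exact: mixed_law_gt0.
rewrite (_ : (fun s => _) = fun s => (if bad N s then 0 else p s i / mixed_law eps N s i)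
    * u i s k 0); last by apply/funext => s; rewrite /mixed_control mxE.
by apply: measurable_funM => //; apply: measurable_if_bad => //; apply: measurable_funM.
Qed.

Lemma integral_mix_le :
  \int[mu]_(s in `[0, T]) mix eps N s <= eps * (T + 1).
Proof.
have iL := integrable_load.
have iLN : mu.-integrable `[0, T] (EFin \o (fun s => load s / N)).
  rewrite (_ : EFin \o _ = (EFin \o load) \* cst (N^-1)%:E)%E//.
  exact: integrableZr.
have ic : mu.-integrable `[0, T] (EFin \o cst eps).
  apply: (@bounded_integrable _ _ _ `|eps|) => //; exact: measurable_cst.
apply: (@le_trans _ _ (\int[mu]_(s in `[0, T]) (cst eps s + load s / N))).
  apply: le_Rintegral => //.
  - apply: (@bounded_integrable _ _ _ 1); first exact: measurable_mix.
    move=> s _; have /andP[m0 m1] := mix_itv s.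
    by rewrite ger0_norm// (le_trans _ m0)// ltW.
  - rewrite (_ : EFin \o _ = (fun s => (cst eps s)%:E + (load s / N)%:E)%E)//.
    exact: integrableD.
  - by move=> s /=; rewrite in_itv /=; exact: mix_le.
rewrite RintegralD// Rintegral_cst// RintegralZr//.
have -> : fine (mu `[0, T]%classic) = T.
  by rewrite /= lebesgue_measure_itv /= lte_fin T_gt0 /= subr0.
have h := small_load sm; set X := \int[mu]_(s in _) load s in h *.
have : X / N <= eps ^+ 2 by rewrite ler_pdivrMr// mulrC.
have : eps ^+ 2 <= eps by rewrite expr2 ler_piMl ?(ltW eps0)//; have := epsh; lra.
lra.
Qed.

End Small.

Definition speed (s : R) : R := \sum_j p s j * n1 (u j s).

Let speed_ge0 s : 0 <= s <= T -> 0 <= speed s.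
Proof.
by move=> /p_prob[p0 _]; apply: sumr_ge0 => j _; rewrite mulr_ge0 ?n1_ge0.
Qed.

(** An integrable majorant of [speed ^+ 2], by Cauchy-Schwarz, in the form that [gronwall] asks
    for. *)
Definition speed2 (s : R) : R := l%:R * (m%:R ^+ 2 * \sum_j energy j s).

Let speed2_ge0 s : 0 <= s <= T -> 0 <= speed2 s.
Proof.
move=> sT; rewrite !mulr_ge0 ?sqr_ge0// sumr_ge0// => j _; exact: energy_ge0.
Qed.

Let speed_sqr s : 0 <= s <= T -> speed s ^+ 2 <= speed2 s.
Proof.
move=> sT; apply: (le_trans (sqr_sum_le_card _)).
rewrite /speed2 ler_wpM2l// mulr_sumr; apply: ler_sum => j _.
exact: mulr_n1_energy.
Qed.

Let measurable_speed : measurable_fun `[0, T] speed.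
Proof.
apply: measurable_sum => j; apply: measurable_funM => //.
rewrite (_ : (fun s => _) = fun s => \sum_k `|u j s k 0|).
  by apply: measurable_sum => k; apply: measurableT_comp.
by apply/funext => s; rewrite n1_cV.
Qed.

Let integrable_energy : mu.-integrable `[0, T] (EFin \o (fun s => \sum_j energy j s)).
Proof.
rewrite (_ : EFin \o _ = fun s => (\sum_j (energy j s)%:E)%E).
  by apply: integrable_sum => // j _; exact: iU.
by apply/funext => s; rewrite /= sumEFin.
Qed.

Let integrable_speed2 : mu.-integrable `[0, T] (EFin \o speed2).
Proof.
pose en s := \sum_j energy j s.
rewrite (_ : EFin \o _ = fun s => ((l%:R * m%:R ^+ 2)%:E * (en s)%:E)%E).
  exact: integrableZl.
by apply/funext => s; rewrite /= /speed2 mulrA EFinM.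
Qed.

(** The first bracket is the effect of mixing at a fixed state: the change of the law and the
    control lost at bad times. The second term is the Lipschitz effect of the state, with a
    coefficient that is unbounded but square integrable. *)
Lemma drift_dist eps N (xis : R -> 'cV[R]_d) (Mx s : R) : small eps N -> 0 <= s <= T ->
  (forall j, n1 (b (xi s) j) <= Mx /\ n1 (a (xi s) j) <= Mx) ->
  n1 (drift b a u p xi s - drift b a (mixed_control eps N) (mixed_law eps N) xis s)
  <= Mx * (l%:R * mix eps N s + eps * speed2 s + load s / N / eps)
     + K * (1 + speed s) * n1 (xi s - xis s).
Proof.
move=> sm sT hM; have eps0 := small_eps0 sm; have N0 := small_N sm.
have [p0 p1] := p_prob sT; have [q0 q1] := mixed_law_prob sm sT.
have M0 : 0 <= Mx by have [h _] := hM (Ordinal l_gt0); apply: le_trans h; exact: n1_ge0.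
set f := n1 (xi s - xis s); set mx := mix eps N s; set qs := mixed_law eps N s in q0 q1 *.
pose B : R := if bad N s then 1 else 0.
have B0 : 0 <= B by rewrite /B; case: ifP.
rewrite /drift -sumrB; apply: (le_trans (ler_n1_sum _ _ _)).
apply: (@le_trans _ _ (\sum_j ((mx * Mx + qs j * (K * f)) +
    (p s j * n1 (u j s) * (K * f) + B * Mx * (p s j * n1 (u j s)))))).
  apply: ler_sum => j _; have [hb ha] := hM j.
  rewrite opprD addrACA; apply: (le_trans (ler_n1D _ _)); apply: lerD.
    have -> : p s j *: b (xi s) j - qs j *: b (xis s) j =
        (p s j - qs j) *: b (xi s) j + qs j *: (b (xi s) j - b (xis s) j).
      by rewrite scalerBl scalerBr addrA subrK.
    apply: (le_trans (ler_n1D _ _)); rewrite !n1Z; apply: lerD.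
      by rewrite ler_pM ?n1_ge0//; exact: mixed_law_dist.
    by rewrite ger0_norm// ler_wpM2l// (mc_b mc).
  have qj0 : qs j != 0 by rewrite gt_eqF// (mixed_law_gt0 sm).
  have pu0 : 0 <= p s j * n1 (u j s) by rewrite mulr_ge0 ?n1_ge0.
  have Kf : 0 <= K * f by rewrite mulr_ge0 ?n1_ge0 ?(ltW K_gt0).
  rewrite /mixed_control /B -/qs; case: ifP => _.
    rewrite scale0r mulmx0 scaler0 subr0 n1Z ger0_norm// mul1r.
    apply: (@le_trans _ _ (Mx * (p s j * n1 (u j s)))); last by rewrite lerDr mulr_ge0.
    apply: (@le_trans _ _ (p s j * (n1 (a (xi s) j) * n1 (u j s)))).
      by rewrite ler_wpM2l// ler_n1M.
    by rewrite mulrCA ler_wpM2r.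
  rewrite -scalemxAr scalerA mulrCA mulfV// mulr1 -scalerBr -mulmxBl n1Z ger0_norm//.
  rewrite !mul0r addr0.
  apply: (@le_trans _ _ (p s j * (n1 (a (xi s) j - a (xis s) j) * n1 (u j s)))).
    by rewrite ler_wpM2l// ler_n1M.
  by rewrite mulrCA mulrC ler_wpM2l// (mc_a mc).
rewrite !big_split /= -!mulr_suml q1 -mulr_sumr -/(speed s) sumr_const card_ord.
(* At bad times [speed <= eps * speed ^+ 2 + 1 / eps], and the indicator of these times is at most
   [load / N]. *)
have BW : B * speed s <= eps * speed2 s + load s / N / eps.
  have w0 := speed_ge0 sT; have w2 := speed_sqr sT; have L0 := load_ge0 sT.
  rewrite /B; case: ifP => hb; last first.
    rewrite mul0r; apply: addr_ge0; first by rewrite mulr_ge0 ?speed2_ge0// ltW.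
    by rewrite !divr_ge0// ltW.
  have h1 : 1 / eps <= load s / N / eps.
    by rewrite ler_pM2r ?invr_gt0// ler_pdivlMr// mul1r ltW.
  have h2 : eps * speed s ^+ 2 <= eps * speed2 s by rewrite ler_wpM2l// ltW.
  have h3 : speed s <= eps * speed s ^+ 2 + 1 / eps.
    rewrite -(ler_pM2r eps0) mulrDl divfK ?gt_eqF//.
    have := sqr_ge0 (eps * speed s - 2^-1); rewrite expr2; lra.
  by rewrite mul1r; lra.
have BW2 : Mx * (B * speed s) <= Mx * (eps * speed2 s + load s / N / eps).
  by rewrite ler_wpM2l.
rewrite mul1r -(mulr_natr mx l).
set X := speed s in BW2 *; set Y := eps * _ in BW2 *; set Z := load s / N / eps in BW2 *.
by clearbody X Y Z f mx B; lra.
Qed.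

(** The Gronwall coefficient depends on the original triple only, and the source term integrates to
    at most [eps * A0]; hence the constant can precede [eps], [N] and the new path. *)
Lemma closeness : exists2 C1 : R, 0 < C1 & forall eps N xis, small eps N ->
  continuous_path T xis ->
  state_eq b a x0 T (mixed_control eps N) xis (mixed_law eps N) ->
  forall t, 0 <= t <= T -> n1 (xi t - xis t) <= C1 * eps.
Proof.
have [Mx Mx0 hM] := coef_bounded K_gt0 T_gt0 (mc_b mc) (mc_a mc) xi_cont.
pose k s := K * (1 + speed s); pose h s := 2 * K ^+ 2 * (1 + speed2 s).
have mk : measurable_fun `[0, T] k.
  by apply: measurable_funM => //; apply: measurable_funD.
have hk s : 0 <= s <= T -> 0 <= k s /\ k s ^+ 2 <= h s.
  move=> sT; have w0 := speed_ge0 sT; have w2 := speed_sqr sT.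
  split; first by rewrite mulr_ge0 ?addr_ge0// ltW.
  rewrite /k /h exprMn (_ : 2 * K ^+ 2 * (1 + speed2 s) = K ^+ 2 * (2 * (1 + speed2 s))).
    2: by ring.
  rewrite ler_wpM2l ?sqr_ge0//.
  by have := sqr_ge0 (1 - speed s); lra.
have ih : mu.-integrable `[0, T] (EFin \o h).
  have i1 : mu.-integrable `[0, T] (EFin \o cst 1).
    by apply: (@bounded_integrable _ _ _ 1) => [|s _]; [exact: measurable_cst|rewrite normr1].
  have i2 : mu.-integrable `[0, T] (EFin \o (fun s => 1 + speed2 s)).
    exact: (integrableD _ i1 integrable_speed2).
  exact: (integrableZl _ _ i2).
have [C C0 hC] := gronwall T_ge0 mk hk ih.
pose EE := \int[mu]_(s in `[0, T]) speed2 s.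
have EE0 : 0 <= EE by apply: Rintegral_ge0 => s /=; rewrite in_itv /=; exact: speed2_ge0.
pose A0 := Mx * (l%:R * (T + 1) + EE + 1).
have A00 : 0 <= A0 by rewrite mulr_ge0// !addr_ge0// mulr_ge0// addr_ge0.
exists (C * A0 + 1); first by rewrite ltr_wpDl// mulr_ge0// ltW.
move=> eps N xis sm cxis exis t tT.
have eps0 := small_eps0 sm; have N0 := small_N sm.
pose f t := n1 (xi t - xis t).
have [My My0 hy] := path_bounded T_ge0 xi_cont.
have [My' My'0 hy'] := path_bounded T_ge0 cxis.
have mf : measurable_fun `[0, T] f by exact: measurable_n1_path.
have fb s : 0 <= s <= T -> 0 <= f s <= My + My'.
  move=> sT; rewrite n1_ge0 /f (le_trans (ler_n1D _ _))// n1N.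
  by rewrite lerD// ?hy ?hy'.
apply: (@le_trans _ _ (C * (eps * A0))); last first.
  by rewrite mulrDl mul1r mulrCA mulrC lerDl ltW.
apply: (hC _ (My + My') f) => //; first by rewrite mulr_ge0// ltW.
move=> {t tT}t tT; have /andP[t0 tT'] := tT.
have mt : measurable (`[0, t] : set R) by [].
have [i1 e1] := state_eq_drift xi_eq tT; have [i2 e2] := state_eq_drift exis tT.
have [i12 e12] := vintB mt i1 i2.
pose phi s := Mx * (l%:R * mix eps N s + eps * speed2 s + load s / N / eps).
have imix : mu.-integrable `[0, T] (EFin \o mix eps N).
  apply: (@bounded_integrable _ _ _ 1); first exact: measurable_mix.
  move=> s _; have /andP[m0 m1] := mix_itv sm s.
  by rewrite ger0_norm// (le_trans _ m0)// ltW.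
have i_1 : mu.-integrable `[0, T] (EFin \o (fun s => l%:R * mix eps N s)).
  exact: (integrableZl _ _ imix).
have i_2 : mu.-integrable `[0, T] (EFin \o (fun s => eps * speed2 s)).
  exact: (integrableZl _ _ integrable_speed2).
have i_3 : mu.-integrable `[0, T] (EFin \o (fun s => load s / N / eps)).
  rewrite (_ : EFin \o _ = fun s => ((N^-1 / eps)%:E * (load s)%:E)%E).
    by apply: integrableZl => //; exact: integrable_load.
  by apply/funext => s /=; rewrite -EFinM -mulrA mulrC.
have i_12 : mu.-integrable `[0, T] (EFin \o (fun s => l%:R * mix eps N s + eps * speed2 s)).
  exact: (integrableD _ i_1 i_2).
have i_123 : mu.-integrable `[0, T]
    (EFin \o (fun s => l%:R * mix eps N s + eps * speed2 s + load s / N / eps)).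
  exact: (integrableD _ i_12 i_3).
have iphi : mu.-integrable `[0, T] (EFin \o phi).
  exact: (integrableZl _ _ i_123).
have phi0 s : 0 <= s <= T -> 0 <= phi s.
  move=> sT; have /andP[m0 _] := mix_itv sm s.
  have L0 := load_ge0 sT; have S0 := speed2_ge0 sT.
  have mm := le_trans (ltW eps0) m0.
  apply: mulr_ge0 => //; apply: addr_ge0; last by rewrite !divr_ge0// ltW.
  by apply: addr_ge0; rewrite mulr_ge0// ltW.
have ikf : mu.-integrable `[0, T] (EFin \o (fun s => k s * f s)).
  apply: (@integrable_mul_bounded _ _ _ _ (My + My')) => //.
    exact: integrable_sqrt_bound mk hk ih.
  by move=> s /fb/andP[f0 fM]; rewrite ger0_norm.
have iphit := integrable_itvS tT' iphi; have ikft := integrable_itvS tT' ikf.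
have phiT : \int[mu]_(s in `[0, T]) phi s <= eps * A0.
  have -> : \int[mu]_(s in `[0, T]) phi s = Mx * (l%:R * \int[mu]_(s in `[0, T]) mix eps N s
      + eps * EE + (\int[mu]_(s in `[0, T]) load s) / N / eps).
    rewrite /phi RintegralZl//; congr (_ * _); rewrite RintegralD//; congr (_ + _).
      by rewrite RintegralD//; congr (_ + _); exact: RintegralZl.
    rewrite -mulrA -RintegralZr//; last exact: integrable_load.
    by apply: eq_Rintegral => s _; rewrite mulrA.
  rewrite mulrCA ler_wpM2l//.
  have h1 := integral_mix_le sm.
  (* This term forces the square in [small_load]. *)
  have h2 : (\int[mu]_(s in `[0, T]) load s) / N / eps <= eps.
    rewrite ler_pdivrMr// ler_pdivrMr// mulrC; exact: small_load sm.
  have h3 : l%:R * \int[mu]_(s in `[0, T]) mix eps N s <= l%:R * (eps * (T + 1)).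
    by rewrite ler_wpM2l.
  have -> : eps * (l%:R * (T + 1) + EE + 1) = l%:R * (eps * (T + 1)) + eps * EE + eps.
    by rewrite (mulrDr eps _ 1) (mulrDr eps _ EE) mulr1 mulrCA.
  by rewrite !lerD.
apply: (@le_trans _ _ (\int[mu]_(s in `[0, t]) (phi s + k s * f s))).
  rewrite /f e1 e2 opprD addrACA subrr add0r -e12.
  apply: (le_trans (n1_vint mt i12)); apply: le_Rintegral => //.
  - exact: integrable_n1.
  - exact: (integrableD _ iphit ikft).
  - move=> s /=; rewrite in_itv /= => /andP[s0 st].
    have sT : 0 <= s <= T by rewrite s0 (le_trans st).
    by apply: drift_dist => // j; exact: hM.
rewrite RintegralD// lerD2r; apply: le_trans phiT.
exact: le_Rintegral_itv.
Qed.

(** Chosen so that law times rate times intensity is the mixed flux, with the rate taken on the new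
    path. *)
Definition mixed_intensity (xis : R -> 'cV[R]_d) (eps N s : R) (i j : 'I_l) : R :=
  mixed_flux eps N s i j / (mixed_law eps N s i * rate c r (xis s) i j).

(** Collects the errors of replacing the rate at [xi] by the one at [xis], per unit of distance and
    relative to [J + 1]. *)
Definition cost_slope : R := K / kap * (1 + cb * expR 1) + K.
(** Bounds the entropy cost of the flux [g] under the uniform law: for [w = rate / l],
    [w * ell (g / w) <= g ^+ 2 / w + w]. *)
Definition cost_reference : R := cb ^+ 2 * l%:R / kap + cb.

(** With the new intensity [y] as tangent point, the new cost density equals
    [F * ln y + ql * f * (1 - y)], which is linear in the flux [F] and the law [ql]. It splits along
    the mixture into an original and a reference part, and each is bounded by a tangent inequality
    at a matching point. *)
Lemma jump_cost_pointwise eps N xis eta s i j : small eps N -> 0 <= s <= T ->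
  (i, j) \in TT r ->
  (forall y, 0 < y -> Q s i j * ln y + p s i * rate c r (xi s) i j * (1 - y) <= J s i j) ->
  n1 (xi s - xis s) <= eta ->
  mixed_law eps N s i * (rate c r (xis s) i j * ell (mixed_intensity xis eps N s i j))
  <= J s i j + eta * (cost_slope * (J s i j + 1)) + mix eps N s * cost_reference.
Proof.
move=> sm sT hij tan heta; have eps0 := small_eps0 sm.
have [p0 p1] := p_prob sT; have pi1 := prob_vec_le1 i (p_prob sT).
rewrite (ger0_norm (p0 i)) in pi1.
have q0 := mixed_law_gt0 sm i sT; have /andP[m0 m1] := mix_itv sm s.
have mx0 := le_trans (ltW eps0) m0; have J0 := J_ge0 i j sT; have Q0 := Q_ge0 i j sT.
have e1 : kap <= rate c r (xi s) i j by exact: (mc_TT mc).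
have es1 : kap <= rate c r (xis s) i j by exact: (mc_TT mc).
have ecb x : rate c r x i j <= cb.
  apply: le_trans (mc_sum mc x i); rewrite (bigD1 j)//= lerDl sumr_ge0// => k _.
  exact: (mc_rate0 mc).
have dist : `|rate c r (xi s) i j - rate c r (xis s) i j| <= K * eta.
  by apply: (le_trans (mc_rate mc _ _ i j)); rewrite ler_wpM2l// ltW.
have eta0 : 0 <= eta by apply: le_trans heta; exact: n1_ge0.
have ecb1 := ecb (xi s); have ecb2 := ecb (xis s).
have gl := g_low hij; have /andP[_ gcb] := g_itv i j.
have F0 := mixed_flux_low sm sT hij.
rewrite /mixed_intensity.
have FE : mixed_flux eps N s i j = (1 - mix eps N s) * Q s i j + mix eps N s * g i j by [].
have qE : mixed_law eps N s i = (1 - mix eps N s) * p s i + mix eps N s / l%:R by [].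
set F := mixed_flux eps N s i j in FE F0 *; set ql := mixed_law eps N s i in q0 qE *.
set e := rate c r (xi s) i j in e1 dist ecb1 tan *.
set f := rate c r (xis s) i j in es1 dist ecb2 *.
have f0 : 0 < f by exact: lt_le_trans es1.
have e0 : 0 < e by exact: lt_le_trans e1.
have Fgt0 : 0 < F by apply: lt_le_trans F0; rewrite mulr_gt0.
set y := F / (ql * f).
have y0 : 0 < y by rewrite divr_gt0// mulr_gt0.
have -> : ql * (f * ell y) = F * ln y + ql * f * (1 - y).
  have -> : F = ql * f * y by rewrite /y mulrC divfK// gt_eqF// mulr_gt0.
  by rewrite /ell; ring.
have second : g i j * ln y + f / l%:R * (1 - y) <= cost_reference.
  set w := f / l%:R; have w0 : 0 < w by rewrite divr_gt0.
  have wcb : w <= cb by rewrite (le_trans _ ecb2)// ler_pdivrMr// ler_peMr ?ler1n// ltW.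
  have wk : kap / l%:R <= w by rewrite ler_pM2r ?invr_gt0.
  have g00 : 0 < g i j by exact: lt_le_trans gl.
  have h := ell_tangent (divr_ge0 (ltW g00) (ltW w0)) y0.
  have -> : g i j * ln y + w * (1 - y) = w * (g i j / w * ln y + (1 - y)).
    by field; rewrite gt_eqF.
  apply: (@le_trans _ _ (w * ell (g i j / w))); first by rewrite ler_wpM2l// ltW.
  have gw0 : 0 < g i j / w by rewrite divr_gt0.
  have lnle : ln (g i j / w) <= g i j / w.
    by have := expR_ge1Dx (ln (g i j / w)); rewrite lnK ?posrE//; lra.
  apply: (@le_trans _ _ (w * ((g i j / w) ^+ 2 + 1))).
    rewrite ler_wpM2l ?(ltW w0)// /ell expr2.
    have : g i j / w * ln (g i j / w) <= g i j / w * (g i j / w).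
      by rewrite ler_wpM2l// ltW.
    by move: gw0; lra.
  have -> : w * ((g i j / w) ^+ 2 + 1) = g i j ^+ 2 / w + w.
    by field; rewrite gt_eqF.
  rewrite /cost_reference lerD// -mulrA; apply: ler_pM; rewrite ?sqr_ge0 ?invr_ge0 ?(ltW w0)//.
    by rewrite ler_sqr ?nnegrE// ltW.
  rewrite -[l%:R / kap]invrK lef_pV2 ?posrE ?invr_gt0 ?divr_gt0//.
  by rewrite invf_div.
have first_ : Q s i j * ln y + p s i * f * (1 - y) <=
    J s i j + eta * (cost_slope * (J s i j + 1)).
  (* Rescaled so that [e * y' = y * f]: the tangent inequality is available for the rate [e] at
     [xi], while [y] refers to the rate [f] at [xis]. The corrections [ln (e / f)] and [p * (f - e)]
     are at most of order [eta]. *)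
  pose y' := y * f / e.
  have y'0 : 0 < y' by rewrite divr_gt0// mulr_gt0.
  have lny : ln y = ln y' + ln (e / f).
    have -> : y = y' * (e / f) by rewrite /y'; field; rewrite !gt_eqF.
    by rewrite lnM ?posrE// divr_gt0.
  have lnef : ln (e / f) <= K * eta / kap.
    have h1 : ln (e / f) <= e / f - 1.
      have := expR_ge1Dx (ln (e / f)); rewrite lnK ?posrE ?divr_gt0//; lra.
    apply: (le_trans h1); have -> : e / f - 1 = (e - f) / f by field; rewrite gt_eqF.
    apply: (@le_trans _ _ (`|e - f| / f)).
      by rewrite ler_pM2r ?invr_gt0// ler_norm.
    by rewrite ler_pM ?invr_ge0 ?(ltW f0)// lef_pV2 ?posrE.
  have QJ : Q s i j <= J s i j + cb * expR 1.
    have := tan _ (expR_gt0 1); rewrite expRK mulr1.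
    have : p s i * e * expR 1 <= cb * expR 1.
      rewrite ler_wpM2r ?expR_ge0//; apply: le_trans ecb1.
      by rewrite ler_piMl// ltW.
    have : 0 <= p s i * e by rewrite mulr_ge0// ltW.
    lra.
  have fe : p s i * (f - e) <= K * eta.
    apply: (@le_trans _ _ `|e - f|) => //; apply: (@le_trans _ _ (p s i * `|e - f|)).
      by rewrite ler_wpM2l// distrC ler_norm.
    by rewrite ler_piMl.
  have T1 := tan y' y'0.
  have -> : Q s i j * ln y + p s i * f * (1 - y) =
     (Q s i j * ln y' + p s i * e * (1 - y')) + Q s i j * ln (e / f) + p s i * (f - e).
    have ey : e * y' = y * f by rewrite /y' mulrC divfK// gt_eqF.
    have -> : p s i * e * (1 - y') = p s i * e - p s i * (e * y') by ring.
    by rewrite ey lny; ring.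
  have Qln : Q s i j * ln (e / f) <= (J s i j + cb * expR 1) * (K * eta / kap).
    apply: (@le_trans _ _ (Q s i j * (K * eta / kap))); first by rewrite ler_wpM2l.
    by rewrite ler_wpM2r// divr_ge0 ?mulr_ge0 ?(ltW K_gt0) ?(ltW kap_gt0).
  rewrite /cost_slope.
  have -> : eta * ((K / kap * (1 + cb * expR 1) + K) * (J s i j + 1)) =
     (J s i j + cb * expR 1) * (K * eta / kap) + K * eta +
     (eta * (K / kap) * (1 + J s i j * (cb * expR 1)) + eta * K * J s i j).
    by field; rewrite gt_eqF.
  have rest : 0 <= eta * (K / kap) * (1 + J s i j * (cb * expR 1)) + eta * K * J s i j.
    have cbe : 0 <= cb * expR 1 by rewrite mulr_ge0 ?expR_ge0// ltW.
    have Kk : 0 <= K / kap by rewrite divr_ge0// ltW.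
    apply: addr_ge0; last by rewrite !mulr_ge0// ltW.
    apply: mulr_ge0; first by rewrite mulr_ge0.
    by rewrite addr_ge0// mulr_ge0.
  by lra.
have X0 : 0 <= J s i j + eta * (cost_slope * (J s i j + 1)).
  have cs0 : 0 <= cost_slope.
    have cbe : 0 <= cb * expR 1 by rewrite mulr_ge0 ?expR_ge0// ltW.
    have Kk : 0 <= K / kap by rewrite divr_ge0// ltW.
    by apply: addr_ge0; [rewrite mulr_ge0// addr_ge0|exact: ltW].
  by rewrite addr_ge0// !mulr_ge0// addr_ge0.
have -> : F * ln y + ql * f * (1 - y) =
   (1 - mix eps N s) * (Q s i j * ln y + p s i * f * (1 - y)) +
   mix eps N s * (g i j * ln y + f / l%:R * (1 - y)).
  by rewrite FE qE; ring.
apply: lerD; last by rewrite ler_wpM2l.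
apply: (@le_trans _ _ ((1 - mix eps N s) * (J s i j + eta * (cost_slope * (J s i j + 1))))).
  by rewrite ler_wpM2l// subr_ge0.
by rewrite ler_piMl// gerBl.
Qed.

(** At good times the energy is multiplied by [p / law <= 1 / (1 - eps) <= 1 + 2 * eps]; at bad
    times the control vanishes. *)
Lemma control_cost_pointwise eps N s i : small eps N -> 0 <= s <= T ->
  enorm (mixed_control eps N i s) ^+ 2 * mixed_law eps N s i
  <= (1 + 2 * eps) * energy i s.
Proof.
move=> sm sT; have eps0 := small_eps0 sm; have epsh := small_eps sm.
have [p0 p1] := p_prob sT; have q0 := mixed_law_gt0 sm i sT.
have E0 := energy_ge0 i sT.
have e2 : 0 <= 1 + 2 * eps by rewrite addr_ge0// mulr_ge0// ltW.
rewrite /mixed_control; case: ifP => [_|hb].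
  rewrite scale0r enorm_sqr_cV big1 ?mul0r; first exact: mulr_ge0.
  by move=> k _; rewrite mxE expr0n.
have hq := mixed_law_good sm i sT hb.
set q := mixed_law eps N s i in q0 hq *.
have -> : enorm ((p s i / q) *: u i s) ^+ 2 = (p s i / q) ^+ 2 * enorm (u i s) ^+ 2.
  by rewrite !enorm_sqr_cV mulr_sumr; apply: eq_bigr => k _; rewrite mxE exprMn.
have -> : (p s i / q) ^+ 2 * enorm (u i s) ^+ 2 * q = p s i / q * energy i s.
  by rewrite /energy; field; rewrite gt_eqF.
rewrite ler_wpM2r// ler_pdivrMr//.
have h1 : (1 + 2 * eps) * ((1 - eps) * p s i) <= (1 + 2 * eps) * q by rewrite ler_wpM2l.
apply: le_trans h1; rewrite mulrA ler_peMl//.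
have : eps * eps <= eps * 2^-1 by rewrite ler_wpM2l// ltW.
by lra.
Qed.

End Perturbation.

(** * Fluxes of an admissible triple *)

Lemma measurable_fun_pair_in d d1 d2 (T : measurableType d) (T1 : measurableType d1)
    (T2 : measurableType d2) (D : set T) (f : T -> T1) (g : T -> T2) :
  measurable_fun D f -> measurable_fun D g ->
  measurable_fun D (fun x => (f x, g x)).
Proof.
move=> mf mg mD; move: (mD).
apply: (measurability _ (measurable_prod_measurableType _ _)).
move=> _ [_ [A mA [B mB <-]] <-].
have -> : D `&` (fun x => (f x, g x)) @^-1` (A `*` B) =
    (D `&` f @^-1` A) `&` (D `&` g @^-1` B).
  by apply/seteqP; split => x /=; tauto.
by apply: measurableI; [exact: mf|exact: mg].
Qed.

Lemma ae_forall {R : realType} (I : finType) (P : I -> R -> Prop) :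
  (forall i, {ae lebesgue_measure, forall s : R, P i s}) ->
  {ae lebesgue_measure, forall s : R, forall i, P i s}.
Proof.
move=> h; have F : Filter (almost_everywhere (@lebesgue_measure R)).
  exact: ae_filter_ringOfSetsType.
exact: filter_forall.
Qed.

Section FluxData.
Context {R : realType} {d m l : nat}.
Local Notation mu := (@lebesgue_measure R).
Variables (b : 'cV[R]_d -> 'I_l -> 'cV[R]_d) (a : 'cV[R]_d -> 'I_l -> 'M[R]_(d, m)).
Variables (c : 'cV[R]_d -> 'I_l -> R) (r : 'cV[R]_d -> 'I_l -> 'I_l -> R).
Variables (K kap cb : R).
Hypothesis mc : model_consts b a c r K kap cb.
Variables (T : R) (xi : R -> 'cV[R]_d) (phi : 'I_l -> 'I_l -> R -> R -> R).
Variables (p : R -> 'I_l -> R).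
Hypothesis T_gt0 : 0 < T.
Hypothesis xi_cont : continuous_path T xi.
Hypothesis phi_adm : forall i j, (i, j) \in TT r ->
  measurable_fun (`[0, T] `*` `[0, zeta c]) (fun q : R * R => phi i j q.1 q.2) /\
  forall s z, 0 <= s <= T -> 0 <= z <= zeta c -> 0 <= phi i j s z.
Hypothesis p_adm : measurable_prob T p.
Hypothesis phi_stat : stationary_eq c r T phi xi p.
Hypothesis phi_cost : forall i j, (i, j) \in TT r -> (jump_cost c T phi p i j < +oo)%E.

Let p_ge0 i s : 0 <= s <= T -> 0 <= p s i.
Proof. by case: p_adm => h _ /h[]. Qed.

Let mp i : measurable_fun `[0, T] (fun s => p s i).
Proof. by case: p_adm. Qed.

Let p_le1 i s : 0 <= s <= T -> p s i <= 1.
Proof.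
by case: p_adm => h _ /h /(prob_vec_le1 i); apply: le_trans; exact: ler_norm.
Qed.

Let e i j s := rate c r (xi s) i j.

Let me i j : measurable_fun `[0, T] (e i j).
Proof.
apply: (measurable_path_comp (g := fun x => rate c r x i j)) => //.
by apply: (@lipschitz_continuous _ _ _ K) => x x'; exact: (mc_rate mc).
Qed.

Let e_itv i j s : 0 <= s <= T -> 0 <= e i j s <= zeta c.
Proof. by move=> _; rewrite (mc_rate0 mc) (mc_zeta mc). Qed.

Let off i j s := (\int[mu]_(z in `[0%R, e i j s]) (phi i j s z)%:E)%E.
Let Jb i j s := (\int[mu]_(z in `[0%R, zeta c]) (ell (phi i j s z) * p s i)%:E)%E.

(** Flux per unit of mass at [i]. [fine] sends an infinite integral to 0; for almost every time this
    happens only where [p s i = 0], and there [Q] vanishes anyway. *)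
Let G s i j : R := if (i, j) \in TT r then fine (off i j s) else 0.
Let Q s i j : R := p s i * G s i j.
Let J s i j : R := if (i, j) \in TT r then fine (Jb i j s) else 0.

Let off_ge0 i j s : 0 <= s <= T -> (i, j) \in TT r -> (0 <= off i j s)%E.
Proof.
move=> sT hij; have [_ h] := phi_adm hij.
apply: integral_ge0 => z /=; rewrite in_itv /= => /andP[z0 ze].
by rewrite lee_fin h// z0 (le_trans ze)//; case/andP: (e_itv i j sT).
Qed.

Let Jb_ge0 i j s : 0 <= s <= T -> (i, j) \in TT r -> (0 <= Jb i j s)%E.
Proof.
move=> sT hij; have [_ h] := phi_adm hij.
exact: (@jump_cost_ge0 _ T (zeta c) (phi i j) (fun s => p s i) h (p_ge0 i) s sT).
Qed.

Let mJb i j : (i, j) \in TT r -> measurable_fun `[0, T] (Jb i j).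
Proof.
move=> hij; have [h1 h2] := phi_adm hij.
exact: (@measurable_jump_cost _ T (zeta c) (phi i j) (fun s => p s i) h1 h2 (mp i) (p_ge0 i)).
Qed.

Let JbE i j : (i, j) \in TT r ->
  jump_cost c T phi p i j = (\int[mu]_(s in `[0%R, T]) Jb i j s)%E.
Proof.
move=> hij; have [h1 h2] := phi_adm hij.
rewrite /jump_cost; apply: (@jump_costE _ T (zeta c) (phi i j) (fun s => p s i)) => // s.
exact: p_ge0.
Qed.

Let iJb i j : (i, j) \in TT r -> mu.-integrable `[0, T] (Jb i j).
Proof.
move=> hij; apply/integrableP; split; first exact: mJb.
rewrite (_ : (\int[mu]_(x in _) _)%E = jump_cost c T phi p i j); first exact: phi_cost.
rewrite JbE//; apply: eq_integral => s; rewrite inE /= in_itv /= => sT.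
by rewrite gee0_abs// Jb_ge0.
Qed.

Let Jfin i j : (i, j) \in TT r ->
  {ae mu, forall s, 0 <= s <= T -> Jb i j s \is a fin_num}.
Proof.
by move=> hij; apply: ae_imp (integrable_ae _ (iJb hij)).
Qed.

Let J_ge0 s i j : 0 <= s <= T -> 0 <= J s i j.
Proof. by move=> sT; rewrite /J; case: ifP => // hij; rewrite fine_ge0// Jb_ge0. Qed.

Let G_ge0 s i j : 0 <= s <= T -> 0 <= G s i j.
Proof. by move=> sT; rewrite /G; case: ifP => // hij; rewrite fine_ge0// off_ge0. Qed.

Let Q_ge0 s i j : 0 <= s <= T -> 0 <= Q s i j.
Proof. by move=> sT; apply: mulr_ge0; [exact: p_ge0|exact: G_ge0]. Qed.

Let mJ i j : measurable_fun `[0, T] (fun s => J s i j).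
Proof.
have [hij|hij] := boolP ((i, j) \in TT r).
  rewrite (_ : (fun s => _) = fine \o Jb i j); last by apply/funext => s; rewrite /J hij.
  by apply: measurableT_comp => //; exact: mJb.
rewrite (_ : (fun s => _) = cst 0); first exact: measurable_cst.
by apply/funext => s; rewrite /J (negPf hij).
Qed.

Let mQ i j : measurable_fun `[0, T] (fun s => Q s i j).
Proof.
apply: measurable_funM => //; have [hij|hij] := boolP ((i, j) \in TT r).
  rewrite (_ : (fun s => _) = fine \o off i j); last by apply/funext => s; rewrite /G hij.
  have [h1 h2] := phi_adm hij; apply: measurableT_comp => //.
  exact: (@measurable_flux _ T (zeta c) (phi i j) (e i j) h1 h2 (me i j) (e_itv i j)).
rewrite (_ : (fun s => _) = cst 0); first exact: measurable_cst.
by apply/funext => s; rewrite /G (negPf hij).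
Qed.

Let JJb i j : (i, j) \in TT r ->
  {ae mu, forall s, `[0, T]%classic s -> Jb i j s = (J s i j)%:E}.
Proof.
move=> hij; apply: ae_imp (Jfin hij) => s h /=; rewrite in_itv /= => sT.
by rewrite /J hij fineK// h.
Qed.

Let iJ i j : mu.-integrable `[0, T] (EFin \o (fun s => J s i j)).
Proof.
have [hij|hij] := boolP ((i, j) \in TT r).
  apply: (ae_integrable _ (JJb hij)) => //; last exact: iJb.
  by apply/measurable_EFinP; exact: mJ.
rewrite (_ : EFin \o _ = cst 0%E) ?integrable0//.
by apply/funext => s; rewrite /= /J (negPf hij).
Qed.

Let intJ i j : (i, j) \in TT r ->
  (\int[mu]_(s in `[0, T]) J s i j)%:E = jump_cost c T phi p i j.
Proof.
move=> hij; rewrite JbE// /Rintegral fineK; last exact: (integrable_fin_num _ (iJ i j)).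
apply: ge0_ae_eq_integral => //.
- by apply/measurable_EFinP; exact: mJ.
- exact: mJb.
- by move=> s /=; rewrite in_itv /= lee_fin; exact: J_ge0.
- by move=> s /=; rewrite in_itv /= => sT; exact: Jb_ge0.
- by apply: ae_imp (JJb hij) => s h /h.
Qed.

(** The cost density is integrable, hence finite almost everywhere, and there [jump_cost_tangent]
    applies; where [p s i = 0] the left side of the inequality is 0. *)
Let tangent i j : (i, j) \in TT r -> {ae mu, forall s, 0 <= s <= T ->
  (p s i != 0 -> off i j s \is a fin_num) /\
  forall y, 0 < y -> Q s i j * ln y + p s i * rate c r (xi s) i j * (1 - y) <= J s i j}.
Proof.
move=> hij; have [h1 h2] := phi_adm hij.
apply: ae_imp (Jfin hij) => s Jf sT.
have Joo : (Jb i j s < +oo)%E by rewrite ltey_eq Jf.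
have [p0|pN0] := eqVneq (p s i) 0.
  by split => // y _; rewrite /Q p0 !mul0r addr0 J_ge0.
have [f1 f2] := @jump_cost_tangent _ T (zeta c) (phi i j) (fun s => p s i) (e i j)
  h1 h2 (p_ge0 i) (e_itv i j) s sT Joo pN0.
by split => // y y0; rewrite /Q /G /J hij; exact: f2.
Qed.

(** The tangent at [expR 1] gives [Q <= J + cb * expR 1] almost everywhere. *)
Let iQ i j : mu.-integrable `[0, T] (EFin \o (fun s => Q s i j)).
Proof.
have [hij|hij] := boolP ((i, j) \in TT r); last first.
  rewrite (_ : EFin \o _ = cst 0%E) ?integrable0//.
  by apply/funext => s; rewrite /= /Q /G (negPf hij) mulr0.
pose C := cb * expR 1.
have cb0 : 0 <= cb by apply: le_trans (mc_kapcb mc); rewrite ltW// (mc_kap mc).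
have C0 : 0 <= C by rewrite mulr_ge0 ?expR_ge0.
have iC : mu.-integrable `[0, T] (EFin \o cst C).
  by apply: (@bounded_integrable _ _ _ C) => [|s _]; [exact: measurable_cst|rewrite ger0_norm].
have iJC : mu.-integrable `[0, T] (EFin \o (fun s => J s i j + C)).
  exact: (integrableD _ (iJ i j) iC).
apply/integrableP; split; first by apply/measurable_EFinP; exact: mQ.
case/integrableP: iJC => mJC; apply: le_lt_trans.
apply: ae_ge0_le_integral => //.
- by do 2 apply: measurableT_comp => //; exact: mQ.
- by do 2 apply: measurableT_comp => //; apply/measurable_EFinP.
apply: ae_imp (tangent hij) => s h /=; rewrite in_itv /= => sT.
have [_ /(_ _ (expR_gt0 1))] := h sT; rewrite expRK mulr1 lee_fin.
have J0 := J_ge0 i j sT; have Q0 := Q_ge0 i j sT.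
rewrite (ger0_norm Q0) ger0_norm ?addr_ge0//.
have e0 := mc_rate0 mc (xi s) i j.
have ecb : rate c r (xi s) i j <= cb.
  apply: le_trans (mc_sum mc (xi s) i); rewrite (bigD1 j)//= lerDl sumr_ge0// => k _.
  exact: (mc_rate0 mc).
have pe : p s i * rate c r (xi s) i j * expR 1 <= C.
  rewrite /C ler_wpM2r ?expR_ge0//; apply: le_trans ecb.
  by rewrite ler_piMl// p_le1.
have : 0 <= p s i * rate c r (xi s) i j by rewrite mulr_ge0// p_ge0.
lra.
Qed.

(** Interface to the perturbation: [phi] is forgotten, and only its fluxes, its cost densities and
    the tangent inequalities linking them remain. *)
Lemma flux_data : exists Q J : R -> 'I_l -> 'I_l -> R,
  [/\ (forall s i j, 0 <= s <= T -> 0 <= Q s i j) /\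
      (forall s i j, 0 <= s <= T -> 0 <= J s i j),
      forall i j, mu.-integrable `[0, T] (EFin \o (fun s => Q s i j)),
      forall i j, mu.-integrable `[0, T] (EFin \o (fun s => J s i j)),
      forall i j, (i, j) \in TT r ->
        (\int[mu]_(s in `[0, T]) J s i j)%:E = jump_cost c T phi p i j &
      (forall s i j, (i, j) \notin TT r -> Q s i j = 0) /\
      {ae mu, forall s, 0 <= s <= T ->
        (forall j, \sum_i Q s i j = \sum_y Q s j y) /\
        forall i j, (i, j) \in TT r -> forall y, 0 < y ->
          Q s i j * ln y + p s i * rate c r (xi s) i j * (1 - y) <= J s i j}].
Proof.
exists Q, J; split => //; split.
  by move=> s i j hij; rewrite /Q /G (negPf hij) mulr0.
pose Pij (ij : 'I_l * 'I_l) s := 0 <= s <= T -> ij \in TT r ->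
  (p s ij.1 != 0 -> off ij.1 ij.2 s \is a fin_num) /\
  forall y, 0 < y -> Q s ij.1 ij.2 * ln y
    + p s ij.1 * rate c r (xi s) ij.1 ij.2 * (1 - y) <= J s ij.1 ij.2.
have hP : {ae mu, forall s, forall ij, Pij ij s}.
  apply: ae_forall => -[i j]; have [hij|hij] := boolP ((i, j) \in TT r).
    by apply: ae_imp (tangent hij) => s h sT _; exact: h.
  by apply: aeW => s sT h; move: hij; rewrite h.
apply: ae_imp (ae_and phi_stat hP) => s [st h] sT; split; last first.
  by move=> i j hij; have [_] := h (i, j) sT hij.
have := st sT; rewrite (@stationary_balanced _ _ _ _ _ _ _ _ (G s)).
  by move=> bG j; rewrite /Q bG mulr_sumr.
move=> i j pN0; rewrite /ext /G; case: ifP => hij.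
  by rewrite fineK//; have [f _] := h (i, j) sT hij; exact: f.
rewrite /Eset -/(rate c r (xi s) i j) (mc_nTT mc) ?hij// set_itv1.
exact: integral_set1.
Qed.

End FluxData.

(** * The perturbed controls *)

Section PerturbedControls.
Context {R : realType} {d m l : nat}.
Local Notation mu := (@lebesgue_measure R).
Variables (b : 'cV[R]_d -> 'I_l -> 'cV[R]_d) (a : 'cV[R]_d -> 'I_l -> 'M[R]_(d, m)).
Variables (c : 'cV[R]_d -> 'I_l -> R) (r : 'cV[R]_d -> 'I_l -> 'I_l -> R).
Variables (K kap cb : R).
Hypothesis mc : model_consts b a c r K kap cb.
Hypothesis l_gt0 : (0 < l)%N.
Variables (T : R) (x0 : 'cV[R]_d).
Hypothesis T_gt0 : 0 < T.
Variables (xi : R -> 'cV[R]_d) (u : 'I_l -> R -> 'cV[R]_m) (p : R -> 'I_l -> R).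
Hypothesis u_meas : forall i k, measurable_fun `[0, T] (fun s => u i s k 0).
Hypothesis p_prob : forall s, 0 <= s <= T -> prob_vec (p s).
Hypothesis mp : forall i, measurable_fun `[0, T] (fun s => p s i).
Variables (Q J : R -> 'I_l -> 'I_l -> R) (g : 'I_l -> 'I_l -> R) (g0 : R).
Hypothesis Q_ge0 : forall s i j, 0 <= s <= T -> 0 <= Q s i j.
Hypothesis J_ge0 : forall s i j, 0 <= s <= T -> 0 <= J s i j.
Hypothesis iQ : forall i j, mu.-integrable `[0, T] (EFin \o (fun s => Q s i j)).
Hypothesis iJ : forall i j, mu.-integrable `[0, T] (EFin \o (fun s => J s i j)).
Hypothesis Q_TT : forall s i j, (i, j) \notin TT r -> Q s i j = 0.
Hypothesis g_TT : forall i j, (i, j) \notin TT r -> g i j = 0.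
Hypothesis g_bal : forall j, \sum_i g i j = \sum_y g j y.
Hypothesis g0_gt0 : 0 < g0.
Hypothesis g_low : forall i j, (i, j) \in TT r -> g0 <= g i j.
Hypothesis g_itv : forall i j, 0 <= g i j <= cb.
Hypothesis iU : forall i, mu.-integrable `[0, T] (EFin \o energy u p i).
Variables (eps N : R).
Hypothesis sm : small T u p Q eps N.
Variable xis : R -> 'cV[R]_d.
Hypothesis xis_cont : continuous_path T xis.

Let T_ge0 : 0 <= T := ltW T_gt0.
Let kap_gt0 : 0 < kap := mc_kap mc.
Let cb_gt0 : 0 < cb. Proof. exact: lt_le_trans (mc_kapcb mc). Qed.
Let l0 : 0 < l%:R :> R. Proof. by rewrite ltr0n. Qed.
Let eps0 : 0 < eps := small_eps0 sm.
Let N0 : 0 < N := small_N sm.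

Let law := mixed_law u p Q eps N.
Let flux := mixed_flux u p Q g eps N.

Definition edge (s : R) (i j : 'I_l) : R := rate c r (xis s) i j.
Definition intensity (s : R) (i j : 'I_l) : R :=
  if (i, j) \in TT r then mixed_intensity c r u p Q g xis eps N s i j else 1.
(** A lower bound of the mixed flux over an upper bound of law times rate, capped at 1 because
    [step_control] takes the value 1 beyond the edge; dually for [intensity_high]. *)
Definition intensity_low : R := Num.min 1 (eps * g0 / cb).
Definition intensity_high : R := Num.max 1 ((N + cb) / (eps / l%:R * kap)).

Let rate_le x i j : rate c r x i j <= cb.
Proof.
apply: le_trans (mc_sum mc x i); rewrite (bigD1 j)//= lerDl sumr_ge0// => k _.
exact: (mc_rate0 mc).
Qed.

Lemma edge_ge0 s i j : 0 <= s <= T -> 0 <= edge s i j.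
Proof. by move=> _; exact: (mc_rate0 mc). Qed.

Lemma measurable_edge i j : measurable_fun `[0, T] (fun s => edge s i j).
Proof.
apply: (measurable_path_comp (g := fun x => rate c r x i j)) => //.
by apply: (@lipschitz_continuous _ _ _ K) => x x'; exact: (mc_rate mc).
Qed.

Let law_gt0 s i : 0 <= s <= T -> 0 < law s i.
Proof. exact: (mixed_law_gt0 l_gt0 p_prob sm). Qed.

Let edge_gt0 s i j : (i, j) \in TT r -> 0 < edge s i j.
Proof. by move=> h; apply: lt_le_trans (mc_TT mc _ h). Qed.

Lemma intensity_low_gt0 : 0 < intensity_low.
Proof. by rewrite lt_min ltr01 divr_gt0// mulr_gt0. Qed.

Lemma intensity_low_le1 : intensity_low <= 1.
Proof. by rewrite ge_min lexx. Qed.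

Lemma intensity_high_ge1 : 1 <= intensity_high.
Proof. by rewrite le_max lexx. Qed.

Lemma intensity_itv s i j : 0 <= s <= T -> (i, j) \in TT r ->
  intensity_low <= intensity s i j <= intensity_high.
Proof.
move=> sT h; rewrite /intensity h /mixed_intensity -/(flux s i j) -/(law s i) -/(edge s i j).
have q0 := law_gt0 i sT; have e0 := edge_gt0 s h.
have [p0 p1] := mixed_law_prob l_gt0 p_prob sm sT.
have q1 : law s i <= 1.
  by have := prob_vec_le1 i (mixed_law_prob l_gt0 p_prob sm sT); rewrite ger0_norm// ltW.
have qe : 0 < law s i * edge s i j by exact: mulr_gt0.
have F0 : eps * g0 <= flux s i j by exact: (mixed_flux_low Q_ge0 g0_gt0 g_low sm sT h).
have FN : flux s i j <= N + cb by exact: (mixed_flux_high p_prob Q_ge0 g_itv sm i j sT).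
apply/andP; split.
  rewrite ge_min; apply/orP; right; apply: ler_pM => //.
  - by rewrite mulr_ge0// ltW.
  - by rewrite invr_ge0 ltW.
  - rewrite lef_pV2 ?posrE//; apply: le_trans (rate_le (xis s) i j).
    by rewrite ler_piMl// ltW.
rewrite le_max; apply/orP; right; apply: ler_pM => //.
- by apply: le_trans F0; rewrite mulr_ge0// ltW.
- by rewrite invr_ge0 ltW.
- rewrite lef_pV2 ?posrE//; last by rewrite !mulr_gt0 ?invr_gt0.
  apply: ler_pM.
  + by rewrite divr_ge0// ltW.
  + exact: ltW.
  + exact: (mixed_law_low l_gt0 p_prob sm i sT).
  + exact: (mc_TT mc).
Qed.

Lemma measurable_intensity i j : measurable_fun `[0, T] (fun s => intensity s i j).
Proof.
have [h|h] := boolP ((i, j) \in TT r); last first.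
  rewrite (_ : (fun s => _) = cst 1); first exact: measurable_cst.
  by apply/funext => s; rewrite /intensity (negPf h).
rewrite (_ : (fun s => _) = fun s => flux s i j * (law s i * edge s i j)^-1).
  apply: measurable_funM; first exact: measurable_mixed_flux.
  apply: measurable_funV_gt0 => [|s /=].
    apply: measurable_funM; first exact: measurable_mixed_law.
    exact: measurable_edge.
  by rewrite in_itv /= => sT; rewrite mulr_gt0 ?law_gt0 ?edge_gt0.
by apply/funext => s; rewrite /intensity h.
Qed.

Lemma intensity_ge0 s i j : 0 <= s <= T -> 0 <= intensity s i j.
Proof.
move=> sT; have [h|h] := boolP ((i, j) \in TT r); last by rewrite /intensity (negPf h).
by have /andP[+ _] := intensity_itv sT h; apply: le_trans; rewrite ltW// intensity_low_gt0.
Qed.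

(** On the path [xis] the edge is exactly the end of the jump interval, so the controlled rate is
    intensity times rate and the mixed flux is recovered. *)
Lemma law_step_rate s i j : 0 <= s <= T ->
  law s i * step_rate c r intensity edge s (xis s) i j = flux s i j.
Proof.
move=> sT; rewrite /step_rate -/(edge s i j) minxx subrr maxxx addr0.
have [h|h] := boolP ((i, j) \in TT r); last first.
  rewrite /edge (mc_nTT mc _ h) !mulr0 /flux /mixed_flux Q_TT// g_TT//.
  by rewrite !mulr0 addr0.
rewrite /intensity h /mixed_intensity -/(flux s i j) -/(law s i) -/(edge s i j).
have q0 := law_gt0 i sT; have e0 := edge_gt0 s h.
by field; rewrite !gt_eqF.
Qed.

(** [Q s] and [g] are circulations, and the weights of the mixture depend on [s] alone. *)
Lemma law_balanced s : 0 <= s <= T -> (forall j, \sum_i Q s i j = \sum_y Q s j y) ->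
  balanced (step_rate c r intensity edge s (xis s)) (law s).
Proof.
move=> sT hQ j; rewrite mulr_sumr.
rewrite (eq_bigr _ (fun i _ => law_step_rate i j sT)).
rewrite (eq_bigr _ (fun i _ => law_step_rate j i sT)).
by rewrite /flux /mixed_flux !big_split /= -!mulr_sumr hQ g_bal.
Qed.

Lemma measurable_step_control i j :
  measurable_fun (`[0, T] `*` `[0, zeta c])
    (fun q : R * R => step_control intensity edge i j q.1 q.2).
Proof.
have m1 (f : R -> R) : measurable_fun `[0, T] f ->
    measurable_fun (`[0, T] `*` `[0, zeta c]) (fun q : R * R => f q.1).
  move=> mf; apply: (measurable_comp (F := `[0, T]) _ _ mf) => //.
    by move=> _ [q [h _] <-].
  by apply: measurable_funTS; exact: measurable_fst.
have mD : measurable (`[0, T] `*` `[0, zeta c] : set (R * R)) by exact: measurableX.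
apply: measurable_fun_if => //.
- apply: measurable_fun_ler; first by apply: measurable_funTS; exact: measurable_snd.
  exact: (m1 (fun s => edge s i j) (measurable_edge i j)).
- apply: measurable_funS (m1 _ (measurable_intensity i j)) => // q [].
Qed.

Lemma step_control_ge0 i j s z : 0 <= s <= T -> 0 <= step_control intensity edge i j s z.
Proof. by move=> sT; rewrite /step_control; case: ifP => // _; exact: intensity_ge0. Qed.

Section Costs.
Variable pis : R -> 'I_l -> R.
Hypothesis pis_adm : measurable_prob T pis.
Hypothesis pis_law : {ae mu, forall s, 0 <= s <= T -> law s = pis s}.
Variable eta : R.
Hypothesis xi_xis : forall s, 0 <= s <= T -> n1 (xi s - xis s) <= eta.

Let pis_ge0 s i : 0 <= s <= T -> 0 <= pis s i.
Proof. by case: pis_adm => h _ /h[]. Qed.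

(** Stated for any law equal to the mixed one almost everywhere, since the law finally used is the
    invariant one along [xis]. *)
Lemma perturbed_jump_cost i j : (i, j) \in TT r ->
  {ae mu, forall s, 0 <= s <= T -> forall y, 0 < y ->
     Q s i j * ln y + p s i * rate c r (xi s) i j * (1 - y) <= J s i j} ->
  (jump_cost c T (step_control intensity edge) pis i j <=
   (\int[mu]_(s in `[0, T]) J s i j
    + eta * (cost_slope K kap cb * (\int[mu]_(s in `[0, T]) J s i j + T))
    + eps * (T + 1) * cost_reference kap cb (l := l))%:E)%E.
Proof.
move=> hij tan; have mpis : measurable_fun `[0, T] (fun s => pis s i) by case: pis_adm.
have eta0 : 0 <= eta.
  have h0 : 0 <= (0 : R) <= T by rewrite lexx.
  by apply: le_trans (xi_xis h0); exact: n1_ge0.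
have cs0 : 0 <= cost_slope K kap cb.
  have Kk : 0 <= K / kap by rewrite divr_ge0// ltW// (mc_K mc).
  apply: addr_ge0; last by rewrite ltW// (mc_K mc).
  by rewrite mulr_ge0// addr_ge0// mulr_ge0 ?expR_ge0// ltW.
have cr0 : 0 <= @cost_reference R l kap cb.
  apply: addr_ge0; last exact: ltW.
  by rewrite divr_ge0 ?(ltW kap_gt0)// mulr_ge0 ?sqr_ge0// ltW.
have JE := @jump_costE _ T (zeta c) (step_control intensity edge i j) (fun s => pis s i)
  (measurable_step_control i j) (fun s z sT _ => step_control_ge0 i j z sT) mpis
  (fun s sT => pis_ge0 i sT).
rewrite /jump_cost JE.
(* The result of integrating out [z]: beyond the edge the control is 1 and costs nothing, so only
   the length [edge s i j], at most [zeta c], contributes. *)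
pose f s := pis s i * (edge s i j * ell (intensity s i j)).
have f0 s : 0 <= s <= T -> 0 <= f s.
  move=> sT; rewrite mulr_ge0 ?pis_ge0// mulr_ge0 ?edge_ge0// ell_ge0//.
  exact: intensity_ge0.
rewrite (_ : (\int[mu]_(s in _) _)%E = (\int[mu]_(s in `[0%R, T]) (f s)%:E)%E); last first.
  apply: eq_integral => s; rewrite inE /= in_itv /= => sT.
  have ze : edge s i j <= zeta c by exact: (mc_zeta mc).
  have e0 := edge_ge0 i j sT.
  have al0 : 0 <= ell (intensity s i j) * pis s i.
    by rewrite mulr_ge0 ?pis_ge0// ell_ge0// intensity_ge0.
  rewrite (_ : f s = ell (intensity s i j) * pis s i * Num.min (zeta c) (edge s i j)
      + 0 * Num.max (zeta c - edge s i j) 0); last by rewrite mul0r addr0 min_r// /f; ring.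
  rewrite -integral_step//; last exact: le_trans ze.
  apply: eq_integral => z _; congr _%:E; rewrite /step_control; case: ifP => // _.
  by rewrite ell1 mul0r.
pose h s := J s i j + eta * (cost_slope K kap cb * (J s i j + 1))
  + mix u p Q eps N s * @cost_reference R l kap cb.
have i1 : mu.-integrable `[0, T] (EFin \o cst 1).
  by apply: (@bounded_integrable _ _ _ 1) => [|s _]; [exact: measurable_cst|rewrite normr1].
have imix : mu.-integrable `[0, T] (EFin \o mix u p Q eps N).
  apply: (@bounded_integrable _ _ _ 1); first exact: measurable_mix.
  move=> s _; have /andP[m0 m1] := mix_itv sm s.
  by rewrite ger0_norm// (le_trans _ m0)// ltW.
have iJ1 : mu.-integrable `[0, T] (EFin \o (fun s => J s i j + 1)).
  exact: (integrableD _ (iJ i j) i1).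
have iJ2 : mu.-integrable `[0, T] (EFin \o (fun s => cost_slope K kap cb * (J s i j + 1))).
  exact: (integrableZl _ _ iJ1).
have iJ3 : mu.-integrable `[0, T]
    (EFin \o (fun s => eta * (cost_slope K kap cb * (J s i j + 1)))).
  exact: (integrableZl _ _ iJ2).
have iJ4 : mu.-integrable `[0, T]
    (EFin \o (fun s => J s i j + eta * (cost_slope K kap cb * (J s i j + 1)))).
  exact: (integrableD _ (iJ i j) iJ3).
have im : mu.-integrable `[0, T]
    (EFin \o (fun s => mix u p Q eps N s * @cost_reference R l kap cb)).
  rewrite (_ : EFin \o _ = (fun s => (@cost_reference R l kap cb)%:E * (mix u p Q eps N s)%:E)%E).
    exact: (integrableZl _ _ imix).
  by apply/funext => s; rewrite /= -EFinM mulrC.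
have ih : mu.-integrable `[0, T] (EFin \o h) by exact: (integrableD _ iJ4 im).
apply: (@le_trans _ _ (\int[mu]_(s in `[0%R, T]) (h s)%:E)%E).
  apply: ae_ge0_le_integral => //.
  - apply/measurable_EFinP; apply: measurable_funM => //.
    apply: measurable_funM; first exact: measurable_edge.
    apply: measurableT_comp; first exact: measurable_ell.
    exact: measurable_intensity.
  - move=> s /=; rewrite in_itv /= => sT; have /andP[m0 m1] := mix_itv sm s.
    have J0 := J_ge0 i j sT.
    have m00 := le_trans (ltW eps0) m0.
    rewrite lee_fin /h; apply: addr_ge0; last exact: mulr_ge0.
    by apply: addr_ge0 => //; rewrite !mulr_ge0// addr_ge0.
  - exact: (measurable_int mu ih).
  apply: ae_imp (ae_and pis_law tan) => s [pl tn] /=; rewrite in_itv /= => sT.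
  rewrite lee_fin /f -pl// /intensity hij.
  exact: (jump_cost_pointwise mc l_gt0 p_prob Q_ge0 J_ge0 g0_gt0 g_low g_itv sm sT hij
    (tn sT) (xi_xis sT)).
rewrite -[leLHS]fineK; last exact: (integrable_fin_num _ ih).
rewrite lee_fin -/(Rintegral mu `[0, T]%classic h) /h RintegralD// RintegralD//.
rewrite RintegralZl// RintegralZl// RintegralD// Rintegral_cst//.
have -> : fine (mu `[0, T]%classic) = T.
  by rewrite /= lebesgue_measure_itv /= lte_fin T_gt0 /= subr0.
rewrite mul1r lerD2l RintegralZr//.
by rewrite ler_wpM2r//; exact: integral_mix_le.
Qed.

Lemma perturbed_control_cost i :
  (control_cost T (mixed_control u p Q eps N) pis i <=
   ((1 + 2 * eps) * \int[mu]_(s in `[0, T]) energy u p i s)%:E)%E.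
Proof.
have mpis : measurable_fun `[0, T] (fun s => pis s i) by case: pis_adm.
have iE : mu.-integrable `[0, T] (EFin \o (fun s => (1 + 2 * eps) * energy u p i s)).
  exact: (integrableZl _ _ (iU i)).
rewrite -RintegralZl// /Rintegral fineK; last exact: (integrable_fin_num _ iE).
apply: ae_ge0_le_integral => //.
- by move=> s /=; rewrite in_itv /= lee_fin => sT; rewrite mulr_ge0 ?sqr_ge0 ?pis_ge0.
- apply/measurable_EFinP; apply: measurable_funM => //.
  rewrite (_ : (fun s => _) = fun s => \sum_k mixed_control u p Q eps N i s k 0 ^+ 2).
    apply: measurable_sum => k; apply: measurable_funX.
    exact: measurable_mixed_control.
  by apply/funext => s; rewrite enorm_sqr_cV.
- move=> s /=; rewrite in_itv /= lee_fin => sT.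
  apply: mulr_ge0; last exact: (energy_ge0 u p_prob i sT).
  by rewrite addr_ge0// mulr_ge0// ltW.
- exact: (measurable_int mu iE).
apply: ae_imp pis_law => s pl /=; rewrite in_itv /= => sT.
by rewrite lee_fin -pl//; exact: (control_cost_pointwise l_gt0 p_prob i sm sT).
Qed.

End Costs.

End PerturbedControls.

(** * Costs of an admissible triple *)

Lemma prob_vec_card {R : realType} l (v : 'I_l -> R) : prob_vec v -> (0 < l)%N.
Proof.
case: l v => // v [_]; rewrite big_ord0 => /esym/eqP.
by rewrite oner_eq0.
Qed.

Lemma measurable_along_path {R : realType} d (T : R) (h : R -> 'cV[R]_d -> R)
    (x : R -> 'cV[R]_d) :
  measurable_fun (`[0, T] `*` [set: borel 'cV[R]_d])
    (fun p : R * borel 'cV[R]_d => h p.1 p.2) ->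
  continuous_path T x -> measurable_fun `[0, T] (fun s => h s (x s)).
Proof.
move=> mh cx.
have mx : measurable_fun `[0, T] (x : R -> borel 'cV[R]_d).
  by apply: measurable_borel_cV => // k; exact: measurable_path_coord.
apply: (measurable_comp (F := `[0, T] `*` [set: borel 'cV[R]_d])
  (g := fun s => (s, (x s : borel 'cV[R]_d))) _ _ mh).
- exact: measurableX.
- by move=> _ [s sT <-].
- exact: measurable_fun_pair_in.
Qed.

Section Circulation.
Context {R : realType} {d m l : nat}.
Variables (b : 'cV[R]_d -> 'I_l -> 'cV[R]_d) (a : 'cV[R]_d -> 'I_l -> 'M[R]_(d, m)).
Variables (c : 'cV[R]_d -> 'I_l -> R) (r : 'cV[R]_d -> 'I_l -> 'I_l -> R).
Variables (K kap cb : R).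

(** The stationary flux of the uncontrolled chain frozen at the point 0: its law is bounded below
    and its rates are at least [kap] on [TT]. *)
Lemma reference_circulation : model_consts b a c r K kap cb ->
  (forall x i j, 0 <= r x i j) -> (0 < l)%N ->
  exists (g : 'I_l -> 'I_l -> R) (g0 : R),
    [/\ 0 < g0, forall i j, (i, j) \notin TT r -> g i j = 0,
        forall i j, (i, j) \in TT r -> g0 <= g i j,
        forall i j, 0 <= g i j <= cb &
        forall j, \sum_i g i j = \sum_y g j y].
Proof.
move=> mc r_ge0 l_gt0; have kap0 := mc_kap mc; have kapcb := mc_kapcb mc.
have rb : rate_bounds r (0 : 'cV[R]_d) kap cb (rate c r 0).
  split=> [i j|i j h|i]; [exact: (mc_rate0 mc)| |exact: (mc_sum mc)].
  by apply: (mc_TT mc); rewrite inE /TT /=; exists 0.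
have [v [pv bv]] := balanced_exists l_gt0 kap0 kapcb rb.
have [c0 c00 hc0] := balanced_lower_bound (r_ge0 0) (mc_irr mc 0) l_gt0 kap0 kapcb.
have cv i := hc0 _ _ i rb pv bv; have [v0 _] := pv.
have r0 := mc_rate0 mc 0.
exists (fun i j => v i * rate c r 0 i j), (c0 * kap); split.
- exact: mulr_gt0.
- by move=> i j h; rewrite (mc_nTT mc)// mulr0.
- by move=> i j h; apply: ler_pM; rewrite ?(ltW c00) ?(ltW kap0)// (mc_TT mc).
- move=> i j; rewrite mulr_ge0//=.
  have v1 : v i <= 1 by have := prob_vec_le1 i pv; rewrite ger0_norm.
  apply: (@le_trans _ _ (rate c r 0 i j)); first by rewrite ler_piMl.
  by apply: le_trans (mc_sum mc 0 i); rewrite (bigD1 j)//= lerDl sumr_ge0//.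
- by move=> j; rewrite -mulr_sumr; exact: bv.
Qed.

End Circulation.

Section CostOfAdmissible.
Context {R : realType} {d m l : nat}.
Local Notation mu := (@lebesgue_measure R).
Variables (b : 'cV[R]_d -> 'I_l -> 'cV[R]_d) (a : 'cV[R]_d -> 'I_l -> 'M[R]_(d, m)).
Variables (c : 'cV[R]_d -> 'I_l -> R) (r : 'cV[R]_d -> 'I_l -> 'I_l -> R).
Variables (x0 : 'cV[R]_d) (T : R) (xi : R -> 'cV[R]_d).
Variables (u : 'I_l -> R -> 'cV[R]_m) (phi : 'I_l -> 'I_l -> R -> R -> R).
Variable p : R -> 'I_l -> R.
Hypothesis adm : admissible b a c r x0 T xi u phi p.

Let p_ge0 s i : 0 <= s <= T -> 0 <= p s i.
Proof. by case: adm => _ _ [h _] _ _ /h[]. Qed.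

Lemma admissible_control_cost_ge0 i : (0 <= control_cost T u p i)%E.
Proof.
apply: integral_ge0 => s /=; rewrite in_itv /= => sT.
by rewrite lee_fin mulr_ge0 ?sqr_ge0 ?p_ge0.
Qed.

Lemma admissible_jump_cost_ge0 i j : (i, j) \in TT r -> (0 <= jump_cost c T phi p i j)%E.
Proof.
move=> hij; case: adm => _ /(_ _ _ hij)[_ phi0] _ _ _.
apply: integral_ge0 => -[s z] [] /=; rewrite !in_itv /= => sT zT.
by rewrite lee_fin mulr_ge0 ?p_ge0// ell_ge0// phi0.
Qed.

Lemma admissible_cost_ge0 : (0 <= cost c r T u phi p)%E.
Proof.
apply: adde_ge0; last by apply: sume_ge0 => -[i j] h; exact: admissible_jump_cost_ge0.
apply: sume_ge0 => i _.
by rewrite mule_ge0 ?admissible_control_cost_ge0// lee_fin invr_ge0.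
Qed.

Lemma admissible_jump_cost_fin i j : (cost c r T u phi p < +oo)%E -> (i, j) \in TT r ->
  (jump_cost c T phi p i j < +oo)%E.
Proof.
move=> + hij; apply: le_lt_trans; apply: (@le_trans _ _
  (\sum_(q : 'I_l * 'I_l | q \in TT r) jump_cost c T phi p q.1 q.2)%E).
  rewrite (bigD1 (i, j))//= leeDl// sume_ge0// => -[i' j'] /andP[h _].
  exact: admissible_jump_cost_ge0.
rewrite /cost leeDr// sume_ge0// => k _.
by rewrite mule_ge0 ?admissible_control_cost_ge0// lee_fin invr_ge0.
Qed.

Lemma admissible_measurable_control i k : measurable_fun `[0, T] (fun s => u i s k 0).
Proof. by case: adm => /(_ i)[h _] _ _ _ _; exact: (measurable_coord k h). Qed.

Lemma integrable_energy i : mu.-integrable `[0, T] (EFin \o energy u p i).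
Proof.
have mp : measurable_fun `[0, T] (fun s => p s i) by case: adm => _ _ [].
have me : measurable_fun `[0, T] (energy u p i).
  rewrite (_ : energy u p i = fun s => (\sum_k u i s k 0 ^+ 2) * p s i).
    apply: measurable_funM => //; apply: measurable_sum => k; apply: measurable_funX.
    exact: admissible_measurable_control.
  by apply/funext => s; rewrite /energy enorm_sqr_cV.
apply/integrableP; split; first exact/measurable_EFinP.
rewrite (_ : (\int[mu]_(x in _) _)%E = control_cost T u p i).
  by case: adm => /(_ i)[].
apply: eq_integral => s; rewrite inE /= in_itv /= => sT.
by rewrite ger0_norm// mulr_ge0 ?sqr_ge0 ?p_ge0.
Qed.

Lemma control_costE i :
  control_cost T u p i = (\int[mu]_(s in `[0, T]) energy u p i s)%:E.
Proof. by rewrite /Rintegral fineK// (integrable_fin_num _ (integrable_energy i)). Qed.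

End CostOfAdmissible.

(** [N] is chosen after [eps], large enough to absorb the integral of the load; the summand 1 keeps
    it positive. *)
Lemma small_exists {R : realType} m l (T : R) (u : 'I_l -> R -> 'cV[R]_m)
    (p : R -> 'I_l -> R) (Q : R -> 'I_l -> 'I_l -> R) (e : R) :
  (forall s, 0 <= s <= T -> prob_vec (p s)) ->
  (forall s i j, 0 <= s <= T -> 0 <= Q s i j) -> 0 < e ->
  exists eps N : R, eps <= e /\ small T u p Q eps N.
Proof.
move=> p_prob Q_ge0 e0; pose eps := Num.min 2^-1 e.
have eps0 : 0 < eps by rewrite lt_min e0 invr_gt0 ltr0n.
pose X := \int[lebesgue_measure]_(s in `[0, T]) load u p Q s.
have X0 : 0 <= X.
  by apply: Rintegral_ge0 => s /=; rewrite in_itv /=; exact: load_ge0.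
exists eps, (X / eps ^+ 2 + 1); split; first by rewrite ge_min lexx orbT.
have e2 : 0 < eps ^+ 2 by rewrite exprn_gt0.
have Xe : 0 <= X / eps ^+ 2 by rewrite divr_ge0 ?sqr_ge0.
split => //.
- by rewrite ge_min lexx.
- by rewrite ltr_wpDl.
- by rewrite mulrDl divfK ?gt_eqF// mul1r lerDl ltW.
Qed.

Section Approximation.
Context {R : realType} {d m l : nat}.
Local Notation mu := (@lebesgue_measure R).
Variables (b : 'cV[R]_d -> 'I_l -> 'cV[R]_d) (a : 'cV[R]_d -> 'I_l -> 'M[R]_(d, m)).
Variables (c : 'cV[R]_d -> 'I_l -> R) (r : 'cV[R]_d -> 'I_l -> 'I_l -> R).
Variables (K kap cb : R).
Hypothesis mc : model_consts b a c r K kap cb.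
Hypothesis r_ge0 : forall x i j, 0 <= r x i j.
Hypothesis l_gt0 : (0 < l)%N.
Variables (T : R) (x0 : 'cV[R]_d).
Hypothesis T_gt0 : 0 < T.
Variables (xi : R -> 'cV[R]_d) (u : 'I_l -> R -> 'cV[R]_m).
Variables (phi : 'I_l -> 'I_l -> R -> R -> R) (p : R -> 'I_l -> R).
Hypothesis xi_cont : continuous_path T xi.
Hypothesis adm : admissible b a c r x0 T xi u phi p.
Hypothesis cost_fin : (cost c r T u phi p < +oo)%E.

(** The cost estimate covers all laws equal to the mixed one almost everywhere, because the
    invariant kernel that supplies the final law is built only afterwards, from [q] and [es]. *)
Lemma approximation (delta : R) : 0 < delta ->
  exists (xis : R -> 'cV[R]_d) (us : 'I_l -> R -> 'cV[R]_m)
    (q es : R -> 'I_l -> 'I_l -> R) (m2 m3 W : R) (law : R -> 'I_l -> R),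
    [/\ continuous_path T xis, forall t, 0 <= t <= T -> n1 (xi t - xis t) <= delta &
    [/\ 0 < m2, m2 <= 1, 1 <= m3,
        forall s i j, 0 <= s <= T -> (i, j) \in TT r -> m2 <= q s i j <= m3 &
        forall s i j, 0 <= s <= T -> 0 <= es s i j] /\
    [/\ forall i j, measurable_fun `[0, T] (fun s => q s i j),
        forall i j, measurable_fun `[0, T] (fun s => es s i j) &
        forall i j, measurable_fun (`[0, T] `*` `[0, zeta c])
          (fun p : R * R => step_control q es i j p.1 p.2)] /\
    [/\ 0 <= W, forall i s, 0 <= s <= T -> n1 (us i s) <= W &
        forall i k, measurable_fun `[0, T] (fun s => us i s k 0)] /\
    [/\ forall s, 0 <= s <= T -> prob_vec (law s),
        state_eq b a x0 T us xis law,
        {ae mu, forall s, 0 <= s <= T -> balanced (step_rate c r q es s (xis s)) (law s)} &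
        forall pis, measurable_prob T pis ->
          {ae mu, forall s, 0 <= s <= T -> law s = pis s} ->
          (forall i, (control_cost T us pis i < +oo)%E) /\
          (cost c r T us (step_control q es) pis <= cost c r T u phi p + delta%:E)%E]].
Proof.
move=> delta0; case: (adm) => _ phi_adm p_adm xi_eq phi_stat.
have [p_prob mp] := p_adm.
have u_meas := admissible_measurable_control adm; have iU := integrable_energy adm.
have jfin i j := admissible_jump_cost_fin adm cost_fin (i := i) (j := j).
have [Q [J [[Q0 J0] iQ iJ JE [QTT hae]]]] :=
  flux_data mc xi_cont phi_adm p_adm phi_stat jfin.
have [g [g0 [g00 gTT g_low g_itv g_bal]]] := reference_circulation mc r_ge0 l_gt0.
have [C1 C10 close] := closeness mc l_gt0 T_gt0 xi_cont u_meas p_prob mp xi_eq Q0 iQ iU.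
pose IE i := \int[mu]_(s in `[0, T]) energy u p i s.
pose IJ (ij : 'I_l * 'I_l) := \int[mu]_(s in `[0, T]) J s ij.1 ij.2.
(* Coefficient of [eps] in the increase of a jump cost. A control cost increases by half of
   [2 * eps] times the energy, hence the plain [IE i] in [C4]. *)
pose slope (ij : 'I_l * 'I_l) :=
  C1 * (cost_slope K kap cb * (IJ ij + T)) + (T + 1) * cost_reference kap cb (l := l).
pose C4 := \sum_i IE i + \sum_(ij : 'I_l * 'I_l | ij \in TT r) slope ij.
have cost0 : cost c r T u phi p =
    (\sum_i 2^-1 * IE i + \sum_(ij : 'I_l * 'I_l | ij \in TT r) IJ ij)%:E.
  rewrite EFinD -!sumEFin; congr (_ + _)%E.
    by apply: eq_bigr => i _; rewrite (control_costE adm) EFinM.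
  by apply: eq_bigr => -[i j] h; rewrite -JE.
(* With this denominator one [eps] brings both the distance [C1 * eps] and the cost increase
   [eps * C4] below [delta]. *)
have D1 : 0 < C1 + `|C4| by rewrite ltr_pwDl.
have [eps [N [eps_le sm]]] := small_exists u p_prob Q0 (divr_gt0 delta0 D1).
have eps0 := small_eps0 sm; have N0 := small_N sm.
have epsD : eps * (C1 + `|C4|) <= delta by rewrite -ler_pdivlMr.
have W0 : 0 <= @control_bound R m l eps N.
  rewrite divr_ge0 ?divr_ge0 ?(ltW eps0)//.
  by rewrite addr_ge0// mulr_ge0 ?sqr_ge0// ltW.
have lawP := mixed_law_prob l_gt0 p_prob sm.
have mlaw := measurable_mixed_law mp iQ iU eps N.
have mus := measurable_mixed_control l_gt0 u_meas p_prob mp iQ iU sm.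
have usW := mixed_control_bounded l_gt0 p_prob Q0 sm.
have [xis xis_cont xis_eq] := state_eq_exists x0 (mc_K mc) T_gt0 (mc_b mc) (mc_a mc)
  W0 lawP mlaw mus usW.
have xi_xis := close _ _ _ sm xis_cont xis_eq.
exists xis, (mixed_control u p Q eps N), (intensity c r u p Q g eps N xis), (edge c r xis),
  (intensity_low cb g0 eps), (@intensity_high R l kap cb eps N), (@control_bound R m l eps N),
  (mixed_law u p Q eps N).
split => //.
  move=> t tT; apply: (le_trans (xi_xis t tT)); apply: le_trans epsD.
  by rewrite mulrC ler_wpM2l ?(ltW eps0)// lerDl.
split.
  split.
  - exact: (intensity_low_gt0 mc g00 sm).
  - exact: intensity_low_le1.
  - exact: intensity_high_ge1.
  - exact: (intensity_itv mc l_gt0 p_prob Q0 g00 g_low g_itv sm).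
  - by move=> s i j; exact: (edge_ge0 mc).
split.
  split.
  - exact: (measurable_intensity mc l_gt0 p_prob mp g iQ iU sm xis_cont).
  - exact: (measurable_edge mc xis_cont).
  - exact: (measurable_step_control mc l_gt0 p_prob mp g iQ iU sm xis_cont).
split => //; split => //.
  by apply: ae_imp hae => s h sT; have [hQ _] := h sT;
    exact: (law_balanced mc l_gt0 p_prob QTT gTT g_bal sm xis sT hQ).
move=> pis pis_adm pis_law.
have cc := perturbed_control_cost l_gt0 u_meas p_prob mp iQ iU sm pis_adm pis_law.
have jc i j : (i, j) \in TT r -> (jump_cost c T (step_control
    (intensity c r u p Q g eps N xis) (edge c r xis)) pis i j
    <= (IJ (i, j) + eps * slope (i, j))%:E)%E.
  move=> hij.
  have tan : {ae mu, forall s, 0 <= s <= T -> forall y, 0 < y ->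
      Q s i j * ln y + p s i * rate c r (xi s) i j * (1 - y) <= J s i j}.
    by apply: ae_imp hae => s h sT; have [_ /(_ _ _ hij)] := h sT.
  apply: (le_trans (perturbed_jump_cost mc l_gt0 T_gt0 p_prob mp Q0 J0 iQ iJ g00 g_low g_itv
    iU sm xis_cont pis_adm pis_law xi_xis hij tan)).
  rewrite lee_fin -/(IJ (i, j)) /slope le_eqVlt; apply/orP; left; apply/eqP; ring.
split=> [i|]; first by apply: le_lt_trans (cc i) _; rewrite ltry.
rewrite cost0 -EFinD /cost.
apply: (@le_trans _ _ (\sum_i (2^-1 * ((1 + 2 * eps) * IE i)) +
  \sum_(ij : 'I_l * 'I_l | ij \in TT r) (IJ ij + eps * slope ij))%:E); last first.
  have -> : \sum_i (2^-1 * ((1 + 2 * eps) * IE i)) =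
      \sum_i 2^-1 * IE i + eps * \sum_i IE i.
    by rewrite mulr_sumr -big_split /=; apply: eq_bigr => i _; field.
  rewrite lee_fin big_split /= -[X in _ + (_ + X)]mulr_sumr addrACA -mulrDr lerD2l -/C4.
  apply: le_trans epsD; rewrite ler_wpM2l ?(ltW eps0)//.
  by apply: (le_trans (ler_norm C4)); rewrite lerDr ltW.
rewrite EFinD -!sumEFin; apply: leeD; last by apply: lee_sum => -[i j]; exact: jc.
apply: lee_sum => i _; rewrite EFinM; apply: lee_wpmul2l; last exact: cc.
by rewrite lee_fin invr_ge0.
Qed.

End Approximation.

Theorem proposition4p1 (R : realType) (d m l : nat) (T : R) (x0 : 'cV[R]_d)
  (b : 'cV[R]_d -> 'I_l -> 'cV[R]_d)
  (a : 'cV[R]_d -> 'I_l -> 'M[R]_(d, m))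
  (c : 'cV[R]_d -> 'I_l -> R)
  (r : 'cV[R]_d -> 'I_l -> 'I_l -> R)
  (T_gt0 : 0 < T)
  (c_ge0 : forall x y, 0 <= c x y)
  (r_01 : forall x y y', 0 <= r x y y' <= 1)
  (hA1 : A1 b a c r) (hA2 : A2 c r)
  (xi : R -> 'cV[R]_d) (xi_cont : continuous_path T xi)
  (I_fin : (rate_function b a c r x0 T xi < +oo)%E)
  (gamma : R) (gamma_01 : 0 < gamma < 1) :
  exists xis : R -> 'cV[R]_d,
    [/\ continuous_path T xis,
        (ereal_sup [set (enorm (xi s - xis s))%:E | s in `[0%R, T]] < gamma%:E)%E &
    exists (us : 'I_l -> R -> 'cV[R]_m) (phis : 'I_l -> 'I_l -> R -> R -> R)
           (pis : R -> 'I_l -> R),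
      admissible b a c r x0 T xis us phis pis /\
      [/\ (* 1 *)
          exists m2 m3 : R, [/\ 0 < m2, 0 < m3 &
            forall s z i j, 0 <= s <= T -> 0 <= z <= zeta c -> (i, j) \in TT r ->
              m2 <= phis i j s z <= m3],
          (* 2 and 3 *)
          exists rho : R -> 'cV[R]_d -> 'I_l -> R,
            [/\ (forall s x, 0 <= s <= T -> prob_vec (rho s x)) /\
                (forall i, measurable_fun (`[0, T] `*` [set: borel 'cV[R]_d])
                   (fun p : R * borel 'cV[R]_d => rho p.1 p.2 i)),
                forall s x, 0 <= s <= T ->
                  stationary c r (ext r phis s) x (rho s x),
                exists c1 : R, [/\ 0 < c1,
                  forall s i x x', 0 <= s <= T ->
                    `|rho s x i - rho s x' i| <= c1 * enorm (x - x') &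
                  forall s x i, 0 <= s <= T -> c1^-1 <= rho s x i],
                forall s x (p : 'I_l -> R), 0 <= s <= T -> prob_vec p ->
                  stationary c r (ext r phis s) x p -> p = rho s x &
                forall s, 0 <= s <= T -> rho s (xis s) = pis s],
          (* 4: the equation for the second component holds for a.e. time only,
             so that component is determined up to a null set of times. *)
          forall (xit : R -> 'cV[R]_d) (pit : R -> 'I_l -> R),
            continuous_path T xit -> measurable_prob T pit ->
            state_eq b a x0 T us xit pit ->
            stationary_eq c r T phis xit pit ->
            (forall t, 0 <= t <= T -> xit t = xis t) /\
            {ae lebesgue_measure, forall s : R, 0 <= s <= T -> pit s = pis s} &
          (* 5 *)
          (cost c r T us phis pis
             <= rate_function b a c r x0 T xi + gamma%:E)%E]].
Proof.
case/andP: gamma_01 => g0 _.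
have r_ge0 x i j : 0 <= r x i j by case/andP: (r_01 x i j).
have T0 : 0 <= (0 : R) <= T by rewrite lexx ltW.
(* A finite rate supplies an admissible triple, whose law is a probability vector; hence [l] is
   positive. *)
have l_gt0 : (0 < l)%N.
  have [_ [u [phi [p [[_ _ [pp _] _ _] _]]]] _] := ereal_inf_lt I_fin.
  exact: prob_vec_card (pp 0 T0).
have I_num : rate_function b a c r x0 T xi \is a fin_num.
  rewrite ge0_fin_numE//; apply: le_ereal_inf_tmp => _ [u [phi [p [adm ->]]]].
  exact: admissible_cost_ge0 adm.
(* One half for the near-optimality of the triple, the other for its perturbation; halving also
   makes the bound on the distance strict. *)
have gh : 0 < gamma / 2 by rewrite divr_gt0.
have [_ [u [phi [p [adm ->]]]] cost_lt] := lb_ereal_inf_adherent gh I_num.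
have cost_fin : (cost c r T u phi p < +oo)%E.
  by apply: (lt_trans cost_lt); rewrite -ge0_fin_numE ?fin_numD ?I_num//;
    apply: le_trans (ltW cost_lt); exact: admissible_cost_ge0 adm.
have [K [kap [cb mc]]] := model_constsP l_gt0 c_ge0 r_01 hA1 hA2.
have [xis [us [q [es [m2 [m3 [W [law [xis_cont xi_xis]]]]]]]]] :=
  approximation mc r_ge0 l_gt0 T_gt0 xi_cont adm cost_fin gh.
move=> [[m2_gt0 m2_le1 m3_ge1 q_itv es_ge0] [[mq mes msc] [[W0 usW mus]
  [law_prob xis_eq law_bal cost_le]]]].
have [rho [rho_prob mrho rho_bal [c1 [c10 rho_lip rho_low]] rho_uniq]] :=
  invariant_kernel mc r_ge0 l_gt0 m2_gt0 m2_le1 m3_ge1 q_itv es_ge0 mq mes.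
have stat s x v : 0 <= s <= T ->
    stationary c r (ext r (step_control q es) s) x v <-> balanced (step_rate c r q es s x) v.
  by move=> sT; exact: (stationary_step mc m2_gt0 q_itv es_ge0).
(* Read off the kernel at every time, so that agreement with [rho] along the path has no exceptional
   times; the mixed law agrees with it only almost everywhere. *)
pose pis s := rho s (xis s).
have mrho_path x i : continuous_path T x -> measurable_fun `[0, T] (fun s => rho s (x s) i).
  by apply: (measurable_along_path (h := fun s x => rho s x i)); exact: mrho.
have pis_adm : measurable_prob T pis.
  by split=> [s sT|i]; [exact: rho_prob|exact: mrho_path].
have law_pis : {ae lebesgue_measure, forall s : R, 0 <= s <= T -> law s = pis s}.
  by apply: ae_imp law_bal => s h sT; apply: rho_uniq => //; [exact: law_prob|exact: h].
have [ctrl_fin cost_pis] := cost_le _ pis_adm law_pis.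
have pis_eq : state_eq b a x0 T us xis pis.
  exact: (state_eq_ae T_gt0 (mc_b mc) (mc_a mc) xis_cont mus
    (fun i => mrho_path _ i xis_cont) law_pis xis_eq).
have m3_gt0 : 0 < m3 by exact: lt_le_trans m3_ge1.
have q_range i j s z : 0 <= s <= T -> (i, j) \in TT r ->
    m2 <= step_control q es i j s z <= m3.
  by move=> sT h; rewrite /step_control; case: ifP => _; [exact: q_itv|rewrite m2_le1].
exists xis; split => //.
  apply: (@le_lt_trans _ _ (gamma / 2)%:E); last first.
    by rewrite lte_fin ltr_pdivrMr// mulr_natr mulr2n ltrDr.
  apply: ge_ereal_sup => _ [s /= sT <-]; rewrite in_itv /= in sT.
  by rewrite lee_fin; apply: le_trans (xi_xis s sT); exact: enorm_le_n1.
exists us, (step_control q es), pis; split; first split => //.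
- by move=> i; split => //; exact: measurable_borel_cV.
- move=> i j h; split => // s z sT _; have /andP[h2 _] := q_range i j s z sT h.
  by apply: le_trans h2; exact: ltW.
- by apply: aeW => s sT; apply/stat => //; exact: rho_bal.
split.
- by exists m2, m3; split => // s z i j sT _; exact: q_range.
- exists rho; split => //.
  + by move=> s x sT; apply/stat => //; exact: rho_bal.
  + by exists c1.
  + by move=> s x v sT pv /(stat _ _ _ sT); exact: rho_uniq.
- move=> xit pit xit_cont [pit_prob mpit] xit_eq pit_stat.
  (* Uniqueness of the invariant law forces the competitor into the same feedback form, which
     reduces the claim to [state_eq_unique]. *)
  have pitE : {ae lebesgue_measure, forall s : R, 0 <= s <= T -> pit s = rho s (xit s)}.
    apply: ae_imp pit_stat => s h sT.
    by apply: rho_uniq => //; [exact: pit_prob|apply/stat => //; exact: h].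
  have xit_eq' : state_eq b a x0 T us xit (fun s => rho s (xit s)).
    exact: (state_eq_ae T_gt0 (mc_b mc) (mc_a mc) xit_cont mus
      (fun i => mrho_path _ i xit_cont) pitE xit_eq).
  have xitE : forall t, 0 <= t <= T -> xit t = xis t.
    apply: (state_eq_unique (mc_K mc) T_gt0 (mc_b mc) (mc_a mc) (ltW c10) W0 rho_prob
      _ usW xit_cont xis_cont xit_eq' pis_eq) => s i y y' sT.
    by apply: (le_trans (rho_lip _ _ _ _ sT)); rewrite ler_wpM2l ?(ltW c10) ?enorm_le_n1.
  split => //; apply: ae_imp pitE => s h sT.
  by rewrite h// xitE.
apply: (le_trans cost_pis); apply: (@le_trans _ _
  (rate_function b a c r x0 T xi + (gamma / 2)%:E + (gamma / 2)%:E)%E).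
  by rewrite leeD2r// ltW.
by rewrite -addeA -EFinD -splitr.
Qed.
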